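(* Let $m,n\ge0$, let $V$ be an orthosymplectic vector superspace with $\mathrm{sdim}(V)=(m|2n)$, and put $r_c:=(m+1)(n+1)$, $\lambda_c:=((2n+2)^{m+1})$. For every $r\ge r_c$ the set $$\Theta_r:=\{d(\mathfrak t)^{-1}\ast\Phi_\lambda\ \mid\ \lambda\in2\mathcal P_r,\ \lambda\supseteq\lambda_c,\ \mathfrak t\in\mathrm{Std}(\lambda)\}$$ forms a basis of $\mathrm{Ker}\,F_r^r$, where $F_r^r:B_r(m-2n)\to\mathrm{End}_{\mathrm{OSp}(V)}(V^{\otimes r})$.
   Context: Everything is over $\mathbb{C}$. $V=V_{\bar0}\oplus V_{\bar1}$ is a vector superspace with $\dim V_{\bar0}=m$, $\dim V_{\bar1}=2n$, equipped with a non-degenerate even bilinear form $(-,-)$ satisfying $(u,v)=(-1)^{[u][v]}(v,u)$ for homogeneous $u,v$ ($[v]$ is the parity). $\mathfrak{osp}(V)$ is the Lie superalgebra preserving the form and $\mathrm{OSp}(V)$ denotes the Harish-Chandra pair $(\mathrm{O}(V_{\bar0})\times\mathrm{Sp}(V_{\bar1}),\mathfrak{osp}(V))$; $\mathrm{Hom}_{\mathrm{OSp}(V)}(M,N)$ is the space of linear maps $\phi$ with $g\phi g^{-1}=\phi$ for $g\in\mathrm{O}(V_{\bar0})\times\mathrm{Sp}(V_{\bar1})$ and $X\phi(v)=(-1)^{[X][\phi]}\phi(Xv)$ for $X\in\mathfrak{osp}(V)$. Brauer diagrams. A Brauer $(k,l)$-diagram is a perfect matching of $k$ bottom and $l$ top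 vertices (each row numbered left to right); $B_k^l(\delta)$ is the vector space with these as basis. $D_1\circ D_2$ is obtained by stacking $D_1$ above $D_2$, identifying the middle vertices, and replacing each closed loop by a factor $\delta$; $D_1\otimes D_2$ is juxtaposition ($D_2$ to the right of $D_1$). $B_r(\delta)=B_r^r(\delta)$ is the Brauer algebra, with unit $I_r$. $I\in B_1^1$ is the single vertical strand, $X\in B_2^2$ the crossing, $A_0\in B_2^0$ and $U_0\in B_0^2$ the single arcs. There is a unique linear assignment $F$ compatible with $\circ$ and $\otimes$, with components $F_k^l:B_k^l(m-2n)\to\mathrm{Hom}_{\mathrm{OSp}(V)}(V^{\otimes k},V^{\otimes l})$, such that $F(I)=\mathrm{id}_V$, $F(X)(v\otimes w)=(-1)^{[v][w]}w\otimes v$, $F(A_0)(v\otimes w)=(v,w)$, $F(U_0)(1)=\sum_a v_a\otimes\bar v_a$, where $(v_a)$ is a homogeneous basis and $(\bar v_a)$ satisfies $(\bar v_a,v_b)=\delta_{ab}$. Permutations are regarded as Brauer diagrams joining bottom vertex $i$ to top vertex $\sigma(i)$, so products in $\mathbb{C}\mathrm{Sym}_{2r}$ are compositions of functions. Label the $i$-th top vertex of a Brauer $(r,r)$-diagram by $2i-1$ and the $i$-th bottom vertex by $2i$. $\mathrm{Sym}_{2r}$ acts on the left on $B_r(m-2n)$ by $\sigma\ast D$ := the diagram with edges $\{\sigma(a),\sigma(b)\}$ for each edge $\{a,b\}$ of $D$, extended linearly to $\mathbb{C}\mathrm{Sym}_{2r}$. $\mathbb U_r:B_{2r}^0(m-2n)\to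 B_r(m-2n)$ is the linear isomorphism sending a diagram $A$ on bottom vertices $1,\dots,2r$ to the $(r,r)$-diagram with the same edges in this labelling. $\hat A^r\in B_{2r}^0$ is the diagram with edges $\{2i-1,2i\}$, $1\le i\le r$. Tableaux. $2\mathcal P_r$ is the set of partitions of $2r$ with all parts even; $(a^b)$ is the partition with $b$ rows of length $a$; $\supseteq$ is containment of Young diagrams; $\mathrm{Std}(\lambda)$ is the set of standard $\lambda$-tableaux; $\mathfrak t^\lambda$ is the one with $1,2,\dots$ filled in order along successive rows. $x_\lambda$ is the sum of all elements of the row stabiliser of $\mathfrak t^\lambda$, $y_\lambda=\sum\epsilon(\sigma)\sigma$ over its column stabiliser ($\epsilon$ the sign), $\mathfrak c_\lambda=x_\lambda y_\lambda$. $\mathrm{Sym}_{2r}$ acts on the right on tableaux: $\mathfrak t\sigma$ is obtained from $\mathfrak t$ by replacing each entry $a$ by $\sigma^{-1}(a)$; $d(\mathfrak t)$ is defined by $\mathfrak t=\mathfrak t^\lambda d(\mathfrak t)$ (so $d(\mathfrak t)^{-1}$ maps the entry of $\mathfrak t^\lambda$ in each box to the entry of $\mathfrak t$ in that box). Finally $\Phi_\lambda:=\mathbb U_r(\hat A^r\circ\mathfrak c_\lambda)=(y_\lambda x_\lambda)\ast I_r$. *)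

(* Defs.v *)
From mathcomp Require Export all_boot all_order all_algebra all_fingroup.
From mathcomp Require Export reals complex.
From HB Require Import structures.

Set Implicit Arguments.
Unset Strict Implicit.
Unset Printing Implicit Defensive.

Import GRing.Theory.
Local Open Scope ring_scope.

(* The parity [true] is odd, so that the sign rule is [(-1) ^+ (a && b)]. *)
Definition grade (K : fieldType) (V : vectType K) (V0 V1 : {vspace V})
  (a : bool) : {vspace V} := if a then V1 else V0.

Record osp_space (K : fieldType) (m n : nat) := OspSpace {
  osp_sort :> vectType K;
  even_part : {vspace osp_sort};
  odd_part : {vspace osp_sort};
  osp_form : {biscalar osp_sort};
  osp_total : (even_part + odd_part)%VS = fullv;
  osp_direct : (even_part :&: odd_part)%VS = 0%VS;
  osp_dim_even : \dim even_part = m;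
  osp_dim_odd : \dim odd_part = (2 * n)%N;
  osp_form_even : forall a b u v,
    u \in grade even_part odd_part a -> v \in grade even_part odd_part b ->
    a != b -> osp_form u v = 0;
  osp_form_sym : forall a b u v,
    u \in grade even_part odd_part a -> v \in grade even_part odd_part b ->
    osp_form u v = (-1) ^+ (a && b) * osp_form v u;
  osp_form_nondeg : forall u, (forall v, osp_form u v = 0) -> u = 0
}.

Section TensorPowers.
Variables (K : fieldType) (m n : nat) (V : osp_space K m n).

Definition vgrade (a : bool) : {vspace V} :=
  grade (even_part V) (odd_part V) a.

Definition sdimn : nat := (\dim (even_part V) + \dim (odd_part V))%N.

(* A homogeneous basis, used only to give coordinates on tensor powers. *)
Definition hbasis : sdimn.-tuple V :=
  [tuple of vbasis (even_part V) ++ vbasis (odd_part V)].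

Definition idx_parity (i : 'I_sdimn) : bool := (\dim (even_part V) <= i)%N.

(* An element of the k-th tensor power of V is given by its coordinates on the
   tensors hbasis_(f 0) (x) ... (x) hbasis_(f (k-1)). *)
Definition mindex (k : nat) := {ffun 'I_k -> 'I_sdimn}.
Definition tpow (k : nat) := {ffun mindex k -> K^o}.

Definition ptens k (v : 'I_k -> V) : tpow k :=
  [ffun f : mindex k => \prod_(i < k) coord hbasis (f i) (v i)].

Definition tens2 (v w : V) : tpow 2 := ptens (tnth [tuple v; w]).

(* The identification of K with the zeroth tensor power. *)
Definition tscal (c : K) : tpow 0 := [ffun _ => c].

Definition tbase k (f : mindex k) : tpow k :=
  ptens (fun i => tnth hbasis (f i)).

Definition mleft k l (f : mindex (k + l)) : mindex k :=
  [ffun i => f (lshift l i)].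
Definition mright k l (f : mindex (k + l)) : mindex l :=
  [ffun i => f (rshift k i)].

(* The identification of V^(x)k (x) V^(x)l with V^(x)(k + l). *)
Definition tprod k l (x : tpow k) (y : tpow l) : tpow (k + l) :=
  [ffun f => x (mleft f) * y (mright f)].

Definition mparity k (f : mindex k) : bool := odd (\sum_(i < k) idx_parity (f i)).

Definition tpart k (a : bool) : 'End(tpow k) :=
  linfun (fun x : tpow k =>
    [ffun f => if mparity f == a then x f else 0] : tpow k).

Definition hom_part k l (a : bool) (phi : 'Hom(tpow k, tpow l)) :
    'Hom(tpow k, tpow l) :=
  \sum_(b : bool) (tpart l (a (+) b) \o phi \o tpart k b)%VF.

(* (phi (x) psi)(x (x) y) = (-1)^([psi][x]) phi(x) (x) psi(y). *)
Definition tens_hom k l k' l'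
    (phi : 'Hom(tpow k, tpow l)) (psi : 'Hom(tpow k', tpow l')) :
    'Hom(tpow (k + k'), tpow (l + l')) :=
  linfun (fun z : tpow (k + k') =>
    \sum_(f : mindex (k + k')) z f *: \sum_(b : bool)
      (-1) ^+ (b && mparity (mleft f)) *:
        tprod (phi (tbase (mleft f))) (hom_part b psi (tbase (mright f)))).

(* The elements of O(V_0) x Sp(V_1), as even isometries of V. *)
Definition OxSp (g : 'End(V)) : Prop :=
  [/\ lker g = 0%VS,
      forall a v, v \in vgrade a -> g v \in vgrade a
    & forall u v, osp_form V (g u) (g v) = osp_form V u v].

Definition osp (p : bool) (X : 'End(V)) : Prop :=
  (forall a v, v \in vgrade a -> X v \in vgrade (p (+) a)) /\
  (forall a u v, u \in vgrade a ->
     osp_form V (X u) v + (-1) ^+ (p && a) * osp_form V u (X v) = 0).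

Definition grp_act k (g : 'End(V)) : 'End(tpow k) :=
  linfun (fun x : tpow k =>
    \sum_(f : mindex k) x f *: ptens (fun i => g (tnth hbasis (f i)))).

Definition lie_act k (p : bool) (X : 'End(V)) : 'End(tpow k) :=
  linfun (fun x : tpow k =>
    \sum_(f : mindex k) x f *: \sum_(i < k)
      (-1) ^+ (p * \sum_(j < k | (j < i)%N) idx_parity (f j))%N *:
        ptens (fun j => if j == i then X (tnth hbasis (f j))
                        else tnth hbasis (f j))).

Definition OSp_hom k l (phi : 'Hom(tpow k, tpow l)) : Prop :=
  (forall g, OxSp g -> (grp_act l g \o phi \o grp_act k g^-1)%VF = phi) /\
  (forall p X, osp p X ->
     (lie_act l p X \o phi)%VF =
     \sum_(b : bool) (-1) ^+ (p && b) *: (hom_part b phi \o lie_act k p X)%VF).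

End TensorPowers.

(* A perfect matching is encoded by the map sending a vertex to its partner. *)
Definition is_matching (T : finType) (f : {ffun T -> T}) : bool :=
  [forall x, (f x != x) && (f (f x) == x)].

Record matching (T : finType) := Matching {
  partner :> {ffun T -> T};
  partnerP : is_matching partner
}.

HB.instance Definition _ (T : finType) := [isSub for @partner T].
HB.instance Definition _ (T : finType) := [Countable of matching T by <:].
HB.instance Definition _ (T : finType) := [Finite of matching T by <:].

Lemma mk_matchingP (T : finType) (f : T -> T) :
  (forall x, f x != x) -> involutive f -> is_matching (finfun f).
Proof.
by move=> f_neq fK; apply/forallP=> x; rewrite !ffunE f_neq fK eqxx.
Qed.

Definition mk_matching (T : finType) (f : T -> T)
    (f_neq : forall x, f x != x) (fK : involutive f) : matching T :=
  Matching (mk_matchingP f_neq fK).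

Lemma partner_neq (T : finType) (D : matching T) x : D x != x.
Proof. by have /forallP/(_ x)/andP[] := partnerP D. Qed.

Lemma partnerK (T : finType) (D : matching T) : involutive D.
Proof. by move=> x; have /forallP/(_ x)/andP[_ /eqP] := partnerP D. Qed.

Section Relabel.
Variables (T T' : finType) (h : T -> T') (h' : T' -> T).
Hypotheses (hK : cancel h h') (h'K : cancel h' h).

Lemma relabel_neq (D : matching T) x : h (D (h' x)) != x.
Proof. by rewrite (can2_eq hK h'K) partner_neq. Qed.

Lemma relabel_inv (D : matching T) : involutive (fun x => h (D (h' x))).
Proof. by move=> x; rewrite hK partnerK h'K. Qed.

(* The matching with edges {h a, h b} for {a, b} an edge of D. *)
Definition relabel (D : matching T) : matching T' :=
  mk_matching (relabel_neq D) (relabel_inv D).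

End Relabel.

(* A (k, l)-diagram: [inl] is the bottom row, [inr] the top row. *)
Definition brauer (k l : nat) := matching ('I_k + 'I_l)%type.

Definition perm_fun k (s : {perm 'I_k}) (x : 'I_k + 'I_k) : 'I_k + 'I_k :=
  match x with inl i => inr (s i) | inr j => inl ((s^-1)%g j) end.

Lemma perm_fun_neq k (s : {perm 'I_k}) x : perm_fun s x != x.
Proof. by case: x. Qed.

Lemma perm_funK k (s : {perm 'I_k}) : involutive (perm_fun s).
Proof. by case=> i /=; rewrite ?permK ?permKV. Qed.

Definition perm_diag k (s : {perm 'I_k}) : brauer k k :=
  mk_matching (perm_fun_neq s) (@perm_funK k s).

Definition I_diag (r : nat) : brauer r r := perm_diag 1%g.
Definition X_diag : brauer 2 2 := perm_diag (tperm ord0 ord_max).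

Lemma ltn_double_half r (j : 'I_(r.*2)) : (j./2 < r)%N.
Proof. by rewrite ltn_half_double. Qed.
Lemma ltn_even_label r (i : 'I_r) : (i.*2 < r.*2)%N.
Proof. by rewrite ltn_double. Qed.
Lemma ltn_odd_label r (i : 'I_r) : (i.*2.+1 < r.*2)%N.
Proof. by rewrite ltn_Sdouble. Qed.

(* Counting from 0: the i-th top vertex is labelled 2 i and the i-th bottom
   vertex 2 i + 1. *)
Definition label r (x : 'I_r + 'I_r) : 'I_(r.*2) :=
  match x with
  | inl i => Ordinal (ltn_odd_label i)
  | inr i => Ordinal (ltn_even_label i)
  end.

Definition unlabel r (j : 'I_(r.*2)) : 'I_r + 'I_r :=
  if odd j then inl (Ordinal (ltn_double_half j))
  else inr (Ordinal (ltn_double_half j)).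

Lemma labelK r : cancel (@label r) (@unlabel r).
Proof.
case=> i; rewrite /unlabel /= odd_double /=; congr (_ _); apply/val_inj => /=.
  by rewrite uphalf_double.
by rewrite doubleK.
Qed.

Lemma unlabelK r : cancel (@unlabel r) (@label r).
Proof.
move=> j; apply/val_inj; have := odd_double_half j.
by rewrite /unlabel; case: (odd j).
Qed.

Definition bottom k (x : 'I_k + 'I_0) : 'I_k :=
  match x with inl i => i | inr j => False_rect _ (notF (ltn_ord j)) end.

Lemma inlK0 k : cancel (inl : 'I_k -> 'I_k + 'I_0) (@bottom k).
Proof. by []. Qed.

Lemma bottomK k : cancel (@bottom k) (inl : 'I_k -> 'I_k + 'I_0).
Proof. by case=> [//|[]]. Qed.

Lemma unbend_can r :
  cancel (@unlabel r \o @bottom r.*2) (inl \o @label r).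
Proof. by move=> x /=; rewrite unlabelK bottomK. Qed.

Lemma bend_can r :
  cancel (inl \o @label r) (@unlabel r \o @bottom r.*2).
Proof. by move=> x /=; rewrite labelK. Qed.

(* The map U_r on diagrams. *)
Definition unbend r : brauer r.*2 0 -> brauer r r :=
  relabel (@unbend_can r) (@bend_can r).


Lemma ltn_pair r (j : 'I_(r.*2)) : ((if odd j then j.-1 else j.+1) < r.*2)%N.
Proof.
case: ifP => odd_j; first by rewrite (leq_ltn_trans (leq_pred j)).
rewrite ltn_neqAle ltn_ord andbT; apply/eqP=> /(congr1 odd).
by rewrite /= odd_j odd_double.
Qed.

Definition pair_fun r (x : 'I_(r.*2) + 'I_0) : 'I_(r.*2) + 'I_0 :=
  inl (Ordinal (ltn_pair (bottom x))).

Lemma pair_fun_neq r (x : 'I_(r.*2) + 'I_0) : pair_fun x != x.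
Proof.
rewrite -[X in _ != X]bottomK; apply/eqP=> -[/(congr1 val)] /=.
by case: (bottom x) => -[|j] _ //=; case: odd => /=;
   [move/esym; apply: n_Sn | apply: n_Sn].
Qed.

Lemma pair_funK r : involutive (@pair_fun r).
Proof.
move=> x; rewrite -[RHS]bottomK; congr inl; apply/val_inj => /=.
by case: (bottom x) => -[|j] _ //=; case odd_j: (odd j); rewrite /= ?odd_j.
Qed.

(* Counting from 0, the edges of \hat A^r are {2 i, 2 i + 1}. *)
Definition Ahat (r : nat) : brauer r.*2 0 :=
  mk_matching (@pair_fun_neq r) (@pair_funK r).

Definition A_diag : brauer 2 0 := Ahat 1.

Definition swap_sum (S T : Type) (x : S + T) : T + S :=
  match x with inl i => inr i | inr j => inl j end.

Lemma swap_sumK S T : cancel (@swap_sum S T) (@swap_sum T S).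
Proof. by case. Qed.

Definition U_diag : brauer 0 2 :=
  relabel (@swap_sumK 'I_2 'I_0) (@swap_sumK 'I_0 'I_2) A_diag.

Section SymAction.
Variables (r : nat) (s : {perm 'I_(r.*2)}).

Lemma sym_can : cancel (fun x : 'I_r + 'I_r => unlabel (s (label x)))
                       (fun x => unlabel ((s^-1)%g (label x))).
Proof. by move=> x; rewrite unlabelK permK labelK. Qed.

Lemma sym_can' : cancel (fun x : 'I_r + 'I_r => unlabel ((s^-1)%g (label x)))
                        (fun x => unlabel (s (label x))).
Proof. by move=> x; rewrite unlabelK permKV labelK. Qed.

Definition sym_diag : brauer r r -> brauer r r := relabel sym_can sym_can'.

End SymAction.

Section Juxtapose.
Variables (k l k' l' : nat).
Local Notation T := (('I_k + 'I_l) + ('I_k' + 'I_l'))%type.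
Local Notation T' := ('I_(k + k') + 'I_(l + l'))%type.

Definition juxt_emb (x : T) : T' :=
  match x with
  | inl (inl i) => inl (lshift k' i)
  | inl (inr j) => inr (lshift l' j)
  | inr (inl i) => inl (rshift k i)
  | inr (inr j) => inr (rshift l j)
  end.

Definition juxt_proj (x : T') : T :=
  match x with
  | inl i => match split i with inl a => inl (inl a) | inr b => inr (inl b) end
  | inr j => match split j with inl a => inl (inr a) | inr b => inr (inr b) end
  end.

Lemma juxt_embK : cancel juxt_emb juxt_proj.
Proof.
by case=> -[] i /=; rewrite ?(unsplitK (inl _)) ?(unsplitK (inr _)).
Qed.

Lemma juxt_projK : cancel juxt_proj juxt_emb.
Proof.
by case=> i /=; rewrite -[in RHS](splitK i); case: (split i).
Qed.

Definition juxt_fun (D : matching ('I_k + 'I_l)%type)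
    (E : matching ('I_k' + 'I_l')%type) (x : T) : T :=
  match x with inl a => inl (D a) | inr b => inr (E b) end.

Lemma juxt_fun_neq D E x : juxt_fun D E x != x.
Proof. by case: x => a; apply: (partner_neq _ a). Qed.

Lemma juxt_funK D E : involutive (juxt_fun D E).
Proof. by case=> a /=; rewrite partnerK. Qed.

Definition juxt_diag (D : brauer k l) (E : brauer k' l') :
    brauer (k + k') (l + l') :=
  relabel juxt_embK juxt_projK
    (mk_matching (juxt_fun_neq D E) (@juxt_funK D E)).

End Juxtapose.

(* D1 is stacked above D2; the vertices are the bottom, middle and top rows. *)
Section Stack.
Variables (k l p : nat) (D1 : brauer l p) (D2 : brauer k l).
Local Notation T := ('I_k + 'I_l + 'I_p)%type.

Definition lower_vertex (x : 'I_k + 'I_l) : T := inl x.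
Definition upper_vertex (x : 'I_l + 'I_p) : T :=
  match x with inl j => inl (inr j) | inr i => inr i end.
Definition outer_vertex (x : 'I_k + 'I_p) : T :=
  match x with inl i => inl (inl i) | inr j => inr j end.

Definition stack_edge : rel T := fun x y =>
  [exists a, (x == lower_vertex a) && (y == lower_vertex (D2 a))] ||
  [exists a, (x == upper_vertex a) && (y == upper_vertex (D1 a))].

Definition stack_loops : nat :=
  n_comp stack_edge
    [pred x | [forall a, ~~ connect stack_edge (outer_vertex a) x]].

(* Each component containing an outer vertex contains exactly two of them, so
   there is exactly one such diagram D. *)
Definition is_stack (D : brauer k p) : bool :=
  [forall a, connect stack_edge (outer_vertex a) (outer_vertex (D a))].

End Stack.

Section BrauerSpaces.
Variable (K : fieldType).

Definition bspace (k l : nat) := {ffun brauer k l -> K^o}.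

Definition bvec k l (D : brauer k l) : bspace k l :=
  [ffun E => (E == D)%:R].

Definition lin_ext k l k' l' (h : brauer k l -> brauer k' l')
    (x : bspace k l) : bspace k' l' := \sum_D x D *: bvec (h D).

Definition bcomp (delta : K) k l p (x : bspace l p) (y : bspace k l) :
    bspace k p :=
  \sum_D1 \sum_D2 (x D1 * y D2 * delta ^+ stack_loops D1 D2) *:
    \sum_(D | is_stack D1 D2 D) bvec D.

Definition bjuxt k l k' l' (x : bspace k l) (y : bspace k' l') :
    bspace (k + k') (l + l') :=
  \sum_D1 \sum_D2 (x D1 * y D2) *: bvec (juxt_diag D1 D2).

Definition sym_act r (s : {perm 'I_(r.*2)}) : bspace r r -> bspace r r :=
  lin_ext (sym_diag s).

Definition U_map r : bspace r.*2 0 -> bspace r r := lin_ext (@unbend r).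

Definition bdelta (m n : nat) : K := m%:R - (2 * n)%:R.

Record brauer_functor (m n : nat) (V : osp_space K m n)
    (F : forall k l, 'Hom(bspace k l, 'Hom(tpow V k, tpow V l))) : Prop :=
  BrauerFunctor {
  F_OSp : forall k l (x : bspace k l), OSp_hom (F k l x);
  F_comp : forall k l p (x : bspace l p) (y : bspace k l),
    F k p (bcomp (bdelta m n) x y) = (F l p x \o F k l y)%VF;
  F_tens : forall k l k' l' (x : bspace k l) (y : bspace k' l'),
    F (k + k')%N (l + l')%N (bjuxt x y) = tens_hom (F k l x) (F k' l' y);
  F_I : F 1 1 (bvec (I_diag 1)) = \1%VF;
  F_X : forall a b (v w : V), v \in vgrade V a -> w \in vgrade V b ->
    F 2 2 (bvec X_diag) (tens2 v w) = (-1) ^+ (a && b) *: tens2 w v;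
  F_A : forall v w : V,
    F 2 0 (bvec A_diag) (tens2 v w) = tscal V (osp_form V v w);
  F_U : exists e e' : (sdimn V).-tuple V,
    [/\ basis_of fullv e,
        forall i, exists a, tnth e i \in vgrade V a,
        forall i j, osp_form V (tnth e' i) (tnth e j) = (i == j)%:R
      & F 0 2 (bvec U_diag) (tscal V 1) = \sum_i tens2 (tnth e i) (tnth e' i)]
}.

End BrauerSpaces.

Definition is_partition (N : nat) (s : seq nat) : bool :=
  [&& sorted geq s, 0%N \notin s & sumn s == N].

(* All partitions of N, without repetition. *)
Definition partitions (N : nat) : seq (seq nat) :=
  [seq s <- [seq [seq nat_of_ord i | i <- u] | u : {bseq N of 'I_N.+1}]
         | is_partition N s].

Lemma mem_partitions N s : (s \in partitions N) = is_partition N s.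
Proof.
rewrite mem_filter andb_idr // => /and3P[_ s_gt0 /eqP sum_s].
have le_s x : x \in s -> (x < N.+1)%N.
  rewrite ltnS -sum_s => s_x; have /perm_sumn -> := perm_to_rem s_x.
  exact: leq_addr.
have size_s : (size [seq inord x : 'I_N.+1 | x <- s] <= N)%N.
  rewrite size_map -sum_s; elim: s s_gt0 {sum_s le_s} => //= x s IHs.
  rewrite inE negb_or eq_sym -lt0n => /andP[x_gt0 /IHs le_s].
  by rewrite -add1n leq_add.
apply/mapP; exists (Bseq size_s); rewrite ?mem_enum //= -map_comp.
by rewrite -[LHS]map_id; apply/eq_in_map=> x /le_s lt_x /=; rewrite inordK.
Qed.

Lemma partitions_uniq N : uniq (partitions N).
Proof.
rewrite filter_uniq // map_inj_uniq ?enum_uniq // => u v.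
by move/(inj_map val_inj)/val_inj.
Qed.

Definition even_partitions (r : nat) : seq (seq nat) :=
  [seq la <- partitions r.*2 | all (fun i => ~~ odd i) la].

Definition contains (la mu : seq nat) : bool :=
  [forall i : 'I_(size mu), nth 0 mu i <= nth 0 la i]%N.

Section Tableaux.
Variable N : nat.

(* The list of rows; the entries 1, ..., N are shifted to 0, ..., N - 1. *)
Definition tableau := seq (seq 'I_N).

Definition row_of (t : tableau) (a : 'I_N) : nat := find (fun s => a \in s) t.
Definition col_of (t : tableau) (a : 'I_N) : nat :=
  index a (nth [::] t (row_of t a)).

Definition t_row (la : seq nat) : tableau := reshape la (enum 'I_N).

Definition is_standard (t : tableau) : bool :=
  [forall a, forall b,
    ((row_of t a == row_of t b) && (col_of t a < col_of t b)%N ||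
     (col_of t a == col_of t b) && (row_of t a < row_of t b)%N) ==> (a < b)%N].

(* All standard la-tableaux, without repetition. *)
Definition Std (la : seq nat) : seq tableau :=
  [seq t <- [seq reshape la w | w <- permutations (enum 'I_N)]
         | is_standard t].

Definition row_stab (t : tableau) : {set {perm 'I_N}} :=
  [set s : {perm 'I_N} | [forall a, row_of t (s a) == row_of t a]].
Definition col_stab (t : tableau) : {set {perm 'I_N}} :=
  [set s : {perm 'I_N} | [forall a, col_of t (s a) == col_of t a]].

Definition tab_act (t : tableau) (s : {perm 'I_N}) : tableau :=
  [seq [seq (s^-1)%g a | a <- row] | row <- t].

(* The permutation d with t = t^la d; it is unique when t is a la-tableau. *)
Definition tab_perm (la : seq nat) (t : tableau) : {perm 'I_N} :=
  odflt 1%g [pick d | t == tab_act (t_row la) d].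

(* Elements of the group algebra of Sym_N, inside the Brauer algebra B_N. *)
Variable (K : fieldType).

Definition x_elt (la : seq nat) : bspace K N N :=
  \sum_(s in row_stab (t_row la)) bvec K (perm_diag s).
Definition y_elt (la : seq nat) : bspace K N N :=
  \sum_(s in col_stab (t_row la)) (-1) ^+ odd_perm s *: bvec K (perm_diag s).

End Tableaux.

Definition c_elt (K : fieldType) (delta : K) (N : nat) (la : seq nat) :
    bspace K N N :=
  bcomp delta (x_elt N K la) (y_elt N K la).

Definition Phi (K : fieldType) (delta : K) (r : nat) (la : seq nat) :
    bspace K r r :=
  U_map (bcomp delta (bvec K (Ahat r)) (c_elt delta r.*2 la)).

Definition lambda_c (m n : nat) : seq nat := nseq m.+1 (2 * n + 2)%N.

(* The family Theta_r, indexed by the pairs (la, t). *)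
Definition Theta (K : fieldType) (m n r : nat) : seq (bspace K r r) :=
  [seq sym_act ((tab_perm la t)^-1)%g (Phi (bdelta K m n) r la)
     | la <- [seq mu <- even_partitions r | contains mu (lambda_c m n)],
       t <- Std r.*2 la].

(* Main.v *)
From HB Require Import structures.
Require Import Defs.
From mathcomp Require Import zify.
Import GRing.Theory Num.Theory.
Local Open Scope ring_scope.
Set Implicit Arguments.
Unset Strict Implicit.
Unset Printing Implicit Defensive.

(** Bending the bottom row of an (r, r)-diagram upwards turns it into a perfect matching of 2r
labels, so that B_r becomes the permutation module M of Sym_2r on matchings, generated by the
matching [M0] with edges {2i, 2i + 1}, and an endomorphism of the r-th tensor power of V becomes a
functional on the 2r-th one.  Since the form is non-degenerate, a combination of diagrams is killed
by F exactly when the functional [cap_form] of the bent combination vanishes ([bend_kernel]).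
As Sym_2r acts on functionals by signed permutations of the factors, the kernel is a submodule of
M, and the theorem is a statement about the submodules of M.

On the side of representations, write r_la and c_la for the row sum and the signed column sum of the
superstandard la-tableau, so that Phi_la is the vector u_la = c_la r_la M0 ([Phi_unfold]).  For any
set of even partitions la the vectors d(t)^-1 u_la, with t standard, are free: given a relation, take the
shape la of least weight in it; a suitable c_la s kills all the other shapes and turns the
la-part into a non-zero multiple of u_la ([shape_detect]).  There are at least (2r - 1)!!
standard tableaux whose shape is a partition of 2r with even parts, by the commutation relation of
the operators that add and remove a box ([standard_count]), and there are at most (2r - 1)!!
matchings; so over all even partitions these vectors form a basis of M ([theta_basis]).  A
submodule that contains u_la for the shapes la of a set P, and does not contain r_la c_la M0 for
the other ones, then has for basis the vectors of the shapes of P: if a combination of the other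
vectors lay in it, so would some u_la with la outside P, hence r_la u_la, of which r_la c_la M0 is
a multiple ([rsym_casym_d0], [theta_kernel_basis]).

On the side of tensors, both conditions depend on whether la has a box in row m + 1 and column
2n + 1; for an even partition this is the condition that la contains ((2n + 2)^(m + 1)).

If there is such a box, already the row symmetriser times the column antisymmetriser of the
rectangle with m + 1 rows and 2n + 1 columns is zero on the tensor power ([rect_op_filling],
[cap_form_uvec0]): 2n + 1 odd vectors are linearly dependent, and m + 1 even basis vectors in one
column cannot be distinct.  The two facts are combined by an exchange argument with m + 2 entries,
two of which must share a row ([rect_op_dependent]).

If there is no such box, the functional of r_la c_la M0 is evaluated at the word that repeats, in
each of the first m rows, one vector of an orthogonal basis of the even part, and carries in the
columns below a symplectic basis of the odd part.  The value is a non-zero multiple of a scalar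
product of the form <h, sum of the s h>, where s runs over permutations of the lower rows; it is a
positive multiple of the square norm of the sum, which is not zero
([cap_form_rsym_casym_neq0]). *)

(** * Rows and columns of the superstandard tableau *)

Section Coordinates.
Variables (N : nat) (la : seq nat) (w : seq 'I_N).
Hypotheses (w_uniq : uniq w) (size_w : size w = sumn la).

(** Filling by rows and reading by rows are inverse to each other, so the box of an entry is read
off from its position in the reading word. *)
Lemma mem_reshape_coords a r (t := reshape la w) :
  a \in nth [::] t r ->
  r = reshape_index la (index a w) /\
  index a (nth [::] t r) = reshape_offset la (index a w).
Proof.
move=> ar; set c := index a (nth _ _ _).
have shape_t : shape t = la by rewrite reshapeKl ?size_w.
have flat_t : flatten t = w by rewrite reshapeKr ?size_w.
have lt_c : (c < nth 0 la r)%N.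
  rewrite -shape_t /shape; case: (ltnP r (size t)) => lt_r.
    by rewrite (nth_map [::]) // /c index_mem.
  by move: ar; rewrite nth_default.
have: nth a w (flatten_index la r c) = a.
  by rewrite -flat_t nth_flatten shape_t flatten_indexKl ?flatten_indexKr ?nth_index.
move/(congr1 (index^~ w)); rewrite index_uniq //; last first.
  by rewrite size_w flatten_indexP.
by move<-; rewrite flatten_indexKl ?flatten_indexKr.
Qed.

Hypothesis w_full : forall a, a \in w.

Lemma coords_reshape a (t := reshape la w) :
  row_of t a = reshape_index la (index a w) /\
  col_of t a = reshape_offset la (index a w).
Proof.
have has_a : has (fun s : seq 'I_N => a \in s) t.
  have : a \in flatten t by rewrite reshapeKr ?size_w.
  by case/flattenP=> s st as_; apply/hasP; exists s.
have/mem_reshape_coords[] := nth_find [::] has_a.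
by rewrite /col_of /row_of => <- <-.
Qed.

End Coordinates.

Section Superstandard.
Variables (N : nat) (la : seq nat).
Hypothesis la_part : is_partition N la.

Definition trow (a : 'I_N) := row_of (t_row N la) a.
Definition tcol (a : 'I_N) := col_of (t_row N la) a.

Lemma sumn_part : sumn la = N. Proof. by case/and3P: la_part => _ _ /eqP. Qed.

Lemma tcoordsE a :
  trow a = reshape_index la a /\ tcol a = reshape_offset la a.
Proof.
rewrite -[X in reshape_index _ X]index_enum_ord -[X in reshape_offset _ X]index_enum_ord.
apply: coords_reshape; rewrite ?enum_uniq ?size_enum_ord ?sumn_part //.
by move=> b; rewrite mem_enum.
Qed.

Lemma trowE a : trow a = reshape_index la a. Proof. by have [] := tcoordsE a. Qed.
Lemma tcolE a : tcol a = reshape_offset la a. Proof. by have [] := tcoordsE a. Qed.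

Lemma tcol_lt a : (tcol a < nth 0 la (trow a))%N.
Proof. by rewrite tcolE trowE reshape_offsetP // sumn_part. Qed.

Lemma trow_lt a : (trow a < size la)%N.
Proof. by rewrite trowE reshape_indexP // sumn_part. Qed.

Lemma flatten_tcoords a : flatten_index la (trow a) (tcol a) = a.
Proof. by rewrite trowE tcolE reshape_indexK. Qed.

Lemma tcoords_inj a b : trow a = trow b -> tcol a = tcol b -> a = b.
Proof. by move=> ra ca; apply/val_inj; rewrite /= -flatten_tcoords ra ca flatten_tcoords. Qed.

Lemma tcoords_surj i j : (j < nth 0 la i)%N -> exists a, trow a = i /\ tcol a = j.
Proof.
move=> lt_j; have lt_a : (flatten_index la i j < N)%N.
  by rewrite -[X in (_ < X)%N]sumn_part flatten_indexP.
by exists (Ordinal lt_a); rewrite trowE tcolE flatten_indexKl ?flatten_indexKr.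
Qed.

Lemma nth_part_anti i j : (i <= j)%N -> (nth 0 la j <= nth 0 la i)%N.
Proof.
move=> le_ij; case/and3P: la_part => la_sorted _ _.
case: (ltnP j (size la)) => lt_j; last by rewrite nth_default.
have geq_trans : transitive geq by move=> x y z /= yx xz; apply: leq_trans xz yx.
apply: (sorted_leq_nth geq_trans _ 0%N la_sorted i j) => //=; rewrite ?inE //.
  by move=> x /=.
exact: leq_ltn_trans le_ij lt_j.
Qed.

End Superstandard.

(** * Permutation modules, row sums and column sums *)

Section PermutationModule.
Variables (K : numClosedFieldType) (N : nat).
Local Notation G := {perm 'I_N}.

Definition psign (s : G) : K := (-1) ^+ odd_perm s.
Definition ptriv (s : G) : K := 1.

(** A common frame for the trivial and the sign character. Being an involution makes a character
equal to its inverse, so that the sums below are self-adjoint. *)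
Record involutive_char := InvolutiveChar {
  ichar :> G -> K;
  icharM : forall s t, ichar (s * t)%g = ichar s * ichar t;
  ichar_sq : forall s, ichar s * ichar s = 1;
  ichar_real : forall s, (ichar s)^* = ichar s
}.

Lemma psignM s t : psign (s * t)%g = psign s * psign t.
Proof. by rewrite /psign odd_permM signr_addb. Qed.
Lemma psign_sq s : psign s * psign s = 1.
Proof. by rewrite /psign -signr_addb addbb. Qed.
Lemma psign_real s : (psign s)^* = psign s.
Proof. by rewrite /psign rmorph_sign. Qed.

Lemma ptrivM s t : ptriv (s * t)%g = ptriv s * ptriv t.
Proof. by rewrite /ptriv mulr1. Qed.
Lemma ptriv_sq s : ptriv s * ptriv s = 1.
Proof. by rewrite /ptriv mulr1. Qed.
Lemma ptriv_real s : (ptriv s)^* = ptriv s.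
Proof. by rewrite /ptriv rmorph1. Qed.

Definition triv_char := @InvolutiveChar ptriv ptrivM ptriv_sq ptriv_real.
Definition sign_char := @InvolutiveChar psign psignM psign_sq psign_real.

Lemma icharV (chi : involutive_char) s : chi (s^-1)%g = chi s.
Proof.
have chi1 : chi 1%g = 1 by rewrite -(ichar_sq chi 1%g) -icharM mulg1.
have chi_s := ichar_sq chi s.
have : chi s * (chi s * chi s^-1%g) = chi s by rewrite -icharM mulgV chi1 mulr1.
by rewrite mulrA chi_s mul1r.
Qed.

Section Action.
Variables (X : finType) (to : {action G &-> X}).
Local Notation M := {ffun X -> K^o}.

(** Products of permutations compose from left to right, so this is a right action ([pactM]): the
product y_la x_la of the group algebra, read as a composition of functions, acts as the row sum
followed by the column sum. *)
Definition pact (s : G) (f : M) : M := [ffun x => f (to x s^-1%g)].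

Fact pact_linear s : linear (pact s).
Proof. by move=> a f g; apply/ffunP=> x; rewrite !ffunE. Qed.
HB.instance Definition _ s :=
  GRing.isLinear.Build K M M *:%R (pact s) (pact_linear s).

Lemma pactM s t f : pact (s * t)%g f = pact t (pact s f).
Proof. by apply/ffunP=> x; rewrite !ffunE invMg actM. Qed.

Definition unit_vec (x : X) : M := [ffun y => (y == x)%:R].

Lemma pact_unit_vec s x : pact s (unit_vec x) = unit_vec (to x s).
Proof.
apply/ffunP=> y; rewrite !ffunE; congr (_%:R); congr (nat_of_bool _).
by apply/eqP/eqP=> [<-|->]; rewrite ?actKV ?actK.
Qed.

Definition psum (H : {set G}) (chi : G -> K) (f : M) : M :=
  \sum_(s in H) chi s *: pact s f.

Fact psum_linear H chi : linear (psum H chi).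
Proof.
move=> a f g; rewrite /psum scaler_sumr -big_split; apply: eq_bigr => s _ /=.
by rewrite linearP scalerDr !scalerA mulrC.
Qed.
HB.instance Definition _ H chi :=
  GRing.isLinear.Build K M M *:%R (psum H chi) (psum_linear H chi).

Lemma psum_pact (H : {group G}) (chi : involutive_char) s f :
  s \in H -> psum H chi (pact s f) = chi s *: psum H chi f.
Proof.
move=> sH; rewrite /psum scaler_sumr [RHS](reindex_inj (mulgI s)) /=.
apply: eq_big => [t|t tH]; first by rewrite groupMl.
by rewrite scalerA icharM mulrA ichar_sq mul1r pactM.
Qed.

Lemma pact_psum (H : {group G}) (chi : involutive_char) s f :
  s \in H -> pact s (psum H chi f) = chi s *: psum H chi f.
Proof.
move=> sH; rewrite /psum linear_sum scaler_sumr [RHS](reindex_inj (mulIg s)) /=.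
apply: eq_big => [t|t tH]; first by rewrite groupMr.
by rewrite linearZ scalerA icharM mulrCA ichar_sq mulr1 pactM.
Qed.

(** A positive definite form that is invariant under the action: sums over a group become
self-adjoint, and vectors can be shown to vanish, or not to vanish, through their norm. *)
Definition herm (f g : M) : K := \sum_x f x * (g x)^*.

Lemma hermDl f1 f2 g : herm (f1 + f2) g = herm f1 g + herm f2 g.
Proof. by rewrite -big_split; apply: eq_bigr => x _; rewrite ffunE mulrDl. Qed.
Lemma hermDr f g1 g2 : herm f (g1 + g2) = herm f g1 + herm f g2.
Proof. by rewrite -big_split; apply: eq_bigr => x _; rewrite ffunE rmorphD mulrDr. Qed.
Lemma hermZl a f g : herm (a *: f) g = a * herm f g.
Proof. by rewrite mulr_sumr; apply: eq_bigr => x _; rewrite ffunE mulrA. Qed.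
Lemma hermZr a f g : herm f (a *: g) = a^* * herm f g.
Proof. by rewrite mulr_sumr; apply: eq_bigr => x _; rewrite ffunE rmorphM mulrCA. Qed.
Lemma herm0l g : herm 0 g = 0.
Proof. by rewrite /herm big1 // => x _; rewrite ffunE mul0r. Qed.
Lemma herm0r f : herm f 0 = 0.
Proof. by rewrite /herm big1 // => x _; rewrite ffunE rmorph0 mulr0. Qed.
Lemma herm_suml I (r : seq I) P F g :
  herm (\sum_(i <- r | P i) F i) g = \sum_(i <- r | P i) herm (F i) g.
Proof. by apply: (big_morph (herm^~ g)) => [f1 f2|]; rewrite ?hermDl ?herm0l. Qed.
Lemma herm_sumr I (r : seq I) P F f :
  herm f (\sum_(i <- r | P i) F i) = \sum_(i <- r | P i) herm f (F i).
Proof. by apply: (big_morph (herm f)) => [f1 f2|]; rewrite ?hermDr ?herm0r. Qed.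

Lemma herm_pact s f g : herm (pact s f) g = herm f (pact s^-1%g g).
Proof.
rewrite /herm (reindex_inj (act_inj to s)); apply: eq_bigr => x _.
by rewrite !ffunE actK invgK.
Qed.

(** The adjoint of the action of s is that of its inverse, and inversion preserves both the group
and the character. *)
Lemma herm_psum (H : {group G}) (chi : involutive_char) f g :
  herm (psum H chi f) g = herm f (psum H chi g).
Proof.
rewrite /psum herm_suml herm_sumr [RHS](reindex_inj invg_inj) /=.
apply: eq_big => [s|s _]; first by rewrite groupV.
by rewrite hermZl hermZr herm_pact ichar_real icharV.
Qed.

Lemma herm_eq0 f : herm f f = 0 -> f = 0.
Proof.
move=> ff; apply/ffunP=> x; rewrite !ffunE; apply/eqP.
have/(_ x erefl)/eqP := psumr_eq0P (fun x _ => mul_conjC_ge0 (f x)) ff.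
by rewrite mul_conjC_eq0.
Qed.

End Action.

Section Levels.
Variable (h : 'I_N -> nat).
(** Row and column stabilisers are the cases where [h] is the row and the column of an entry. *)
Definition level_stab : {set G} := [set s : G | [forall a, h (s a) == h a]].

Lemma level_stabP (s : G) : reflect (forall a, h (s a) = h a) (s \in level_stab).
Proof. by rewrite inE; apply: (iffP forallP) => hs a; apply/eqP. Qed.

Fact level_stab_group : group_set level_stab.
Proof.
apply/group_setP; split=> [|s t /level_stabP hs /level_stabP ht].
  by apply/level_stabP=> a; rewrite perm1.
by apply/level_stabP=> a; rewrite permM ht hs.
Qed.
Canonical level_stab_gp := Group level_stab_group.

Lemma tperm_level a b : h a = h b -> tperm a b \in level_stab.
Proof. by move=> hab; apply/level_stabP=> c; case: tpermP => // ->. Qed.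

End Levels.

Section Sandwich.
Variables (X : finType) (to : {action G &-> X}).
Variables (rho gam : 'I_N -> nat).
Let Xop := psum to (level_stab rho) ptriv.
Let Yop := psum to (level_stab gam) psign.

Lemma pact_tperm (s : G) a b (f : {ffun X -> K^o}) :
  pact to s (pact to (tperm a b) f) = pact to (tperm (s a) (s b)) (pact to s f).
Proof. by rewrite -!pactM -tpermJ conjgE !mulgA mulgV mul1g. Qed.

(** The transposition of a and b fixes a sum over the row stabiliser; carried through s, it
becomes a transposition inside a column, which changes the sign of the column sum. *)
Lemma antisym_sym0 (s : G) a b f :
  a != b -> rho a = rho b -> gam (s a) = gam (s b) ->
  Yop (pact to s (Xop f)) = 0.
Proof.
move=> a_b rab gab.
have: Yop (pact to s (pact to (tperm a b) (Xop f))) = - Yop (pact to s (Xop f)).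
  rewrite pact_tperm /Yop (psum_pact to sign_char _ (tperm_level gab)) /=.
  by rewrite /psign odd_tperm (inj_eq perm_inj) a_b scaleN1r.
rewrite /Xop (pact_psum to triv_char _ (tperm_level rab)) scale1r.
by move/eqP; rewrite -subr_eq0 opprK -mulr2n -scaler_nat scaler_eq0 pnatr_eq0 => /eqP.
Qed.

Lemma sym_antisym0 (s : G) a b f :
  a != b -> gam a = gam b -> rho (s a) = rho (s b) ->
  Xop (pact to s (Yop f)) = 0.
Proof.
move=> a_b rab gab.
have: Xop (pact to s (pact to (tperm a b) (Yop f))) = Xop (pact to s (Yop f)).
  by rewrite pact_tperm /Xop (psum_pact to triv_char _ (tperm_level gab)) scale1r.
rewrite /Yop (pact_psum to sign_char _ (tperm_level rab)) /= /psign odd_tperm a_b.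
rewrite scaleN1r linearN [LHS]linearN; move/esym/eqP.
by rewrite -subr_eq0 opprK -mulr2n -scaler_nat scaler_eq0 pnatr_eq0 => /eqP.
Qed.

End Sandwich.
End PermutationModule.

(** * Dominance between shapes *)

Section Dominance.
Variables (N : nat) (la mu : seq nat).
Hypotheses (la_part : is_partition N la) (mu_part : is_partition N mu).
Local Notation G := {perm 'I_N}.

Definition top_rows (nu : seq nat) i : {set 'I_N} := [set a | trow nu a < i]%N.

(** If this fails, a transposition inside a row of the superstandard la-tableau is carried by s to
one inside a column of the superstandard mu-tableau, and the product of the sums vanishes
([casym_rsym0]). *)
Definition rows_spread (s : G) : bool :=
  [forall a, forall b, (a != b) && (trow la a == trow la b) ==>
     (tcol mu (s a) != tcol mu (s b))].

Lemma rows_spreadP (s : G) : reflect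
  (forall a b, trow la a = trow la b -> tcol mu (s a) = tcol mu (s b) -> a = b)
  (rows_spread s).
Proof.
apply: (iffP forallP) => [spread a b rab cab|spread a].
  have /forallP/(_ b) := spread a; rewrite rab cab !eqxx andbT implybF negbK.
  by move/eqP.
by apply/forallP=> b; apply/implyP=> /andP[a_b /eqP rab]; apply: contra a_b => /eqP/(spread _ _ rab)/eqP.
Qed.

Definition tbox (nu : seq nat) i j (a0 : 'I_N) : 'I_N :=
  odflt a0 [pick b | (trow nu b == i) && (tcol nu b == j)].

Lemma tboxP nu i j a0 : is_partition N nu -> (j < nth 0 nu i)%N ->
  trow nu (tbox nu i j a0) = i /\ tcol nu (tbox nu i j a0) = j.
Proof.
move=> nu_part lt_j; rewrite /tbox; case: pickP => [b /andP[/eqP-> /eqP->] //|].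
by have [b [<- <-] /(_ b)] := tcoords_surj nu_part lt_j; rewrite !eqxx.
Qed.

(** Moves the image of an entry a of the first i rows of la up into the first i rows of mu, within
its column: to the row of a if that column of mu meets all these rows, and otherwise not at all,
as the column then stays inside them. *)
Definition lift_up (s : G) i (a : 'I_N) : 'I_N :=
  if [forall i' : 'I_i, tcol mu (s a) < nth 0 mu i']%N
  then tbox mu (trow la a) (tcol mu (s a)) a else s a.

Lemma lift_up_col (s : G) i a : a \in top_rows la i ->
  tcol mu (lift_up s i a) = tcol mu (s a).
Proof.
rewrite inE => lt_i; rewrite /lift_up; case: ifP => // /forallP/(_ (Ordinal lt_i)) /= lt_c.
by have [_ ->] := tboxP a mu_part lt_c.
Qed.

Lemma lift_up_row (s : G) i a : a \in top_rows la i -> lift_up s i a \in top_rows mu i.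
Proof.
rewrite !inE => lt_i; rewrite /lift_up; case: ifP => [/forallP/(_ (Ordinal lt_i)) /= lt_c|].
  by have [-> _] := tboxP a mu_part lt_c.
apply: contraFT; rewrite -leqNgt => le_i; apply/forallP=> i'.
apply: leq_trans (tcol_lt mu_part (s a)) _; apply: nth_part_anti mu_part _ _ _.
by apply: leq_trans (ltnW _) le_i.
Qed.

Lemma lift_up_inj (s : G) i : rows_spread s -> {in top_rows la i &, injective (lift_up s i)}.
Proof.
move=> /rows_spreadP spread a b ai bi eq_ab.
have cab : tcol mu (s a) = tcol mu (s b) by rewrite -(lift_up_col s ai) eq_ab lift_up_col.
move: eq_ab; rewrite /lift_up cab; case: ifP => [/forallP col_full|_]; last exact: perm_inj.
move: ai bi; rewrite !inE => ai bi.
have := col_full (Ordinal ai); have := col_full (Ordinal bi) => /= lt_b lt_a.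
have [ra _] := tboxP a mu_part lt_a; have [rb _] := tboxP b mu_part lt_b.
by move/(congr1 (trow mu)); rewrite ra rb => /spread; apply.
Qed.

(** The classical dominance inequality: [lift_up] embeds the first i rows of la into those of mu.
*)
Lemma rows_spread_dom (s : G) i : rows_spread s -> (#|top_rows la i| <= #|top_rows mu i|)%N.
Proof.
move=> spread; rewrite -(card_in_imset (lift_up_inj (i := i) spread)).
by apply/subset_leq_card/subsetP=> b /imsetP[a ai ->]; apply: lift_up_row.
Qed.

End Dominance.

Section Shapes.
Variable N : nat.
Local Notation G := {perm 'I_N}.

Lemma card_trow (la : seq nat) i : is_partition N la ->
  #|[set a : 'I_N | trow la a == i]| = nth 0%N la i.
Proof.
move=> la_part; set A := [set _ | _]; rewrite cardE -(size_map (tcol la)) -[RHS](size_iota 0).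
apply: perm_size; apply: uniq_perm; rewrite ?iota_uniq //.
  rewrite map_inj_in_uniq ?enum_uniq // => a b; rewrite !mem_enum !inE => /eqP ra /eqP rb.
  by apply: (tcoords_inj la_part); rewrite ra rb.
move=> j; rewrite mem_iota /= add0n; apply/mapP/idP => [[a]|lt_j].
  by rewrite mem_enum inE => /eqP <- ->; apply: tcol_lt.
by have [a [ra ca]] := tcoords_surj la_part lt_j; exists a => //; rewrite mem_enum inE ra.
Qed.

Lemma eq_part (la mu : seq nat) : is_partition N la -> is_partition N mu ->
  (forall i, nth 0%N la i = nth 0%N mu i) -> la = mu.
Proof.
move=> /and3P[_ la0 _] /and3P[_ mu0 _] eq_nth; apply: (@eq_from_nth _ 0%N) => // .
apply/eqP; rewrite eqn_leq; apply/andP; split; rewrite leqNgt; apply/negP => lt.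
  by case/negP: la0; rewrite -[X in X \in _](nth_default 0%N (leqnn (size mu))) -eq_nth mem_nth.
by case/negP: mu0; rewrite -[X in X \in _](nth_default 0%N (leqnn (size la))) eq_nth mem_nth.
Qed.

Lemma eq_top_rows (la mu : seq nat) : is_partition N la -> is_partition N mu ->
  (forall i, #|top_rows N la i| = #|top_rows N mu i|) -> la = mu.
Proof.
move=> la_part mu_part eq_top; apply: eq_part => // i.
suff nthE nu : is_partition N nu -> nth 0%N nu i = (#|top_rows N nu i.+1| - #|top_rows N nu i|)%N.
  by rewrite !nthE ?eq_top.
move=> nu_part; rewrite -(card_trow i nu_part).
have -> : [set a : 'I_N | trow nu a == i] = top_rows N nu i.+1 :\: top_rows N nu i.
  by apply/setP=> a; rewrite !inE ltnS -leqNgt eqn_leq andbC.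
rewrite cardsDS //; apply/subsetP=> a; rewrite !inE; exact: leq_trans.
Qed.

(** A linear extension of the dominance order: it is monotone by [rows_spread_dom], and
[rows_spread_eq] shows that it separates comparable shapes. *)
Definition dominance_weight (la : seq nat) : nat :=
  (\sum_(i < N.+1) #|top_rows N la i|)%N.

Lemma trow_ltN la (a : 'I_N) : is_partition N la -> (trow la a < N)%N.
Proof.
move=> la_part; apply: leq_trans (trow_lt la_part a) _.
rewrite -[X in (_ <= X)%N](sumn_part la_part).
case/and3P: la_part => _ + _; elim: la => //= x s IHs.
by rewrite inE negb_or eq_sym -lt0n => /andP[x0 /IHs le]; rewrite -add1n leq_add.
Qed.

Lemma rows_spread_eq (la mu : seq nat) (s : G) : is_partition N la -> is_partition N mu ->
  (dominance_weight mu <= dominance_weight la)%N -> rows_spread la mu s -> la = mu.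
Proof.
move=> la_part mu_part le_w spread; apply: eq_top_rows => // i.
have dom j := rows_spread_dom mu_part j spread.
have eq_small (j : 'I_N.+1) : #|top_rows N la j| = #|top_rows N mu j|.
  apply/eqP; have := leqif_sum (fun (j : 'I_N.+1) (_ : true) => leqif_eq (dom j)).
  by case=> le_w' /esym; rewrite eqn_leq le_w' le_w /= => /forall_inP/(_ j isT)/eqP/eqP.
case: (ltnP i N.+1) => [lt_i|/ltnW le_i]; first exact: eq_small (Ordinal lt_i).
by congr #|pred_of_set _|; apply/setP=> a; rewrite !inE !(leq_trans (trow_ltN _ _) le_i).
Qed.

Section SameShape.
Variable la : seq nat.
Hypothesis la_part : is_partition N la.

(** Let i be the row of a, and suppose that the column c of s a has no box in row i. Column c then
lies in the first i rows, which [lift_up] permutes along the columns; so the entries of these rows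
that s sends to column c already account for the whole of c, and a is not one of them. *)
Lemma rows_spread_box (s : G) a : rows_spread la la s -> (tcol la (s a) < nth 0 la (trow la a))%N.
Proof.
move=> spread; rewrite ltnNge; apply/negP => le_c.
set i := trow la a in le_c; set c := tcol la (s a) in le_c.
pose A := [set x in top_rows N la i | tcol la (s x) == c].
pose C := [set y : 'I_N | tcol la y == c].
have inj_g := lift_up_inj la_part (i := i) spread.
have g_onto : lift_up la la s i @: top_rows N la i = top_rows N la i.
  apply/eqP; rewrite eqEcard card_in_imset // leqnn andbT.
  by apply/subsetP=> b /imsetP[x xi ->]; apply: lift_up_row.
have sCA : C \subset lift_up la la s i @: A.
  apply/subsetP=> y; rewrite inE => /eqP cy.
  have : y \in top_rows N la i.
    rewrite inE ltnNge; apply/negP=> le_i; have := tcol_lt la_part y.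
    by rewrite cy ltnNge (leq_trans (nth_part_anti la_part le_i) le_c).
  rewrite -g_onto => /imsetP[x xi yE]; apply/imsetP; exists x => //.
  by rewrite inE xi -(lift_up_col la_part s xi) -yE cy eqxx.
have cardAC : (#|C| <= #|A|)%N.
  apply: leq_trans (subset_leq_card sCA) (leq_imset_card _ _).
have sAC : A \subset s @^-1: C by apply/subsetP=> x; rewrite !inE => /andP[].
have /eqP AE : A == s @^-1: C.
  by rewrite eqEcard sAC card_preimset //; exact: perm_inj.
have : a \in A by rewrite AE !inE.
by rewrite !inE ltnn.
Qed.

(** Inside the row of each entry there is a box in the column prescribed by s: first move the
entries to these boxes, then permute the columns. *)
Lemma rows_spread_decomp (s : G) : rows_spread la la s ->
  exists r c, [/\ r \in level_stab (@trow N la), c \in level_stab (@tcol N la)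
                & s = (r * c)%g].
Proof.
move=> spread; pose f a := tbox la (trow la a) (tcol la (s a)) a.
have fP a : trow la (f a) = trow la a /\ tcol la (f a) = tcol la (s a).
  by apply: tboxP => //; apply: rows_spread_box.
have f_inj : injective f.
  move=> a b eq_f; move/rows_spreadP: (spread); apply.
    by rewrite -(fP a).1 eq_f (fP b).1.
  by rewrite -(fP a).2 eq_f (fP b).2.
pose r := perm f_inj; exists r, (r^-1 * s)%g; split; last by rewrite mulKVg.
  by apply/level_stabP=> a; rewrite permE (fP a).1.
have rE a : r a = f a by rewrite permE.
by apply/level_stabP=> b; rewrite permM -[in RHS](permKV r b) rE (fP _).2.
Qed.

End SameShape.
End Shapes.

Section Young.
Variables (K : numClosedFieldType) (N : nat).
Local Notation G := {perm 'I_N}.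
Section Ops.
Variables (X : finType) (to : {action G &-> X}).
Definition rsym (la : seq nat) : {ffun X -> K^o} -> {ffun X -> K^o} :=
  psum to (level_stab (@trow N la)) (@ptriv K N).
Definition casym (la : seq nat) : {ffun X -> K^o} -> {ffun X -> K^o} :=
  psum to (level_stab (@tcol N la)) (@psign K N).
HB.instance Definition _ la := GRing.Linear.on (rsym la).
HB.instance Definition _ la := GRing.Linear.on (casym la).
End Ops.

Lemma casym_rsym0 (X : finType) (to : {action G &-> X}) la mu (s : G) f :
  ~~ rows_spread la mu s -> casym to mu (pact to s (rsym to la f)) = 0.
Proof.
case/forallPn=> a /forallPn[b]; rewrite negb_imply negbK => /andP[/andP[a_b /eqP rab] /eqP cab].
exact: antisym_sym0 a_b rab cab.
Qed.

Lemma rsym_casym0 (X : finType) (to : {action G &-> X}) la mu (s : G) f :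
  ~~ rows_spread la mu s^-1%g -> rsym to la (pact to s (casym to mu f)) = 0.
Proof.
case/forallPn=> a /forallPn[b]; rewrite negb_imply negbK => /andP[/andP[a_b /eqP rab] /eqP cab].
apply: (@sym_antisym0 _ _ _ to (@trow N la) (@tcol N mu) s (s^-1%g a) (s^-1%g b)) => //.
  by rewrite (inj_eq perm_inj).
by rewrite !permKV.
Qed.

(** Either s does not spread the rows and the composite is zero, or s = r c, where r is absorbed
by the row sum and c by the column sum. The scalar is chosen before the module, which lets
[std_comb_detect] compute it in the regular module. *)
Lemma sandwich la (s : G) : is_partition N la ->
  exists kappa : K, forall (X : finType) (to : {action G &-> X}) f,
    casym to la (pact to s (rsym to la f)) = kappa *: casym to la (rsym to la f).
Proof.
move=> la_part; case: (boolP (rows_spread la la s)) => [|unspread]; last first.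
  by exists 0 => X to f; rewrite casym_rsym0 // scale0r.
case/(rows_spread_decomp la_part) => r [c [rR cC ->]]; exists (psign K c) => X to f.
rewrite pactM /rsym (pact_psum to (triv_char K N) _ rR) scale1r.
by rewrite /casym (psum_pact to (sign_char K N) _ cC).
Qed.

End Young.

(** * Standard tableaux *)

Lemma seq_extremum (T : eqType) (leT : rel nat) (s : seq T) (P : pred T) (W : T -> nat) :
  total leT -> transitive leT -> has P s ->
  exists x, [/\ x \in s, P x & forall y, y \in s -> P y -> leT (W x) (W y)].
Proof.
move=> leT_total leT_trans; have leTT n : leT n n by have := leT_total n n; rewrite orbb.
elim: s => //= a s IHs; case: (boolP (has P s)) => [/IHs[x [xs Px x_min]] _|/hasPn none]; last first.
  rewrite orbF => Pa; exists a; split; rewrite ?mem_head // => y; rewrite inE.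
  by case/orP=> [/eqP->//|/none/negPf->].
case: (boolP (P a && leT (W a) (W x))) => [/andP[Pa le_ax]|not_a].
  exists a; split; rewrite ?mem_head // => y; rewrite inE => /orP[/eqP->//|ys Py].
  by apply: leT_trans le_ax _; apply: x_min.
exists x; split; rewrite ?inE ?xs ?orbT // => y /orP[/eqP-> Pa|ys]; last exact: x_min.
by have /orP[le|//] := leT_total (W a) (W x); rewrite Pa le in not_a.
Qed.

Section StandardTableaux.
Variables (N : nat) (la : seq nat).
Hypothesis la_part : is_partition N la.
Local Notation G := {perm 'I_N}.

(** The choice in [tab_perm] succeeds on standard tableaux, whose reading words are permutations
of the entries. *)
Lemma tab_perm_act t : t \in Std N la -> t = tab_act (t_row N la) (tab_perm la t).
Proof.
rewrite mem_filter => /andP[_ /mapP[w]]; rewrite mem_permutations => w_enum ->.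
rewrite /tab_perm; case: pickP => [d /eqP //|] /=.
have w_size : size w = N by rewrite (perm_size w_enum) size_enum_ord.
have w_uniq : uniq w by rewrite (perm_uniq w_enum) enum_uniq.
pose f (i : 'I_N) := nth i w i.
have f_inj : injective f.
  move=> i j; rewrite /f (set_nth_default i) ?w_size // => /eqP.
  by rewrite nth_uniq ?w_size // => /eqP/val_inj.
move/(_ (perm f_inj)^-1%g)/negP; case; rewrite /tab_act invgK /t_row map_reshape.
apply/eqP; congr reshape; rewrite (eq_map (permE f_inj)).
have [w0|[x0 _]] : w = [::] \/ exists x0 : 'I_N, True.
- by case: (w) => [|x0 w']; [left | right; exists x0].
  have /size0nil-> : size (enum 'I_N) = 0%N by rewrite size_enum_ord -w_size w0.
  by rewrite w0.
apply: (@eq_from_nth _ x0); first by rewrite size_map size_enum_ord.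
rewrite w_size => i lt_i.
rewrite (nth_map x0) ?size_enum_ord // /f nth_enum_ord //.
by apply: set_nth_default; rewrite w_size.
Qed.

Lemma tab_perm_coords t a : t \in Std N la ->
  row_of t a = trow la (tab_perm la t a) /\ col_of t a = tcol la (tab_perm la t a).
Proof.
move/tab_perm_act => tE; rewrite {1 3}tE; set d := tab_perm la t.
rewrite /tab_act /t_row map_reshape.
have [|||->->] := @coords_reshape N la [seq (d^-1)%g i | i <- enum 'I_N] _ _ _ a.
- by rewrite map_inj_uniq ?enum_uniq //; apply: perm_inj.
- by rewrite size_map size_enum_ord (sumn_part la_part).
- by move=> b; rewrite -[b](permK d) map_f ?mem_enum.
by rewrite (trowE la_part) (tcolE la_part) -[in index _ _](permK d a) index_map ?index_enum_ord //; apply: perm_inj.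
Qed.

Lemma Std_uniq : uniq (Std N la).
Proof.
apply: filter_uniq; rewrite map_inj_in_uniq ?permutations_uniq // => u v.
rewrite !mem_permutations => /perm_size u_sz /perm_size v_sz /(congr1 flatten).
by rewrite !reshapeKr // ?u_sz ?v_sz size_enum_ord (sumn_part la_part).
Qed.

Lemma Std_row t a b : t \in Std N la ->
  row_of t a = row_of t b -> (col_of t a < col_of t b)%N -> (a < b)%N.
Proof.
rewrite mem_filter => /andP[/forallP/(_ a)/forallP/(_ b)/implyP std _] rab cab.
by apply: std; rewrite rab eqxx cab.
Qed.

Lemma Std_col t a b : t \in Std N la ->
  col_of t a = col_of t b -> (row_of t a < row_of t b)%N -> (a < b)%N.
Proof.
rewrite mem_filter => /andP[/forallP/(_ a)/forallP/(_ b)/implyP std _] cab rab.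
by apply: std; rewrite cab eqxx rab orbT.
Qed.

Lemma Std_coords_inj t a b : t \in Std N la ->
  row_of t a = row_of t b -> col_of t a = col_of t b -> a = b.
Proof.
move=> tS; have [-> ->] := tab_perm_coords a tS; have [-> ->] := tab_perm_coords b tS.
by move=> r c; exact: perm_inj (tcoords_inj la_part r c).
Qed.

(** The entries to the left of a in its row are the smaller entries of that row; hence the row
function determines a standard tableau ([Std_row_inj]). *)
Lemma Std_col_card t a : t \in Std N la ->
  col_of t a = #|[set b : 'I_N | (row_of t b == row_of t a) && (b < a)%N]|.
Proof.
move=> tS; set A := [set _ | _]; rewrite cardE -(size_map (col_of t)) -[LHS](size_iota 0).
have colA b : b \in A -> (col_of t b < col_of t a)%N.
  rewrite inE => /andP[/eqP rb lt_b]; rewrite ltnNge leq_eqVlt; apply/negP=> /orP[/eqP cb|cb].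
    by rewrite (Std_coords_inj tS rb (esym cb)) ltnn in lt_b.
  by have := Std_row tS (esym rb) cb; rewrite ltnNge (ltnW lt_b).
apply: perm_size; apply: uniq_perm; rewrite ?iota_uniq //.
  rewrite map_inj_in_uniq ?enum_uniq // => b c; rewrite !mem_enum !inE.
  by case/andP=> /eqP rb _ /andP[/eqP rc _]; apply: Std_coords_inj; rewrite ?rb ?rc.
move=> j; rewrite mem_iota /= add0n; apply/idP/mapP => [lt_j|[b]]; last first.
  by rewrite mem_enum => /colA lt_b ->.
have [ra ca] := tab_perm_coords a tS.
have lt_j' : (j < nth 0 la (row_of t a))%N.
  by apply: ltn_trans lt_j _; rewrite ra ca; apply: tcol_lt.
have [c [rc cc]] := tcoords_surj la_part lt_j'.
pose b := ((tab_perm la t)^-1)%g c; exists b.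
  have [rb cb] := tab_perm_coords b tS; rewrite permKV in rb cb.
  rewrite mem_enum inE rb rc eqxx /=.
  by apply: (Std_row tS); rewrite ?rb ?rc // cb cc.
by rewrite (tab_perm_coords b tS).2 permKV cc.
Qed.

Lemma Std_row_inj t u : t \in Std N la -> u \in Std N la ->
  row_of t =1 row_of u -> t = u.
Proof.
move=> tS uS eq_row; rewrite (tab_perm_act tS) (tab_perm_act uS); congr tab_act.
apply/permP=> a; apply: (tcoords_inj la_part).
  by rewrite -(tab_perm_coords a tS).1 -(tab_perm_coords a uS).1.
rewrite -(tab_perm_coords a tS).2 -(tab_perm_coords a uS).2 !Std_col_card //.
by apply: eq_card => b; rewrite !inE !eq_row.
Qed.

(** Row functions read as numerals in base N + 1, so that the rows of the largest entries count
most. *)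
Definition row_weight (h : 'I_N -> nat) : nat := (\sum_(a < N) h a * N.+1 ^ a)%N.

Lemma row_weight_lt (f g : 'I_N -> nat) (p : 'I_N) :
  (forall a, f a < N.+1)%N -> (f p < g p)%N -> (forall a : 'I_N, p < a -> f a = g a)%N ->
  (row_weight f < row_weight g)%N.
Proof.
move=> f_lt lt_p eq_above.
have splitW h : row_weight h = (\sum_(i < N | (i < p)%N) h i * N.+1 ^ i + h p * N.+1 ^ p +
    \sum_(i < N | ~~ (i < p) && (i != p)) h i * N.+1 ^ i)%N.
  rewrite /row_weight (bigID (fun a : 'I_N => a < p)%N) /=.
  by rewrite [X in (_ + X)%N](bigD1 p) ?ltnn //= addnA.
rewrite !splitW.
have -> : (\sum_(i < N | ~~ (i < p) && (i != p)) f i * N.+1 ^ i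
         = \sum_(i < N | ~~ (i < p) && (i != p)) g i * N.+1 ^ i)%N.
  apply: eq_bigr => a; rewrite -leqNgt => /andP[le_pa a_p]; rewrite eq_above //.
  by rewrite ltn_neqAle le_pa eq_sym andbT.
rewrite ltn_add2r addnC.
apply: (@leq_trans (f p * N.+1 ^ p + N.+1 ^ p)%N); last first.
  by rewrite addnC -mulSn (leq_trans _ (leq_addl _ _)) // leq_mul2r lt_p orbT.
rewrite ltn_add2l.
apply: (@leq_ltn_trans (\sum_(i < N | (i < p)%N) N * N.+1 ^ i)%N).
  by apply: leq_sum => a _; rewrite leq_mul2r -ltnS f_lt orbT.
rewrite -big_distrr /= (big_ord_narrow (ltnW (ltn_ord p))) /=.
by rewrite -[X in (X * _)%N]/(N.+1.-1) -predn_exp prednK ?expn_gt0.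
Qed.

(** Let p be the largest entry whose row is changed by c. If c p lay below p, it would be larger
than p, so c would fix it, which is absurd; hence c p lies above p. *)
Lemma Std_row_weight t (c : G) : t \in Std N la ->
  (forall a, col_of t (c a) = col_of t a) ->
  (row_weight (row_of t \o c) <= row_weight (row_of t))%N /\
  (row_weight (row_of t \o c) = row_weight (row_of t) -> c = 1%g).
Proof.
move=> tS cC; case: (boolP [forall a, row_of t (c a) == row_of t a]) => [/forallP cR|].
  have -> : c = 1%g; last first.
    by split=> //; apply: eq_leq; apply: eq_bigr => a _; rewrite /= perm1.
  by apply/permP=> a; rewrite perm1; apply: (Std_coords_inj tS) => //; apply/eqP.
case/forallPn=> a0 a0P.
have [p pP p_max] : exists2 p : 'I_N, row_of t (c p) != row_of t p &
    forall a, row_of t (c a) != row_of t a -> (a <= p)%N.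
  by case: (@arg_maxnP _ a0 (fun a => row_of t (c a) != row_of t a) val a0P) => p; exists p.
suff lt_w : (row_weight (row_of t \o c) < row_weight (row_of t))%N.
  by split=> [|eq_w]; [apply: ltnW | rewrite eq_w ltnn in lt_w].
have row_lt a : (row_of t a < N.+1)%N.
  by rewrite (tab_perm_coords a tS).1 ltnW // ltnS trow_ltN.
have fix_above (a : 'I_N) : (p < a)%N -> row_of t (c a) = row_of t a.
  by move=> lt_pa; apply/eqP; apply: contraLR lt_pa => /p_max; rewrite -leqNgt.
apply: (@row_weight_lt (row_of t \o c) (row_of t) p _ _ fix_above) => [a|/=]; first exact: row_lt.
rewrite ltnNge leq_eqVlt eq_sym (negPf pP) /=; apply/negP=> lt_p.
have lt_pc := Std_col tS (esym (cC p)) lt_p.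
have := Std_coords_inj tS (fix_above _ lt_pc) (cC _) => /perm_inj eq_p.
by rewrite eq_p ltnn in lt_pc.
Qed.

End StandardTableaux.

(** * Detecting a shape in a combination of standard tableaux *)

Section Reduction.
Variables (K : numClosedFieldType) (N : nat).
Local Notation G := {perm 'I_N}.

Lemma casym_expand (X : finType) (to : {action G &-> X}) la mu (s : G) g :
  casym to la (pact to s (casym to mu g))
    = \sum_(c in level_stab (@tcol N mu)) psign K c *: casym to la (pact to (c * s)%g g).
Proof.
rewrite {2}/casym /psum !linear_sum; apply: eq_bigr => c _.
by rewrite !linearZ /= pactM.
Qed.

Lemma sandwich_casym la : is_partition N la ->
  exists kappa : G -> K, forall s (X : finType) (to : {action G &-> X}) f,
    casym to la (pact to s (casym to la (rsym to la f)))
      = kappa s *: casym to la (rsym to la f).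
Proof.
move=> la_part; have [kap kapP] := fin_all_exists (fun s => sandwich K s la_part).
exists (fun s => \sum_(c in level_stab (@tcol N la)) psign K c * kap (c * s)%g) => s X to f /=.
by rewrite casym_expand scaler_suml; apply: eq_bigr => c _; rewrite kapP scalerA.
Qed.

(** Expanding the inner column sum leaves products of c_la and r_mu, each of which vanishes unless
mu is dominated by la. *)
Lemma casym_casym_rsym0 (X : finType) (to : {action G &-> X}) la mu (s : G)
    (f : {ffun X -> K^o}) :
  is_partition N la -> is_partition N mu ->
  (dominance_weight N la <= dominance_weight N mu)%N -> mu != la ->
  casym to la (pact to s (casym to mu (rsym to mu f))) = 0.
Proof.
move=> la_part mu_part le_w mu_la; rewrite casym_expand big1 // => c _.
rewrite casym_rsym0 ?scaler0 //.
by apply: contra mu_la => /(rows_spread_eq mu_part la_part le_w)/eqP.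
Qed.

Section OneShape.
Variables (la : seq nat) (c : seq (seq 'I_N) -> K).
Hypothesis la_part : is_partition N la.

Definition std_comb (X : finType) (to : {action G &-> X}) (f : {ffun X -> K^o}) :=
  \sum_(t <- Std N la) c t *: pact to (tab_perm la t)^-1%g (casym to la (rsym to la f)).

Local Notation regular := (mulgr_action G).

(** Among the tableaux with a non-zero coefficient, let t1 have the largest row weight. By
[Std_row_weight] and [Std_row_inj] the group element d(t1)^-1 arises only from the tableau t1 and
the trivial row and column permutations, so its coefficient survives. *)
Lemma std_comb_neq0 t0 : t0 \in Std N la -> c t0 != 0 ->
  std_comb regular (unit_vec K 1%g) != 0.
Proof.
move=> t0S ct0.
have geq_total : total geq by move=> m n; apply: leq_total.
have geq_trans : transitive geq by move=> m n p /= mn pm; apply: leq_trans pm mn.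
have has_t0 : has (fun t => c t != 0) (Std N la) by apply/hasP; exists t0.
have [t1 [t1S ct1 t1_max]] :=
  seq_extremum (fun t => row_weight (row_of t)) geq_total geq_trans has_t0.
pose d (t : tableau N) := tab_perm la t.
suff : std_comb regular (unit_vec K 1%g) (d t1)^-1%g = c t1.
  by move=> E; apply: contra ct1 => /eqP E0; rewrite -E E0 ffunE.
have expand t : pact regular (d t)^-1%g (casym regular la (rsym regular la (unit_vec K 1%g))) (d t1)^-1%g =
   \sum_(k in level_stab (@tcol N la)) \sum_(r in level_stab (@trow N la))
     psign K k * ((d t1)^-1%g == r * k * (d t)^-1)%:R%g.
  rewrite /casym /rsym /psum !linear_sum sum_ffunE; apply: eq_bigr => k _.
  rewrite linearZ /= !linear_sum ?scaler_sumr sum_ffunE; apply: eq_bigr => r _.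
  rewrite /= scale1r !pact_unit_vec !ffunE /=; congr (_ * _%:R).
  by rewrite mul1g.
have key t r k : t \in Std N la -> c t != 0 ->
    r \in level_stab (@trow N la) -> k \in level_stab (@tcol N la) ->
    ((d t1)^-1 = r * k * (d t)^-1)%g -> [/\ t = t1, r = 1%g & k = 1%g].
  move=> tS ct rR kC /(congr1 invg); rewrite !invMg !invgK => dE.
  have kC' := groupVr (G := level_stab_gp _) kC; have rR' := groupVr (G := level_stab_gp _) rR.
  move/level_stabP: kC' => kC'; move/level_stabP: rR' => rR'.
  pose p := (d t * k^-1 * (d t)^-1)%g.
  have dp a : d t (p a) = (k^-1)%g (d t a) by rewrite !permM permKV.
  have pC a : col_of t (p a) = col_of t a.
    by rewrite !(tab_perm_coords la_part _ tS).2 dp kC'.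
  have rowE a : row_of t1 a = row_of t (p a).
    by rewrite (tab_perm_coords la_part _ t1S).1 (tab_perm_coords la_part _ tS).1 dp -/(d t1) dE !permM rR'.
  have [_ p1] := Std_row_weight la_part tS pC.
  have weightE : row_weight (row_of t \o p) = row_weight (row_of t1).
    by apply: eq_bigr => a _; rewrite /= -rowE.
  have p_eq1 : p = 1%g.
    apply: p1; apply/eqP; rewrite eqn_leq (Std_row_weight la_part tS pC).1 /=.
    by rewrite weightE; apply: t1_max.
  have tE : t = t1.
    by apply: (Std_row_inj la_part tS t1S) => a; rewrite rowE p_eq1 perm1.
  have kE : k = 1%g.
    apply/eqP; rewrite -eq_invg1; apply/eqP; move: p_eq1.
    by rewrite /p => /eqP; rewrite -eq_mulgV1 -{2}[d t]mulg1 => /eqP/mulgI.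
  split=> //; apply/eqP; rewrite -eq_invg1; apply/eqP; move: dE.
  by rewrite tE kE invg1 mul1g -{1}[d t1]mulg1 => /mulgI <-.
rewrite /std_comb sum_ffunE (bigD1_seq t1) ?Std_uniq //= big1_seq ?addr0 => [|t /andP[t_t1 tS]].
  rewrite ffunE expand (bigD1 1%g) /= ?(group1 (level_stab_gp _)) //.
  rewrite (bigD1 1%g) /= ?(group1 (level_stab_gp _)) // !mul1g eqxx.
  rewrite /psign odd_perm1 !big1 ?addr0 ?mul1r; first exact: mulr1.
    move=> k /andP[kC k1]; apply: big1 => r rR; case: eqP => [|_]; last by rewrite mulr0.
    by case/(key _ _ _ t1S ct1 rR kC) => _ _ k1'; rewrite k1' eqxx in k1.
  move=> r /andP[rR r1]; case: eqP => [E|_]; last by rewrite mulr0.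
  have [_ r1' _] := key _ _ _ t1S ct1 rR (group1 (level_stab_gp _)) E.
  by rewrite r1' eqxx in r1.
rewrite ffunE expand; have [->|ct] := eqVneq (c t) 0; first exact: mul0r.
rewrite big1; first exact: mulr0.
move=> k kC; apply: big1 => r rR; case: eqP => [|_]; last by rewrite mulr0.
by case/(key _ _ _ tS ct rR kC) => tt1; rewrite tt1 eqxx in t_t1.
Qed.

(** The scalars do not depend on the module. If they all vanished, the combination w in the
regular module would be orthogonal to every translate of a column sum, hence to itself, against
[std_comb_neq0]. *)
Lemma std_comb_detect t0 : t0 \in Std N la -> c t0 != 0 ->
  exists s kappa, kappa != 0 /\ forall (X : finType) (to : {action G &-> X}) f,
    casym to la (pact to s (std_comb to f)) = kappa *: casym to la (rsym to la f).
Proof.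
move=> t0S ct0; have [kap kapP] := sandwich_casym la_part.
pose kappa s := \sum_(t <- Std N la) c t * kap ((tab_perm la t)^-1 * s)%g.
have kappaP s (X : finType) (to : {action G &-> X}) f :
    casym to la (pact to s (std_comb to f)) = kappa s *: casym to la (rsym to la f).
  rewrite scaler_suml /std_comb linear_sum linear_sum; apply: eq_bigr => t _ /=.
  by rewrite linearZ linearZ /= -pactM kapP scalerA.
case: (boolP [exists s, kappa s != 0]) => [/existsP[s ks]|]; first by exists s, (kappa s).
rewrite negb_exists => /forallP none; have/negP[] := std_comb_neq0 t0S ct0.
pose w := std_comb regular (unit_vec K 1%g); rewrite -/w.
have w0 s : casym regular la (pact regular s w) = 0.
  by have := none s; rewrite negbK kappaP => /eqP->; rewrite scale0r.
apply/eqP/herm_eq0; rewrite {2}/w /std_comb herm_sumr big1 // => t _.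
by rewrite hermZr -herm_pact -(herm_psum _ _ (sign_char K N)) [psum _ _ _ _]w0 herm0l mulr0.
Qed.
End OneShape.

(** Choose the shape of least weight among those that occur: its column sum kills the other ones
by [casym_casym_rsym0]. *)
Lemma shape_detect (L : seq (seq nat)) (c : seq nat -> seq (seq 'I_N) -> K) la0 t0 :
  uniq L -> {in L, forall la, is_partition N la} ->
  la0 \in L -> t0 \in Std N la0 -> c la0 t0 != 0 ->
  exists la, [/\ la \in L, has (fun t => c la t != 0) (Std N la)
    & exists s kappa, kappa != 0 /\
        forall (X : finType) (to : {action G &-> X}) f,
          casym to la (pact to s (\sum_(mu <- L) std_comb mu (c mu) to f))
            = kappa *: casym to la (rsym to la f)].
Proof.
move=> L_uniq L_part la0L t0S ct0; pose used la := has (fun t => c la t != 0) (Std N la).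
have has_used : has used L by apply/hasP; exists la0 => //; apply/hasP; exists t0.
have [la [laL la_used la_min]] :=
  seq_extremum (dominance_weight N) leq_total leq_trans has_used.
exists la; split=> //; have la_part := L_part _ laL.
have /hasP[t tS ct] := la_used.
have [s [kap [kap0 kapP]]] := std_comb_detect la_part tS ct.
exists s, kap; split=> // X to f.
rewrite (bigD1_seq la) //= linearD linearD /= kapP big_seq_cond.
rewrite -[RHS]addr0; congr (_ + _).
rewrite linear_sum linear_sum big1 // => mu /andP[muL mu_la] /=.
rewrite /std_comb linear_sum linear_sum big_seq big1 // => u uS /=.
rewrite linearZ linearZ /=; have [->|cu] := eqVneq (c mu u) 0; first by rewrite scale0r.
rewrite -pactM casym_casym_rsym0 ?scaler0 //; first exact: L_part.
by apply: la_min => //; apply/hasP; exists u.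
Qed.
End Reduction.

(** * Counting matchings and standard tableaux of even shape *)

Local Close Scope ring_scope.

Section CountMatchings.
Variable T : finType.

(** The double factorial (2n - 1)!!, the number of perfect matchings of 2n points. *)
Definition double_fact n := \prod_(i < n) i.*2.+1.

(** Extending a fixed-point-free involution of S by the identity keeps all subsets inside one
function type, so that the induction on S can remove two points. *)
Definition matchings_on (S : {set T}) : {set {ffun T -> T}} :=
  [set f : {ffun T -> T} | [forall x, if x \in S then [&& f x \in S, f x != x & f (f x) == x]
                   else f x == x]].

Lemma matchings_onP (S : {set T}) (f : {ffun T -> T}) : reflect
  (forall x, if x \in S then [/\ f x \in S, f x != x & f (f x) = x] else f x = x)
  (f \in matchings_on S).
Proof.
rewrite inE; apply: (iffP forallP) => H x; move: (H x); case: ifP => xS.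
- by case/and3P=> -> -> /eqP.
- by move/eqP.
- by case=> -> -> ->; rewrite eqxx.
by move/eqP.
Qed.

(** A given point has 2n + 1 possible partners, and removing the pair leaves a matching of 2n
points. *)
Lemma card_matchings_on n (S : {set T}) : #|S| = n.*2 -> #|matchings_on S| <= double_fact n.
Proof.
elim: n S => [|n IHn] S cardS.
  rewrite /double_fact big_ord0; apply/card_le1_eqP => f g /matchings_onP fP /matchings_onP gP.
  apply/ffunP=> x; move: (fP x) (gP x); move/eqP: cardS; rewrite cards_eq0 => /eqP->.
  by rewrite inE => -> ->.
have [a aS] : exists a, a \in S by apply/set0Pn; rewrite -card_gt0 cardS.
have cardSa : #|S :\ a| = n.*2.+1 by move: cardS; rewrite (cardsD1 a) aS; case.
have fib b : b \in S :\ a -> #|[set f in matchings_on S | f a == b]| <= double_fact n.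
  rewrite !inE => /andP[b_a bS].
  have cardSab : #|S :\ a :\ b| = n.*2.
    by move: cardSa; rewrite (cardsD1 b) !inE b_a bS; case.
  apply: leq_trans (IHn _ cardSab).
  pose h (f : {ffun T -> T}) := [ffun x => if (x == a) || (x == b) then x else f x].
  have fibP f : f \in [set f in matchings_on S | f a == b] ->
      f \in matchings_on S /\ (f a = b /\ f b = a).
    rewrite inE => /andP[fS /eqP fa]; split=> //; split=> //.
    by move/matchings_onP: fS => /(_ a); rewrite aS fa => -[].
  rewrite -(card_in_imset (f := h)); last first.
    move=> f g /fibP[_ [fa fb]] /fibP[_ [ga gb]] /ffunP eq_h; apply/ffunP=> x.
    have := eq_h x; rewrite !ffunE; have [->|x_a] := eqVneq x a; first by rewrite fa ga.
    by have [->|//] := eqVneq x b; rewrite fb gb.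
  apply/subset_leq_card/subsetP=> _ /imsetP[f /fibP[/matchings_onP fS [fa fb]] ->].
  apply/matchings_onP=> x; rewrite !inE !ffunE.
  have [->|x_a] := eqVneq x a; first by rewrite andbF.
  have [->|x_b] := eqVneq x b; first by [].
  have := fS x; rewrite /=; case: ifP => // xS [fxS fx_x ffx].
  have fx_a : f x != a by apply: contra x_b => /eqP fx; rewrite -ffx fx fa.
  have fx_b : f x != b by apply: contra x_a => /eqP fx; rewrite -ffx fx fb.
  by rewrite fx_a fx_b fxS (negPf fx_a) (negPf fx_b).
rewrite -sum1_card (partition_big (fun f : {ffun T -> T} => f a) (mem (S :\ a))) /=; last first.
  move=> f /matchings_onP/(_ a); rewrite aS => -[faS fa_a _].
  by rewrite !inE fa_a.
rewrite /double_fact big_ord_recr /= -/(double_fact n) mulnC -cardSa -sum_nat_const.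
apply: leq_sum => b bS; apply: leq_trans (fib b bS); rewrite -sum1_card.
by apply: eq_leq; apply: eq_bigl => f; rewrite inE.
Qed.

Lemma card_matching n : #|T| = n.*2 -> #|{: matching T}| <= double_fact n.
Proof.
move=> cardT; apply: leq_trans (@card_matchings_on n setT _); rewrite ?cardsT //.
rewrite -cardsT -(card_imset _ val_inj).
apply/subset_leq_card/subsetP=> _ /imsetP[D _ ->]; apply/matchings_onP=> x.
by rewrite !inE; split; [|apply: (partner_neq D)|apply: (partnerK D)].
Qed.
End CountMatchings.

Section LatticeWords.
Variable k' : nat.
Local Notation k := k'.+1.
Local Notation shape := {ffun 'I_k -> nat}.
Implicit Types (la : shape) (i j : 'I_k) (w : seq 'I_k).

Definition add_box la i : shape := [ffun j => la j + (j == i)].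
Definition del_box la i : shape := [ffun j => la j - (j == i)].
Definition is_shape la := [forall i : 'I_k, forall j : 'I_k, (i <= j) ==> (la j <= la i)].
Definition addable la i := [forall j : 'I_k, (j < i) ==> (la i < la j)].
Definition removable la i := (0 < la i) && [forall j : 'I_k, (i < j) ==> (la j < la i)].

Lemma is_shapeP la : reflect (forall i j : 'I_k, i <= j -> la j <= la i) (is_shape la).
Proof.
apply: (iffP forallP) => [H i j le_ij|H i]; first by move/forallP: (H i) => /(_ j); rewrite le_ij.
by apply/forallP=> j; apply/implyP; apply: H.
Qed.

Lemma addableP la i : reflect (forall j : 'I_k, j < i -> la i < la j) (addable la i).
Proof. by apply: (iffP forallP) => H j; [move/implyP: (H j) | apply/implyP/H]. Qed.

Lemma removableP la i :
  reflect (0 < la i /\ forall j : 'I_k, i < j -> la j < la i) (removable la i).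
Proof.
apply: (iffP andP) => -[la_i H]; split=> //; last by apply/forallP=> j; apply/implyP/H.
by move=> j; move/forallP: H => /(_ j)/implyP.
Qed.

Lemma is_shape_add la i : is_shape la -> is_shape (add_box la i) = addable la i.
Proof.
move/is_shapeP=> la_sh; apply/is_shapeP/addableP=> H.
  move=> j lt_j; have := H _ _ (ltnW lt_j); rewrite !ffunE eqxx.
  by rewrite (_ : j == i = false) ?addn0 ?addn1 //; apply: contraTF lt_j => /eqP->; rewrite ltnn.
move=> a b le_ab; rewrite !ffunE; have := la_sh _ _ le_ab.
case: (b =P i) le_ab => [->|_] le_ai le; last by lia.
have [->|a_i] := eqVneq a i; first by [].
by have := H a; rewrite ltn_neqAle le_ai (inj_eq val_inj) a_i => /(_ isT); lia.
Qed.

Lemma is_shape_del la i : is_shape la -> 0 < la i -> is_shape (del_box la i) = removable la i.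
Proof.
move/is_shapeP=> la_sh la_i; apply/is_shapeP/removableP=> [H|[_ H] a b le_ab].
  split=> // j lt_j; have := H _ _ (ltnW lt_j); rewrite !ffunE eqxx.
  rewrite (_ : j == i = false); first lia.
  by apply: contraTF lt_j => /eqP->; rewrite ltnn.
rewrite !ffunE; have := la_sh _ _ le_ab.
case: (a =P i) le_ab => [->|_] le_ib le; last by lia.
have [->|b_i] := eqVneq b i; first by [].
by have := H b; rewrite ltn_neqAle le_ib eq_sym (inj_eq val_inj) b_i => /(_ isT); lia.
Qed.

(** Adding a box in row i and removing one in row j commute when i and j differ. *)
Lemma swap_boxes la i j : i != j -> is_shape la -> 0 < la j ->
  let nu := add_box (del_box la j) i in
  [/\ del_box (add_box la i) j = nu, is_shape nu -> addable la i & is_shape nu -> removable la j].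
Proof.
move=> i_j /is_shapeP la_sh la_j nu; split.
- apply/ffunP=> a; rewrite !ffunE; have [->|_] := eqVneq a i; last by rewrite !addn0.
  by rewrite (negPf i_j) !subn0.
- move/is_shapeP=> nu_sh; apply/addableP=> a lt_a; have := nu_sh _ _ (ltnW lt_a).
  rewrite !ffunE eqxx (negPf i_j) (_ : a == i = false); first by lia.
  by apply: contraTF lt_a => /eqP->; rewrite ltnn.
move/is_shapeP=> nu_sh; apply/removableP; split=> // a lt_a; have := nu_sh _ _ (ltnW lt_a).
rewrite !ffunE eqxx [j == i]eq_sym (negPf i_j) (_ : a == j = false); first by lia.
by apply: contraTF lt_a => /eqP->; rewrite ltnn.
Qed.

Lemma del_add la i : del_box (add_box la i) i = la.
Proof. by apply/ffunP=> a; rewrite !ffunE addnK. Qed.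

Lemma add_del la i : 0 < la i -> add_box (del_box la i) i = la.
Proof.
move=> la_i; apply/ffunP=> a; rewrite !ffunE.
by have [->|_] := eqVneq a i; rewrite ?subnK // subn0 addn0.
Qed.

(** The rows in which a box can be added are the first one and those just below a row from which a
box can be removed. *)
Lemma card_addable la : is_shape la -> la ord_max = 0 ->
  \sum_i addable la i = (\sum_i removable la i).+1.
Proof.
move=> la_sh la_max; rewrite big_ord_recl [in RHS]big_ord_recr /=.
rewrite (_ : removable la ord_max = false) ?addn0; last by rewrite /removable la_max.
rewrite (_ : addable la ord0 = true) ?add1n; last by apply/addableP.
congr _.+1; apply: eq_bigr => i _; congr (nat_of_bool _).
move/is_shapeP: la_sh => la_sh.
apply/addableP/removableP => [H|[_ H] j lt_j].
  have lt : la (lift ord0 i) < la (widen_ord (leqnSn k') i) by apply: H => /=; rewrite /bump.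
  split=> [|j lt_j]; first by lia.
  by apply: leq_ltn_trans lt; apply: la_sh.
have := H (lift ord0 i); rewrite /= /bump /= => /(_ (leqnn _)) lt.
by apply: leq_trans lt _; apply: la_sh.
Qed.

(** Words in which every prefix has at least as many letters i as letters j whenever i <= j. They
encode standard tableaux (letter number a is the row of the entry a) in a form where the removal
of the last box is the removal of the last letter. *)
Fixpoint lattice_words n la : seq (seq 'I_k) :=
  if n is n'.+1 then
    if is_shape la then
      [seq rcons w i | i <- [seq i <- enum 'I_k | 0 < la i], w <- lattice_words n' (del_box la i)]
    else [::]
  else if la == [ffun=> 0] then [:: [::]] else [::].

Definition nb_words n la := size (lattice_words n la).

Lemma nb_words0 la : nb_words 0 la = (la == [ffun=> 0]).
Proof. by rewrite /nb_words /=; case: eqP. Qed.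

Lemma nb_wordsS n la :
  nb_words n.+1 la = is_shape la * \sum_(i | 0 < la i) nb_words n (del_box la i).
Proof.
rewrite /nb_words /=; case: ifP => _; rewrite ?mul0n // mul1n size_allpairs_dep sumnE.
by rewrite big_map big_filter big_enum_cond.
Qed.

Lemma nb_words_shape n la : 0 < nb_words n la -> is_shape la /\ \sum_i la i = n.
Proof.
elim: n la => [|n IHn] la.
  rewrite nb_words0; case: eqP => // -> _; split; first by apply/is_shapeP=> i j _; rewrite !ffunE.
  by rewrite big1 // => i _; rewrite ffunE.
rewrite nb_wordsS; case: is_shape => //; rewrite mul1n => gt0; split=> //.
have [i la_i /IHn[_ sum_i]] : exists2 i, 0 < la i & 0 < nb_words n (del_box la i).
  apply/exists_inP; apply: contraLR gt0 => /exists_inPn none.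
  by rewrite -leqNgt leqn0 sum_nat_eq0; apply/forall_inP=> i /none; rewrite -eqn0Ngt.
rewrite (bigD1 i) //= -sum_i [in RHS](bigD1 i) //= !ffunE eqxx -addSn; congr (_ + _); first by lia.
by apply: eq_bigr => j /negPf j_i; rewrite ffunE j_i subn0.
Qed.

(** The commutation relation DU - UD = 1 of the operators U and D of Young's lattice, which add
and remove a box: the two steps can be exchanged unless they concern the same row, and
[card_addable] counts these exceptions. *)
Lemma nb_words_up_down n la : is_shape la -> la ord_max = 0 ->
  \sum_i nb_words n.+1 (add_box la i) = nb_words n la +
    \sum_(j | 0 < la j) removable la j * \sum_i nb_words n (add_box (del_box la j) i).
Proof.
move=> la_sh la_max.
have downE i : nb_words n.+1 (add_box la i) = addable la i * nb_words n la +
    \sum_(j | (0 < la j) && (i != j)) removable la j * nb_words n (add_box (del_box la j) i).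
  rewrite nb_wordsS is_shape_add // (bigD1 i) /= ?ffunE ?eqxx ?addn1 // del_add mulnDr.
  congr (_ + _); rewrite big_distrr /=; apply: eq_big => [j|j].
    by rewrite ffunE [i == j]eq_sym; have [->|_] := eqVneq j i; rewrite ?andbF ?addn0.
  rewrite ffunE => /andP[la_j j_i]; rewrite (negPf j_i) addn0 in la_j; rewrite eq_sym in j_i.
  have [-> add_i rem_j] := swap_boxes j_i la_sh la_j.
  case: (posnP (nb_words n (add_box (del_box la j) i))) => [->|/nb_words_shape[nu_sh _]].
    by rewrite !muln0.
  by rewrite add_i ?rem_j.
under eq_bigr do rewrite downE.
rewrite big_split /= -big_distrl /= card_addable // mulSn -addnA; congr (_ + _).
rewrite (exchange_big_dep (fun j => 0 < la j)) /=; last by move=> i j _ /andP[].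
rewrite big_distrl /= [X in X + _](bigID (fun j => 0 < la j)) /=.
rewrite addnAC [X in _ + X]big1 ?addn0; last first.
  by move=> j; rewrite /removable => /negPf->.
rewrite -big_split /=; apply: eq_bigr => j la_j.
have -> : \sum_(i | (0 < la j) && (i != j)) removable la j * nb_words n (add_box (del_box la j) i)
  = removable la j * \sum_(i | i != j) nb_words n (add_box (del_box la j) i).
  by rewrite big_distrr; apply: eq_bigl => i; rewrite la_j.
by rewrite -mulnDr [in RHS](bigD1 j) //= add_del // addnC.
Qed.

(** By induction with [nb_words_up_down]: the standard tableaux of the shapes obtained from la by
adding one box are n + 1 times as many as those of shape la. The bound on n leaves an empty row at
the bottom. *)
Lemma nb_words_up n la : n < k -> is_shape la -> \sum_i la i = n ->
  \sum_i nb_words n.+1 (add_box la i) = n.+1 * nb_words n la.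
Proof.
move=> lt_n la_sh sum_la.
have la_max m (nu : shape) : m < k -> is_shape nu -> \sum_i nu i = m -> nu ord_max = 0.
  move=> lt_m nu_sh sum_nu; apply/eqP; rewrite -leqn0 leqNgt; apply/negP=> gt0.
  move: lt_m; rewrite -sum_nu ltnNge => /negP; apply.
  rewrite -[X in X <= _]card_ord -sum1_card; apply: leq_sum => i _; apply: leq_trans gt0 _.
  by move/is_shapeP: nu_sh; apply; rewrite -ltnS.
elim: n la lt_n la_sh sum_la => [|n IHn] la lt_n la_sh sum_la.
  rewrite nb_words_up_down ?(la_max 0) // mul1n big1 ?addn0 // => j la_j.
  by move: la_j; rewrite (_ : la j = 0) //; apply/eqP; move/eqP: sum_la; rewrite sum_nat_eq0 => /forall_inP->.
rewrite nb_words_up_down ?(la_max n.+1) // mulSn; congr (_ + _).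
rewrite nb_wordsS la_sh mul1n big_distrr /=; apply: eq_bigr => j la_j.
case: (boolP (removable la j)) => [rem_j|not_rem]; last first.
  rewrite mul0n; case: (posnP (nb_words n (del_box la j))) => [->|/nb_words_shape[]]; first by rewrite muln0.
  by rewrite is_shape_del // (negPf not_rem).
rewrite mul1n IHn ?(ltnW lt_n) ?is_shape_del //.
move: sum_la; rewrite (bigD1 j) //= [in X in _ -> X](bigD1 j) //= ffunE eqxx.
under [X in _ -> _ + X = _]eq_bigr => i /negPf i_j do rewrite ffunE i_j subn0.
by lia.
Qed.
End LatticeWords.

Section EvenShapes.
Variables k' M' : nat.
Local Notation k := k'.+1.
Local Notation shape := {ffun 'I_k -> nat}.
Local Notation half := {ffun 'I_k -> 'I_M'.+1}.

Definition dbl (nu : half) : shape := [ffun i => (nu i : nat).*2].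

(** Even shapes are represented by their halves. The bounded entries make the sum finite. *)
Definition nb_even_words r := \sum_(nu : half) nb_words r.*2 (dbl nu).

(** Completes the addition of one box to row i of an even shape to that of two boxes. *)
Definition grow (p : half * 'I_k) : half * 'I_k :=
  ([ffun j => inord (p.1 j + (j == p.2))], p.2).

(** By [nb_words_up] the left-hand side counts the lattice words of the shapes that have one box
more than an even shape, say in row i. Appending the letter i once more gives a lattice word of an
even shape, and the last letter recovers i. *)
Lemma even_words_step r : r.*2 < k -> r < M' ->
  r.*2.+1 * nb_even_words r <= nb_even_words r.+1.
Proof.
move=> lt_rk lt_rM.
pose g (p : half * 'I_k) := nb_words r.*2.+1 (add_box (dbl p.1) p.2).
pose g' (p : half * 'I_k) := if 0 < dbl p.1 p.2 then
  is_shape (dbl p.1) * nb_words r.*2.+1 (del_box (dbl p.1) p.2) else 0.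
have le_g : r.*2.+1 * nb_even_words r <= \sum_p g p.
  rewrite -(pair_bigA _ (fun nu i => g (nu, i))) /nb_even_words big_distrr /=.
  apply: leq_sum => nu _; case: (posnP (nb_words r.*2 (dbl nu))) => [->|]; first by rewrite muln0.
  by case/nb_words_shape=> sh sum_nu; rewrite /g /= nb_words_up.
have g'E : \sum_p g' p = nb_even_words r.+1.
  rewrite -(pair_bigA _ (fun nu i => g' (nu, i))) /nb_even_words /=; apply: eq_bigr => nu _.
  by rewrite doubleS nb_wordsS big_distrr /= [RHS]big_mkcond.
apply: leq_trans le_g _; rewrite -g'E.
have growP p : g p != 0 -> dbl (grow p).1 = add_box (add_box (dbl p.1) p.2) p.2.
  rewrite -lt0n => /nb_words_shape[_ sum_p]; apply/ffunP=> j; rewrite !ffunE /=.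
  have [->|_] := eqVneq j p.2; last by rewrite !addn0 inordK.
  have : (p.1 p.2).*2 < r.*2.+1.
    by rewrite -sum_p (bigD1 p.2) //= !ffunE eqxx addn1 ltnS leq_addr.
  by move=> lt_p; rewrite inordK; lia.
have grow_inj : {in [pred p | g p != 0] &, injective grow}.
  move=> [nu i] [mu j] /growP eq1 /growP eq2 eq_gr.
  have eij : i = j by case: eq_gr.
  subst j; congr (_, _); move: eq1; rewrite eq_gr eq2 => /ffunP eq_b.
  by apply/ffunP=> a; apply/val_inj; have := eq_b a; rewrite !ffunE /=; lia.
rewrite (bigID (fun p => g p != 0)) /= [X in _ + X]big1 ?addn0; last first.
  by move=> p; rewrite negbK => /eqP.
apply: (@leq_trans (\sum_(p | g p != 0) g' (grow p))).
  apply: leq_sum => p gp; rewrite /g' (growP _ gp) /= del_add !ffunE eqxx addn1 /=.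
  have := gp; rewrite -lt0n => /nb_words_shape[p_sh _].
  rewrite (_ : is_shape _ = true) ?mul1n //; apply/is_shapeP=> a b le_ab.
  move/is_shapeP: p_sh => p_sh; have := p_sh _ _ le_ab; rewrite !ffunE.
  case: (eqVneq a p.2) le_ab => [->|a_p]; case: (eqVneq b p.2) => [->|b_p] //= le_ab; try lia.
rewrite -(@big_imset _ _ _ _ _ grow [pred p | g p != 0] g') /=; last exact: grow_inj.
by rewrite [X in _ <= X](bigID (mem [set grow p | p in [pred p | g p != 0]])) /= leq_addr.
Qed.

Lemma even_words_ge r : r.*2 < k.+1 -> r < M'.+1 -> double_fact r <= nb_even_words r.
Proof.
elim: r => [|r IHr] lt_rk lt_rM.
  rewrite /double_fact big_ord0 /nb_even_words (bigD1 [ffun=> ord0]) //= nb_words0.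
  by rewrite (_ : dbl _ = [ffun=> 0]) ?eqxx //; apply/ffunP=> i; rewrite !ffunE.
rewrite /double_fact big_ord_recr /= -/(double_fact r) mulnC.
apply: leq_trans (even_words_step _ _); last by []; last by move: lt_rk; rewrite doubleS; lia.
by rewrite leq_mul2l IHr ?orbT //; move: lt_rk; rewrite doubleS; lia.
Qed.
End EvenShapes.

(** Used to read the column of an entry in its row as a number of occurrences of a letter. *)
Lemma index_filter_count (T : eqType) (P : pred T) (s : seq T) a :
  P a -> index a (filter P s) = count P (take (index a s) s).
Proof.
move=> Pa; elim: s => //= b s IHs; case: (eqVneq b a) => [->|b_a] /=.
  by rewrite Pa /= eqxx.
by case: (P b); rewrite /= ?(negPf b_a) IHs.
Qed.

Section WordsToTableaux.
Variable k' : nat.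
Local Notation k := k'.+1.
Local Notation shape := {ffun 'I_k -> nat}.
Implicit Types (la : shape) (w : seq 'I_k).

(** Shapes have a fixed number of rows here, while partitions have no zero part. *)
Definition nz_rows la : seq 'I_k := [seq i <- enum 'I_k | 0 < la i].
Definition shape_seq la : seq nat := [seq la i | i <- nz_rows la].

Lemma lattice_wordsP n la w : w \in lattice_words n la ->
  [/\ size w = n, forall i, count_mem i w = la i
    & forall m (i j : 'I_k), i <= j -> count_mem j (take m w) <= count_mem i (take m w)].
Proof.
elim: n la w => [|n IHn] la w /=.
  case: eqP => // ->; rewrite inE => /eqP->; split=> // i; by rewrite ffunE.
case: ifP => // /is_shapeP la_sh /allpairsPdep[i [v [i_nz /IHn[size_v count_v lat_v] ->]]].
move: i_nz; rewrite mem_filter => /andP[la_i _].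
have count_w j : count_mem j (rcons v i) = la j.
  rewrite -cats1 count_cat count_v ffunE /= addn0 eq_sym.
  by have [->|_] := eqVneq j i; rewrite ?subnK // subn0 addn0.
split=> // [|m a b le_ab]; first by rewrite size_rcons size_v.
case: (leqP m n) => le_m; first by rewrite -cats1 takel_cat ?size_v //; apply: lat_v.
by rewrite take_oversize ?size_rcons ?size_v // !count_w la_sh.
Qed.

Lemma lattice_words_uniq n la : uniq (lattice_words n la).
Proof.
elim: n la => [|n IHn] la /=; first by case: ifP.
case: ifP => // _; apply: allpairs_uniq_dep => //.
  exact/filter_uniq/enum_uniq.
by move=> [i v] [j u] /= _ _ /rcons_inj[-> ->].
Qed.

Section OneWord.
Variables (n : nat) (la : shape) (w : seq 'I_k).
Hypothesis w_lat : w \in lattice_words n la.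

Definition letter (a : 'I_n) : 'I_k := nth ord0 w a.
Definition word_tab : seq (seq 'I_n) :=
  [seq [seq a <- enum 'I_n | letter a == i] | i <- nz_rows la].

Lemma word_letters : w = [seq letter a | a <- enum 'I_n].
Proof.
have [size_w _ _] := lattice_wordsP w_lat.
apply: (@eq_from_nth _ ord0); first by rewrite size_map size_enum_ord.
rewrite size_w => i lt_i; rewrite (nth_map (Ordinal lt_i)) ?size_enum_ord //.
by rewrite /letter nth_enum_ord.
Qed.

Lemma letter_nz a : letter a \in nz_rows la.
Proof.
have [size_w count_w _] := lattice_wordsP w_lat.
rewrite mem_filter mem_enum andbT -count_w -has_count has_pred1 mem_nth // size_w //.
Qed.

Lemma word_row a : row_of word_tab a = index (letter a) (nz_rows la).
Proof.
rewrite /row_of /word_tab find_map; apply: eq_find => i /=.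
by rewrite mem_filter mem_enum andbT eq_sym.
Qed.

Lemma word_col a : col_of word_tab a = count_mem (letter a) (take a w).
Proof.
rewrite /col_of word_row (nth_map (letter a)) ?index_mem ?letter_nz // nth_index ?letter_nz //.
rewrite index_filter_count // index_enum_ord word_letters -map_take count_map.
by apply: eq_count => b /=.
Qed.

(** The lattice condition says that the columns increase, and the rows increase because positions
are listed in order. *)
Lemma word_tab_standard : is_standard word_tab.
Proof.
have [size_w count_w lat_w] := lattice_wordsP w_lat.
have nth_w (a : 'I_n) : nth ord0 w a = letter a by [].
have take_S (a : 'I_n) i : count_mem i (take a.+1 w) = count_mem i (take a w) + (letter a == i).
  by rewrite (take_nth ord0) ?size_w // -cats1 count_cat /= addn0.
have count_mono (i : 'I_k) p q : p <= q -> count_mem i (take p w) <= count_mem i (take q w).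
  by move=> le_pq; rewrite -(subnKC le_pq) takeD count_cat leq_addr.
apply/forallP=> a; apply/forallP=> b; apply/implyP; rewrite !word_row !word_col.
case/orP=> /andP[/eqP eq_ab lt_ab]; rewrite ltnNge; apply/negP=> le_ba.
  move: lt_ab; have -> : letter a = letter b.
    by rewrite -(nth_index ord0 (letter_nz a)) eq_ab nth_index // letter_nz.
  by rewrite ltnNge count_mono.
have lt_ltr : letter a < letter b.
  have ltr_trans : transitive (fun i j : 'I_k => i < j) by move=> x y z; apply: ltn_trans.
  have rows_sorted : sorted (fun i j : 'I_k => i < j) (nz_rows la).
    apply: (subseq_sorted ltr_trans (filter_subseq _ _)).
    have := iota_ltn_sorted 0 k; rewrite -val_enum_ord sorted_map.
    by apply: sub_sorted => x y.
  exact: (sorted_ltn_index ltr_trans rows_sorted _ _ (letter_nz a) (letter_nz b) lt_ab).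
move: le_ba; rewrite leq_eqVlt => /orP[/eqP/val_inj e|lt_ba]; first by rewrite e ltnn in lt_ltr.
have := lat_w b.+1 _ _ (ltnW lt_ltr); rewrite (take_S b (letter b)) eqxx -eq_ab addn1.
by rewrite ltnNge count_mono.
Qed.

Lemma word_tab_Std : word_tab \in Std n (shape_seq la).
Proof.
rewrite mem_filter word_tab_standard /=; apply/mapP; exists (flatten word_tab).
  rewrite mem_permutations; apply: uniq_perm; rewrite ?enum_uniq //.
    rewrite /word_tab; have : uniq (nz_rows la) by exact/filter_uniq/enum_uniq.
    elim: nz_rows => //= i s IHs /andP[i_s /IHs s_uniq].
    rewrite cat_uniq s_uniq andbT; apply/andP; split; first exact/filter_uniq/enum_uniq.
    apply/hasPn=> a /flatten_mapP[j js]; rewrite /= mem_filter => /andP[/eqP letter_a _].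
    by rewrite mem_filter mem_enum andbT letter_a; apply: contra i_s => /eqP<-.
  move=> a; rewrite mem_enum; apply/flatten_mapP; exists (letter a); first exact: letter_nz.
  by rewrite mem_filter eqxx mem_enum.
have [_ count_w _] := lattice_wordsP w_lat.
rewrite -[LHS]flattenK; congr reshape; rewrite /seq.shape /word_tab -map_comp.
apply: eq_map => i /=.
by rewrite size_filter -count_w word_letters [RHS]count_map; apply: eq_count => a.
Qed.
End OneWord.

(** The word is recovered from its tableau through the rows of the entries. *)
Lemma nb_words_Std n la : nb_words n la <= size (Std n (shape_seq la)).
Proof.
rewrite /nb_words -(size_map (@word_tab n la)); apply: uniq_leq_size; last first.
  by move=> t /mapP[w w_lat ->]; apply: word_tab_Std.
rewrite map_inj_in_uniq ?lattice_words_uniq // => v w v_lat w_lat eq_t.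
rewrite (word_letters v_lat) (word_letters w_lat); apply: eq_map => a.
rewrite -(nth_index ord0 (letter_nz v_lat a)) -(word_row la v) eq_t word_row.
by rewrite nth_index // (letter_nz w_lat).
Qed.

End WordsToTableaux.

Lemma nth_filter_pos (s : seq nat) i :
  sorted geq s -> nth 0 [seq x <- s | 0 < x] i = nth 0 s i.
Proof.
have geq_trans : transitive geq by move=> a b c /= ba ac; apply: leq_trans ac ba.
elim: s i => //= x s IHs i; rewrite path_sortedE // => /andP[/allP le_x s_sorted].
case: posnP => [x0|_]; last by case: i => //= i; apply: IHs.
have s0 : forall y, y \in s -> y = 0.
  by move=> y /le_x /=; rewrite x0 leqn0 => /eqP.
have -> : [seq y <- s | 0 < y] = [::].
  by apply/nilP; rewrite /nilp size_filter -leqn0 leqNgt -has_count -all_predC; apply/allP=> y /s0->.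
rewrite nth_nil; case: i => [//|i] /=.
by case: (ltnP i (size s)) => lt_i; [rewrite (s0 _ (mem_nth 0 lt_i)) | rewrite nth_default].
Qed.

Section Count.
Variable r : nat.
Local Notation k := r.*2.+1.
Local Notation half := {ffun 'I_k -> 'I_r.+2}.

Lemma shape_seqE (la : {ffun 'I_k -> nat}) :
  shape_seq la = [seq x <- [seq la i | i <- enum 'I_k] | 0 < x].
Proof. by rewrite /shape_seq /nz_rows filter_map. Qed.

Lemma shape_sorted (la : {ffun 'I_k -> nat}) : is_shape la -> sorted geq [seq la i | i <- enum 'I_k].
Proof.
move/is_shapeP=> la_sh; rewrite sorted_map.
have := iota_ltn_sorted 0 k; rewrite -val_enum_ord sorted_map.
by apply: sub_sorted => i j /= lt_ij; apply/la_sh/ltnW.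
Qed.

Lemma nth_shape_seq (la : {ffun 'I_k -> nat}) (i : 'I_k) : is_shape la ->
  nth 0 (shape_seq la) i = la i.
Proof.
move=> la_sh; rewrite shape_seqE nth_filter_pos ?shape_sorted //.
by rewrite (nth_map i) ?size_enum_ord // nth_ord_enum.
Qed.

Lemma shape_seq_even (nu : half) : 0 < nb_words r.*2 (dbl nu) ->
  shape_seq (dbl nu) \in even_partitions r.
Proof.
case/nb_words_shape=> nu_sh sum_nu; rewrite mem_filter mem_partitions.
have geq_trans : transitive geq by move=> a b c /= ba ac; apply: leq_trans ac ba.
apply/andP; split; first by apply/allP=> x /mapP[i _ ->]; rewrite ffunE odd_double.
apply/and3P; split.
- by rewrite shape_seqE sorted_filter ?shape_sorted.
- by rewrite shape_seqE mem_filter.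
rewrite shape_seqE sumnE big_filter big_map big_enum_cond big_mkcond.
apply/eqP; apply: etrans sum_nu; apply: eq_bigr => i _.
by case: posnP => [->|].
Qed.

(** With 2r + 1 rows and half-lengths up to r + 1 there is room for all the steps of
[even_words_ge]; the shapes that contribute are distinct even partitions of 2r. *)
Lemma standard_count : double_fact r <= \sum_(la <- even_partitions r) size (Std r.*2 la).
Proof.
apply: (@leq_trans (nb_even_words r.*2 r.+1 r)).
  by apply: even_words_ge; rewrite ltnS.
rewrite /nb_even_words (bigID (fun nu : half => 0 < nb_words r.*2 (dbl nu))) /=.
rewrite [X in _ + X]big1 ?addn0; last by move=> nu; rewrite -eqn0Ngt => /eqP.
pose P := [pred nu : half | 0 < nb_words r.*2 (dbl nu)].
apply: (@leq_trans (\sum_(la <- [seq shape_seq (dbl nu) | nu <- enum P]) size (Std r.*2 la))).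
  by rewrite big_map big_enum; apply: leq_sum => nu _; apply: nb_words_Std.
apply: (@uniq_sub_le_big _ _ leq leqnn (fun x y => leq_addr y x)).
- rewrite map_inj_in_uniq ?enum_uniq // => nu mu; rewrite !mem_enum !inE.
  move=> /nb_words_shape[nu_sh _] /nb_words_shape[mu_sh _] eq_s.
  apply/ffunP=> i; apply/val_inj; have := nth_shape_seq i nu_sh.
  by rewrite eq_s nth_shape_seq // !ffunE /=; lia.
- exact/filter_uniq/partitions_uniq.
by move=> la /mapP[nu]; rewrite mem_enum => nuP ->; apply: shape_seq_even.
Qed.

End Count.

(** * Matchings as a permutation module *)

Local Open Scope ring_scope.

Section MatchingAction.
Variable T : finType.

Lemma eq_matching (D E : matching T) : D =1 E -> D = E.
Proof. by move=> eqDE; apply/val_inj/ffunP. Qed.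

Definition mact (D : matching T) (s : {perm T}) : matching T :=
  relabel (permK s) (permKV s) D.

Lemma mactE D s x : mact D s x = s (D ((s^-1)%g x)).
Proof. by rewrite /= ffunE. Qed.

Lemma mact_is_action : is_action [set: {perm T}] mact.
Proof.
apply: is_total_action => [D|D s t]; apply: eq_matching => x.
  by rewrite mactE invg1 !perm1.
by rewrite !mactE invMg !permM.
Qed.
Canonical mact_action := Action mact_is_action.

End MatchingAction.

Section Restriction.
Variable T : finType.
(** A permutation that preserves E is the product of its actions on E and on the complement of E.
*)
Lemma restr_split (E : {set T}) (s : {perm T}) : (forall a, (s a \in E) = (a \in E)) ->
  [/\ {in E, restr_perm E s =1 s}, forall a, a \notin E -> restr_perm E s a = a
    & s = (restr_perm E s * restr_perm (~: E) s)%g].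
Proof.
move=> sE; have stab (A : {set T}) : (forall a, (s a \in A) = (a \in A)) -> s \in 'N(A | 'P)%g.
  by move=> sA; apply/astabsP => a; rewrite /= apermE sA.
have sE' := stab _ sE; have sC : s \in 'N(~: E | 'P)%g by apply: stab => a; rewrite !inE sE.
split; first by move=> a; apply: restr_permE.
  by move=> a; apply: out_perm; apply: restr_perm_on.
apply/permP=> a; rewrite permM; case: (boolP (a \in E)) => aE.
  by rewrite (restr_permE sE' aE) (out_perm (restr_perm_on _ _)) // inE sE aE.
by rewrite (out_perm (restr_perm_on E s)) // restr_permE // inE.
Qed.
End Restriction.

Section BaseMatching.
Variable r : nat.
Local Notation N := r.*2.

(** The matching of the caps of [Ahat], on the labels themselves. *)
Definition M0 : matching 'I_N := relabel (@bottomK N) (@inlK0 N) (Ahat r).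

Lemma M0E (a : 'I_N) : M0 a = Ordinal (ltn_pair a).
Proof. by rewrite /= !ffunE. Qed.

(** Exchanges the columns 2j and 2j + 1. *)
Definition pcol (c : nat) : nat := if odd c then c.-1 else c.+1.

Lemma odd_pcol c : odd (pcol c) = ~~ odd c.
Proof. by rewrite /pcol; case: c => //= c; case E: (odd c); rewrite /= ?E. Qed.

Section EvenShape.
Variable la : seq nat.
Hypotheses (la_part : is_partition N la) (la_even : all (fun i => ~~ odd i) la).

Lemma odd_flatten i j : odd (flatten_index la i j) = odd j.
Proof.
rewrite /flatten_index oddD; suff -> : odd (sumn (take i la)) = false by [].
elim: la i la_even => [|x s IHs] [|i] //= /andP[/negPf x_even s_even].
by rewrite oddD x_even IHs.
Qed.

Lemma nth_even i : odd (nth 0%N la i) = false.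
Proof.
case: (ltnP i (size la)) => lt_i; last by rewrite nth_default.
by apply/negbTE; move/allP: la_even; apply; rewrite mem_nth.
Qed.

(** As all the rows are even, each of them starts at an even label; so the edges of [M0] join the
boxes of columns 2j and 2j + 1 of one row. *)
Lemma M0_coords (a : 'I_N) :
  trow la (M0 a) = trow la a /\ tcol la (M0 a) = pcol (tcol la a).
Proof.
have odd_a : odd a = odd (tcol la a) by rewrite -{1}(flatten_tcoords la_part a) odd_flatten.
have lt_c : (pcol (tcol la a) < nth 0 la (trow la a))%N.
  rewrite /pcol; have := tcol_lt la_part a; case: ifP => [_|even_c lt_c].
    by apply: leq_ltn_trans; apply: leq_pred.
  rewrite ltn_neqAle lt_c andbT; apply/eqP=> /(congr1 odd) /=.
  by rewrite even_c nth_even.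
have M0a : M0 a = flatten_index la (trow la a) (pcol (tcol la a)) :> nat.
  rewrite M0E /= /pcol -odd_a; have := flatten_tcoords la_part a.
  move: odd_a; case: ifP => odd_a /esym odd_c fa; rewrite -{1}fa /flatten_index ?addnS //.
  by case: (tcol la a) odd_c => // c _; rewrite addnS.
by rewrite (trowE la_part) (tcolE la_part) M0a flatten_indexKl ?flatten_indexKr.
Qed.

Definition col_paired (M : matching 'I_N) := forall a, tcol la (M a) = pcol (tcol la a).
Definition row_paired (M : matching 'I_N) := forall a, trow la (M a) = trow la a.

Lemma col_paired_M0 c : c \in level_stab (@tcol N la) -> col_paired (mact M0 c).
Proof.
move=> cC a; rewrite mactE; have /level_stabP cCV := groupVr (G := level_stab_gp _) cC.
by move/level_stabP: cC => ->; rewrite (M0_coords _).2 cCV.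
Qed.

Lemma row_paired_act M s : s \in level_stab (@trow N la) -> row_paired M -> row_paired (mact M s).
Proof.
move=> sR Mr a; rewrite mactE; have /level_stabP sRV := groupVr (G := level_stab_gp _) sR.
by move/level_stabP: sR => ->; rewrite Mr sRV.
Qed.

Lemma row_paired_M0 : row_paired M0.
Proof. by move=> a; have [] := M0_coords a. Qed.

Lemma paired_eq_M0 (M : matching 'I_N) : row_paired M -> col_paired M -> M = M0.
Proof.
move=> Mr Mc; apply: eq_matching => a; apply: (tcoords_inj la_part).
  by rewrite Mr (M0_coords a).1.
by rewrite Mc (M0_coords a).2.
Qed.

(** The permutation c commutes with [M0], which exchanges the even columns with the odd ones; so
the restrictions of c to the even and to the odd columns are conjugate and have the same sign. *)
Lemma col_stab_even (c : {perm 'I_N}) : c \in level_stab (@tcol N la) -> mact M0 c = M0 ->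
  odd_perm c = false.
Proof.
move=> /level_stabP cC cM0; pose E := [set a : 'I_N | ~~ odd (tcol la a)].
have cE a : (c a \in E) = (a \in E) by rewrite !inE cC.
have [inE_c outE_c ->] := restr_split cE; rewrite odd_permM.
have M0_inj : injective M0 by apply: (can_inj (partnerK M0)).
pose p := perm M0_inj.
have pM0 a : p a = M0 a by rewrite permE.
have pV a : (p^-1)%g a = M0 a by apply: (canLR (permK p)); rewrite pM0 partnerK.
have comm a : M0 (c a) = c (M0 a).
  by rewrite -{1}cM0 mactE permK.
have cEC a : (c a \in ~: E) = (a \in ~: E) by rewrite !inE cC.
have [inC_c outC_c _] := restr_split cEC.
have M0_E a : (M0 a \in E) = (a \notin E).
  by rewrite !inE (M0_coords a).2 odd_pcol.
have -> : restr_perm (~: E) c = (restr_perm E c ^ p)%g.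
  apply/permP=> a; rewrite conjgE !permM pV pM0.
  case: (boolP (a \in E)) => aE.
    rewrite outC_c; last by rewrite inE negbK.
    by rewrite outE_c ?partnerK // M0_E aE.
  rewrite inC_c; last by rewrite inE.
  by rewrite inE_c ?M0_E // -comm partnerK.
by rewrite odd_permJ addbb.
Qed.

End EvenShape.
End BaseMatching.

(** * Bases of the submodules of matchings *)

(** A relation is killed coefficient by coefficient; in particular two different indices cannot
give the same vector. *)
Lemma free_family (K : fieldType) (V : vectType K) (I : eqType) (P : seq I) (f : I -> V) :
  uniq P ->
  (forall c : I -> K, \sum_(p <- P) c p *: f p = 0 -> {in P, forall p, c p = 0}) ->
  free [seq f p | p <- P].
Proof.
elim: P => [|p P IHP] /=; first by rewrite nil_free.
case/andP=> pP P_uniq indep.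
have eqP' (c d : I -> K) : \sum_(q <- P) (if q == p then d q else c q) *: f q = \sum_(q <- P) c q *: f q.
  by rewrite big_seq [RHS]big_seq; apply: eq_bigr => q qP; case: eqP => // qp; rewrite -qp qP in pP.
have P_free : free [seq f p | p <- P].
  apply: IHP => // c sum0 q qP.
  have := indep (fun q => if q == p then 0 else c q).
  rewrite big_cons eqxx scale0r add0r eqP' => /(_ sum0 q); rewrite inE qP orbT => /(_ isT).
  by case: eqP => // qp; rewrite -qp qP in pP.
rewrite free_cons P_free andbT; apply/negP=> /(free_span P_free)[k fpE _].
have := indep (fun q => if q == p then -1 else k (f q)).
rewrite big_cons eqxx eqP' scaleN1r fpE big_map addNr => /(_ erefl p (mem_head _ _)).
by rewrite eqxx => /eqP; rewrite oppr_eq0 oner_eq0.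
Qed.

Lemma span_family (K : fieldType) (V : vectType K) (I : eqType) (P : seq I) (f : I -> V) v :
  free [seq f p | p <- P] -> v \in <<[seq f p | p <- P]>>%VS ->
  exists c : I -> K, v = \sum_(p <- P) c p *: f p.
Proof. by move=> fr /(free_span fr)[k -> _]; exists (k \o f); rewrite big_map. Qed.

Section MatchingModule.
Variables (K : numClosedFieldType) (r : nat).
Local Notation N := r.*2.
Local Notation mt := (matching 'I_N).
Local Notation M := {ffun mt -> K^o}.
Local Notation to := (@mact_action 'I_N).
Local Notation d0 := (unit_vec K (M0 r)).

(** The vector y_la x_la * d0; see [pact] for the order of the factors. *)
Definition uvec la : M := casym to la (rsym to la d0).
Definition theta_vec la t : M := pact to (tab_perm la t)^-1%g (uvec la).

Lemma even_partP la : la \in even_partitions r ->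
  is_partition N la /\ all (fun i => ~~ odd i) la.
Proof. by rewrite mem_filter mem_partitions => /andP[]. Qed.

(** The coefficient at [M0] counts pairs of a row permutation s and a column permutation c that
bring [M0] back to itself, with the sign of c. For such a pair s [M0] pairs both rows and columns
like [M0] and so equals [M0]; then c fixes [M0] and is even. *)
Lemma uvec_neq0 la : la \in even_partitions r -> uvec la != 0.
Proof.
case/even_partP=> la_part la_even; suff: uvec la (M0 r) != 0.
  by apply: contra => /eqP->; rewrite ffunE.
have -> : uvec la (M0 r) = (\sum_(c in level_stab (@tcol N la)) \sum_(s in level_stab (@trow N la))
    (mact (mact (M0 r) s) c == M0 r))%:R.
  rewrite /uvec /casym /rsym /psum sum_ffunE natr_sum; apply: eq_bigr => c cC.
  rewrite linear_sum scaler_sumr sum_ffunE natr_sum; apply: eq_bigr => s sR.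
  rewrite /= scale1r !pact_unit_vec !ffunE /= eq_sym; case: eqP => [fixed|_]; last exact: mulr0.
  have sM0 : mact (M0 r) s = M0 r.
    apply: (paired_eq_M0 la_part la_even).
      by apply: row_paired_act => //; apply: row_paired_M0.
    have -> : mact (M0 r) s = mact (M0 r) (c^-1)%g.
      by rewrite -{2}fixed -[RHS](actM to) mulgV act1.
    by apply: col_paired_M0 => //; apply: (groupVr (G := level_stab_gp _)).
  rewrite sM0 in fixed.
  by rewrite /psign (col_stab_even la_part la_even cC fixed) expr0 scale1r.
rewrite pnatr_eq0 -lt0n (bigD1 1%g) /= ?(group1 (level_stab_gp _)) //.
rewrite (bigD1 1%g) /= ?(group1 (level_stab_gp _)) //.
by rewrite !(act1 to) eqxx.
Qed.

Definition tab_pairs (L : seq (seq nat)) : seq (seq nat * seq (seq 'I_N)) :=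
  [seq (la, t) | la <- L, t <- Std N la].

Lemma tab_pairs_uniq L : uniq L -> {in L, forall la, is_partition N la} -> uniq (tab_pairs L).
Proof.
move=> L_uniq L_part; apply: allpairs_uniq_dep => //; first by move=> la /L_part/Std_uniq.
by move=> [la t] [mu u] /= _ _ [-> ->].
Qed.

Lemma sum_tab_pairs L (c : seq nat * seq (seq 'I_N) -> K) :
  \sum_(p <- tab_pairs L) c p *: theta_vec p.1 p.2
   = \sum_(la <- L) std_comb la (fun t => c (la, t)) to d0.
Proof. by rewrite big_allpairs_dep; apply: eq_bigr => la _. Qed.

(** In a relation with a non-zero coefficient, [shape_detect] would produce a non-zero multiple of
some [uvec]. *)
Lemma theta_free L : uniq L -> {subset L <= even_partitions r} ->
  free [seq theta_vec p.1 p.2 | p <- tab_pairs L].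
Proof.
move=> L_uniq L_even; have L_part : {in L, forall la, is_partition N la}.
  by move=> la /L_even/even_partP[].
apply: free_family; first exact: tab_pairs_uniq.
move=> c; rewrite sum_tab_pairs => sum0 p /allpairsPdep[la [t [laL tS ->]]].
apply/eqP; apply: contraTT isT => ct.
have [mu [muL _ [s [kap [kap0]]]]] :=
  shape_detect (c := fun la t => c (la, t)) L_uniq L_part laL tS ct.
move/(_ _ to d0)/esym; rewrite sum0 !linear0 => /eqP; rewrite scaler_eq0 (negPf kap0) /=.
by rewrite (negPf (uvec_neq0 (L_even _ muL))).
Qed.

Lemma even_partitions_uniq : uniq (even_partitions r).
Proof. exact/filter_uniq/partitions_uniq. Qed.

Lemma card_matchings_r : (#|{: mt}| <= double_fact r)%N.
Proof. by apply: card_matching; rewrite card_ord. Qed.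

(** A free family that is at least as large as the number of matchings. *)
Lemma theta_basis : basis_of fullv [seq theta_vec p.1 p.2 | p <- tab_pairs (even_partitions r)].
Proof.
rewrite basisEfree theta_free ?even_partitions_uniq //= subvf /= dimvf /dim /= muln1.
rewrite size_map size_allpairs_dep sumnE big_map.
exact: leq_trans card_matchings_r (standard_count r).
Qed.

(** This says that the shape la occurs in M only through [uvec]. In the basis [theta_basis], c_la
kills the components of [M0] of larger or equal weight and r_la those of smaller weight, except
for the shape la itself, where [sandwich_casym] applies. *)
Lemma rsym_casym_d0 la : la \in even_partitions r ->
  exists kappa : K, rsym to la (casym to la d0) = kappa *: rsym to la (uvec la).
Proof.
move=> laL; have [la_part _] := even_partP laL.
have : d0 \in <<[seq theta_vec p.1 p.2 | p <- tab_pairs (even_partitions r)]>>%VS.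
  by rewrite (span_basis theta_basis) memvf.
case/(span_family (theta_free even_partitions_uniq (fun _ => id)))=> c; rewrite sum_tab_pairs => d0E.
have [kap kapP] := sandwich_casym K la_part.
exists (\sum_(t <- Std N la) c (la, t) * kap (tab_perm la t)^-1%g).
rewrite {1}d0E (bigD1_seq la) ?even_partitions_uniq //= linearD linearD /=.
rewrite -[RHS]addr0; congr (_ + _).
  rewrite /std_comb [casym _ _ (\sum_(t <- _) _)]linear_sum [LHS]linear_sum scaler_suml.
  apply: eq_bigr => t _ /=.
  by rewrite linearZ linearZ /= kapP linearZ scalerA.
rewrite big_seq_cond [casym _ _ _]linear_sum [LHS]linear_sum big1 // => mu /andP[muL mu_la] /=.
have [mu_part _] := even_partP muL.
rewrite /std_comb [casym _ _ _]linear_sum [LHS]linear_sum big1 // => t _ /=; rewrite linearZ linearZ /=.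
case: (leqP (dominance_weight N la) (dominance_weight N mu)) => [le_w|/ltnW le_w].
  by rewrite casym_casym_rsym0 // linear0 scaler0.
have expand g : rsym to la (casym to la g) =
    \sum_(s in level_stab (@tcol N la)) psign K s *: rsym to la (pact to s g).
  by rewrite /casym /psum [LHS]linear_sum; apply: eq_bigr => s _; rewrite linearZ.
rewrite expand big1 ?scaler0 // => s _.
rewrite -pactM rsym_casym0 ?scaler0 //.
by apply: contra mu_la => /(rows_spread_eq la_part mu_part le_w)->.
Qed.

(** Modulo the vectors of the shapes in P, an element of Ker is a combination of the other basis
vectors. If it were not zero, [shape_detect] would put some [uvec] of a shape outside P in Ker,
and with it r_la c_la d0, by [rsym_casym_d0]. *)
Lemma theta_kernel_basis (Ker : {vspace M}) (P : pred (seq nat)) :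
  (forall s z, z \in Ker -> pact to s z \in Ker) ->
  {in even_partitions r, forall la, P la -> uvec la \in Ker} ->
  {in even_partitions r, forall la, ~~ P la -> rsym to la (casym to la d0) \notin Ker} ->
  basis_of Ker [seq theta_vec p.1 p.2 | p <- tab_pairs [seq la <- even_partitions r | P la]].
Proof.
move=> Ker_act Ker_P Ker_nP; set L := filter P _.
have Ker_sum H chi z : z \in Ker -> psum to H chi z \in Ker.
  by move=> zK; apply: memv_suml => s _; apply/memvZ/Ker_act.
have L_uniq : uniq L by apply/filter_uniq/even_partitions_uniq.
have L_even : {subset L <= even_partitions r} by move=> la; rewrite mem_filter => /andP[].
have theta_Ker p : p \in tab_pairs L -> theta_vec p.1 p.2 \in Ker.
  case/allpairsPdep=> la [t [laL _ ->]]; apply: Ker_act; apply: Ker_P; first exact: L_even.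
  by move: laL; rewrite mem_filter => /andP[].
rewrite /basis_of theta_free // andbT eqEsubv; apply/andP; split.
  by apply/span_subvP=> v /mapP[p pL ->]; apply: theta_Ker.
apply/subvP=> z zK.
have : z \in <<[seq theta_vec p.1 p.2 | p <- tab_pairs (even_partitions r)]>>%VS.
  by rewrite (span_basis theta_basis) memvf.
case/(span_family (theta_free even_partitions_uniq (fun _ => id)))=> c; rewrite sum_tab_pairs.
rewrite (bigID P) /= -big_filter -/L -[X in _ + X]big_filter.
set L' := filter (fun la => ~~ P la) _; rewrite -!sum_tab_pairs => zE.
have in_span : \sum_(p <- tab_pairs L) c p *: theta_vec p.1 p.2 \in
    <<[seq theta_vec p.1 p.2 | p <- tab_pairs L]>>%VS.
  by rewrite big_seq; apply: memv_suml => p pL; apply/memvZ/memv_span/map_f.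
have z'K : \sum_(p <- tab_pairs L') c p *: theta_vec p.1 p.2 \in Ker.
  rewrite -(addKr (\sum_(p <- tab_pairs L) c p *: theta_vec p.1 p.2) (\sum_(p <- _) _)) -zE addrC.
  apply: memvB => //; rewrite big_seq; apply: memv_suml => p pL; exact/memvZ/theta_Ker.
have L'_even : {subset L' <= even_partitions r} by move=> la; rewrite mem_filter => /andP[].
have L'_part : {in L', forall la, is_partition N la} by move=> la /L'_even/even_partP[].
have L'_uniq : uniq L' by apply/filter_uniq/even_partitions_uniq.
suff c0 : {in tab_pairs L', forall p, c p = 0}.
  by rewrite zE [X in _ + X]big_seq [X in _ + X]big1 ?addr0 // => p /c0->; rewrite scale0r.
move=> _ /allpairsPdep[la [t [laL tS ->]]]; apply/eqP; apply: contraTT isT => ct.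
have [mu [muL _ [s [kap [kap0 kapP]]]]] :=
  shape_detect (c := fun la t => c (la, t)) L'_uniq L'_part laL tS ct.
have uK : uvec mu \in Ker.
  rewrite -[uvec mu]scale1r -(mulVf kap0) -scalerA -kapP memvZ //.
  by apply/Ker_sum/Ker_act; rewrite -sum_tab_pairs.
have [muE muP] : mu \in even_partitions r /\ ~~ P mu by move: muL; rewrite mem_filter => /andP[].
have/negP[] := Ker_nP _ muE muP.
by have [kappa ->] := rsym_casym_d0 muE; apply/memvZ/Ker_sum.
Qed.

End MatchingModule.

(** * Tensor powers *)

(** [linfun] is defined on arbitrary functions; this lets linearity be supplied as a proof instead
of a canonical structure. *)
Lemma linfunE (K : fieldType) (aT rT : vectType K) (f : aT -> rT) :
  linear f -> linfun f =1 f.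
Proof.
move=> f_lin; pose fL : {linear aT -> rT} :=
  HB.pack f (GRing.isLinear.Build K aT rT *:%R f f_lin).
exact: (lfunE fL).
Qed.

Section Tensors.
Variables (K : fieldType) (m n : nat) (V : osp_space K m n).
Local Notation d := (sdimn V).

Lemma hbasis_basis : basis_of fullv (hbasis V).
Proof.
rewrite basisEdim /= size_cat !size_tuple -(osp_total V) span_cat.
rewrite !(span_basis (vbasisP _)) subvv /=.
by rewrite dimv_disjoint_sum ?osp_direct.
Qed.

Lemma hbasis_grade i : tnth (hbasis V) i \in vgrade V (idx_parity i).
Proof.
rewrite (tnth_nth 0) /= nth_cat size_tuple /idx_parity /vgrade /grade.
case: ltnP => lt_i /=; apply: vbasis_mem; first by rewrite mem_nth ?size_tuple.
by rewrite mem_nth // size_tuple ltn_subLR.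
Qed.

Definition hcoord i (v : V) : K := coord (hbasis V) i v.

Lemma hcoord_basis i j : hcoord i (tnth (hbasis V) j) = (i == j)%:R.
Proof. by rewrite /hcoord (tnth_nth 0) coord_free ?(basis_free hbasis_basis) // eq_sym. Qed.

Lemma hcoord_sum v : v = \sum_i hcoord i v *: tnth (hbasis V) i.
Proof.
rewrite {1}(coord_basis hbasis_basis (memvf v)).
by apply: eq_bigr => i _; rewrite (tnth_nth 0).
Qed.

Lemma ptensE k (v : 'I_k -> V) f : ptens v f = \prod_(i < k) hcoord (f i) (v i).
Proof. by rewrite ffunE. Qed.

Lemma eq_ptens k (v w : 'I_k -> V) : v =1 w -> ptens v = ptens w.
Proof. by move=> vw; apply/ffunP=> f; rewrite !ptensE; apply: eq_bigr => i _; rewrite vw. Qed.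

Lemma tbaseE k (f g : mindex V k) : tbase f g = (g == f)%:R.
Proof.
rewrite ptensE; have [->|g_f] := eqVneq g f.
  by rewrite big1 // => i _; rewrite hcoord_basis eqxx.
have /existsP[i gi] : [exists i, g i != f i].
  by apply: contraNT g_f; rewrite negb_exists => /forallP H; apply/eqP/ffunP=> i; apply/eqP; have := H i; rewrite negbK.
by rewrite (bigD1 i) //= hcoord_basis (negPf gi) mul0r.
Qed.

Lemma tbase_sum k (x : tpow V k) : x = \sum_f x f *: tbase f.
Proof.
apply/ffunP=> g; rewrite sum_ffunE (bigD1 g) //= big1 ?addr0 => [|f f_g].
  by rewrite ffunE tbaseE eqxx; apply: esym; apply: mulr1.
by rewrite ffunE tbaseE eq_sym (negPf f_g); apply: mulr0.
Qed.

Lemma eq_hom_tbase k (W : vectType K) (phi psi : 'Hom(tpow V k, W)) :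
  (forall f, phi (tbase f) = psi (tbase f)) -> phi = psi.
Proof.
move=> eq_b; apply/lfunP=> x; rewrite [x]tbase_sum !linear_sum.
by apply: eq_bigr => f _; rewrite !linearZ /= eq_b.
Qed.

Definition homog k (v : 'I_k -> V) (p : 'I_k -> bool) := forall i, v i \in vgrade V (p i).

Lemma homog_tbase k (f : mindex V k) :
  homog (fun i => tnth (hbasis V) (f i)) (fun i => idx_parity (f i)).
Proof. by move=> i; apply: hbasis_grade. Qed.

Definition split_fun k l (T : Type) (u : 'I_k -> T) (w : 'I_l -> T) (i : 'I_(k + l)) : T :=
  match split i with inl a => u a | inr b => w b end.

Lemma split_funl k l T (u : 'I_k -> T) (w : 'I_l -> T) i : split_fun u w (lshift l i) = u i.
Proof. by rewrite /split_fun (unsplitK (inl _)). Qed.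
Lemma split_funr k l T (u : 'I_k -> T) (w : 'I_l -> T) i : split_fun u w (rshift k i) = w i.
Proof. by rewrite /split_fun (unsplitK (inr _)). Qed.

Lemma ptens_split k l (v : 'I_(k + l) -> V) :
  ptens v = tprod (ptens (fun i => v (lshift l i))) (ptens (fun i => v (rshift k i))).
Proof.
apply/ffunP=> f; rewrite [RHS]ffunE !ptensE big_split_ord /=.
by congr (_ * _); apply: eq_bigr => i _; rewrite ffunE.
Qed.

Lemma tprod_suml k l I (s : seq I) (P : pred I) (F : I -> tpow V k) (y : tpow V l) :
  tprod (\sum_(i <- s | P i) F i) y = \sum_(i <- s | P i) tprod (F i) y.
Proof.
by apply/ffunP=> f; rewrite ffunE !sum_ffunE mulr_suml; apply: eq_bigr => i _; rewrite ffunE.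
Qed.
Lemma tprod_sumr k l I (s : seq I) (P : pred I) (F : I -> tpow V l) (x : tpow V k) :
  tprod x (\sum_(i <- s | P i) F i) = \sum_(i <- s | P i) tprod x (F i).
Proof.
by apply/ffunP=> f; rewrite ffunE !sum_ffunE mulr_sumr; apply: eq_bigr => i _; rewrite ffunE.
Qed.
Lemma tprodZl k l a (x : tpow V k) (y : tpow V l) : tprod (a *: x) y = a *: tprod x y.
Proof. by apply/ffunP=> f; rewrite !ffunE; apply: esym; apply: mulrA. Qed.
Lemma tprodZr k l a (x : tpow V k) (y : tpow V l) : tprod x (a *: y) = a *: tprod x y.
Proof. by apply/ffunP=> f; rewrite !ffunE; apply: mulrCA. Qed.

Lemma tbase_split k l (f : mindex V (k + l)) : tbase f = tprod (tbase (mleft f)) (tbase (mright f)).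
Proof.
rewrite {1}/tbase ptens_split; congr tprod; apply: eq_ptens => i; by rewrite ffunE.
Qed.

Lemma tpartE k a (x : tpow V k) f : tpart V k a x f = if mparity f == a then x f else 0.
Proof.
rewrite /tpart linfunE ?ffunE // => c y z; apply/ffunP=> g; rewrite !ffunE.
by case: ifP => //; rewrite scaler0 addr0.
Qed.

Lemma tpart_tbase k a (f : mindex V k) :
  tpart V k a (tbase f) = if mparity f == a then tbase f else 0.
Proof.
apply/ffunP=> g; rewrite tpartE tbaseE; have [->|g_f] := eqVneq g f.
  by case: ifP; rewrite ?tbaseE ?eqxx // ffunE.
by rewrite if_same; case: ifP; rewrite ?tbaseE ?(negPf g_f) // ffunE.
Qed.

(** Parity preservation, read on coordinates. For such maps the sign rule in [tens_hom] is trivial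
([tens_homE]). *)
Definition even_hom k l (phi : 'Hom(tpow V k, tpow V l)) :=
  forall f g, phi (tbase f) g != 0 -> mparity f = mparity g.

Lemma hom_part_even k l (phi : 'Hom(tpow V k, tpow V l)) a f : even_hom phi ->
  hom_part a phi (tbase f) = if a then 0 else phi (tbase f).
Proof.
move=> phi_even; rewrite /hom_part sum_lfunE (bigD1 (mparity f)) //= big1 ?addr0; last first.
  move=> b b_f; rewrite !comp_lfunE tpart_tbase eq_sym (negPf b_f).
  by rewrite !linear0.
rewrite !comp_lfunE tpart_tbase eqxx; apply/ffunP=> g; rewrite tpartE.
have [pg0|pg0] := eqVneq (phi (tbase f) g) 0.
  by rewrite pg0 if_same; case: a; rewrite ?ffunE ?pg0.
rewrite -(phi_even _ _ pg0); case: a => /=; last by rewrite eqxx.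
by rewrite ffunE; case: mparity.
Qed.

Lemma tens_homE k l k' l' (phi : 'Hom(tpow V k, tpow V l)) (psi : 'Hom(tpow V k', tpow V l'))
    x y : even_hom psi -> tens_hom phi psi (tprod x y) = tprod (phi x) (psi y).
Proof.
move=> psi_even; rewrite /tens_hom linfunE; last first.
  move=> c z z'; rewrite scaler_sumr -big_split; apply: eq_bigr => f _ /=.
  by rewrite !ffunE scalerDl scalerA.
have termE f : \sum_(b : bool) (-1) ^+ (b && mparity (mleft f)) *:
      tprod (phi (tbase (mleft f))) (hom_part b psi (tbase (mright f)))
    = tprod (phi (tbase (mleft f))) (psi (tbase (mright f))).
  rewrite big_bool /= !hom_part_even //= expr0 scale1r.
  have -> : tprod (phi (tbase (mleft f))) 0 = 0 :> tpow V (l + l').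
    by apply/ffunP=> g; rewrite !ffunE mulr0.
  by rewrite scaler0 add0r.
under eq_bigr do rewrite termE.
rewrite [in RHS](tbase_sum x) linear_sum tprod_suml.
under [RHS]eq_bigr => f _ do rewrite linearZ /= tprodZl {1}(tbase_sum y) linear_sum tprod_sumr scaler_sumr.
rewrite pair_bigA /= [LHS](reindex (fun p : mindex V k * mindex V k' =>
   [ffun i => split_fun p.1 p.2 i] : mindex V (k + k'))) /=; last first.
  exists (fun f => (mleft f, mright f)) => [[f g] _|f _] /=.
    by congr (_, _); apply/ffunP=> i; rewrite !ffunE ?split_funl ?split_funr.
  apply/ffunP=> i; rewrite !ffunE /split_fun -[in RHS](splitK i).
  by case: (split i) => j; rewrite ffunE.
apply: eq_bigr => -[f g] _ /=.
have -> : mleft [ffun i => split_fun f g i] = f by apply/ffunP=> i; rewrite !ffunE split_funl.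
have -> : mright [ffun i => split_fun f g i] = g by apply/ffunP=> i; rewrite !ffunE split_funr.
rewrite ffunE.
have -> : mleft [ffun i => split_fun f g i] = f by apply/ffunP=> i; rewrite !ffunE split_funl.
have -> : mright [ffun i => split_fun f g i] = g by apply/ffunP=> i; rewrite !ffunE split_funr.
by rewrite linearZ tprodZr scalerA.
Qed.

Lemma even_hom_id k : even_hom (\1%VF : 'Hom(tpow V k, tpow V k)).
Proof.
move=> f g; rewrite id_lfunE tbaseE; case: (eqVneq g f) => [->//|_]; by rewrite eqxx.
Qed.

End Tensors.

(** * Composition of diagrams *)

Section Stacking.
Variables (k l p : nat) (D1 : brauer l p) (D2 : brauer k l) (D : brauer k p).
Local Notation T := ('I_k + 'I_l + 'I_p)%type.
Local Notation edge := (stack_edge D1 D2).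

Lemma stack_edge_lower a : edge (lower_vertex p a) (lower_vertex p (D2 a)).
Proof. by apply/orP; left; apply/existsP; exists a; rewrite !eqxx. Qed.

Lemma stack_edge_upper a : edge (upper_vertex k a) (upper_vertex k (D1 a)).
Proof. by apply/orP; right; apply/existsP; exists a; rewrite !eqxx. Qed.

Lemma stack_edgeP x y : edge x y ->
  (exists2 a, x = lower_vertex p a & y = lower_vertex p (D2 a)) \/
  (exists2 a, x = upper_vertex k a & y = upper_vertex k (D1 a)).
Proof.
by case/orP=> /existsP[a /andP[/eqP-> /eqP->]]; [left | right]; exists a.
Qed.

(* [phi] sends a vertex to an outer vertex of its component. *)
Variable phi : T -> 'I_k + 'I_p.
Hypotheses (phi_outer : forall a, phi (outer_vertex l a) = a)
  (phi_lower : forall a, phi (lower_vertex p (D2 a)) \in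
     [:: phi (lower_vertex p a); D (phi (lower_vertex p a))])
  (phi_upper : forall a, phi (upper_vertex k (D1 a)) \in
     [:: phi (upper_vertex k a); D (phi (upper_vertex k a))])
  (phi_connect : forall x, connect edge (outer_vertex l (phi x)) x)
  (D_connect : forall a, connect edge (outer_vertex l a) (outer_vertex l (D a))).

Lemma no_stack_loops : stack_loops D1 D2 = 0%N.
Proof.
rewrite /stack_loops /n_comp_mem; apply: eq_card0 => x; rewrite !inE.
by apply/negP=> /andP[_ /forallP/(_ (phi x))]; rewrite phi_connect.
Qed.

Lemma stack_unique D' : is_stack D1 D2 D' = (D' == D).
Proof.
apply/forallP/eqP=> [D'_stack|-> //].
have same x y : edge x y -> phi y \in [:: phi x; D (phi x)].
  by case/stack_edgeP=> -[a -> ->].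
have conn x y : connect edge x y -> phi y \in [:: phi x; D (phi x)].
  case/connectP=> s; elim: s x => /= [|z s IHs] x; first by move=> _ ->; rewrite !inE eqxx.
  case/andP=> /same + /IHs H /H; rewrite !inE => /orP[]/eqP-> // /orP[]/eqP->; rewrite ?partnerK ?eqxx ?orbT //.
apply: eq_matching => a; have := conn _ _ (D'_stack a); rewrite !phi_outer !inE.
by rewrite (negPf (partner_neq D' a)) => /eqP.
Qed.

(** The retraction phi of the stack onto its boundary certifies that there is no closed loop, as
every vertex is connected to an outer one, and identifies the composite, as phi is constant on
components up to D. *)
Lemma bcomp_bvec (K : fieldType) (delta : K) : bcomp delta (bvec K D1) (bvec K D2) = bvec K D.
Proof.
rewrite /bcomp (bigD1 D1) //= [X in _ + X]big1 ?addr0; last first.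
  by move=> E1 /negPf E1D; apply: big1 => E2 _; rewrite ffunE E1D !mul0r scale0r.
rewrite (bigD1 D2) //= [X in _ + X]big1 ?addr0; last first.
  by move=> E2 /negPf E2D; rewrite [bvec _ _ E2]ffunE E2D mulr0 mul0r scale0r.
rewrite !ffunE !eqxx no_stack_loops expr0 !mulr1 scale1r.
by rewrite (big_pred1 D) // => E; rewrite stack_unique.
Qed.

End Stacking.

Section StackSymmetry.
Variables (k l p : nat) (D1 : brauer l p) (D2 : brauer k l).
Lemma stack_connect_sym : connect_sym (stack_edge D1 D2).
Proof.
apply: sym_connect_sym; suff sym x y : stack_edge D1 D2 x y -> stack_edge D1 D2 y x.
  by move=> x y; apply/idP/idP; apply: sym.
case/stack_edgeP=> -[a -> ->].
  by rewrite -{2}[a](partnerK D2); apply: stack_edge_lower.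
by rewrite -{2}[a](partnerK D1); apply: stack_edge_upper.
Qed.
End StackSymmetry.

Section Bijections.
Variables (k l : nat) (h : 'I_k -> 'I_l) (h' : 'I_l -> 'I_k).
Hypotheses (hK : cancel h h') (h'K : cancel h' h).

Definition bij_fun (x : 'I_k + 'I_l) : 'I_k + 'I_l :=
  match x with inl i => inr (h i) | inr j => inl (h' j) end.
Lemma bij_fun_neq x : bij_fun x != x. Proof. by case: x. Qed.
Lemma bij_funK : involutive bij_fun.
Proof. by case=> i /=; rewrite ?hK ?h'K. Qed.

(** Unlike [perm_diag] it may join rows of sizes that are equal but not convertible, such as r + r
and 2r. *)
Definition bij_diag : brauer k l := mk_matching bij_fun_neq bij_funK.

Variable p : nat.
Definition pull (x : 'I_l + 'I_p) : 'I_k + 'I_p :=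
  match x with inl j => inl (h' j) | inr q => inr q end.
Definition push (x : 'I_k + 'I_p) : 'I_l + 'I_p :=
  match x with inl i => inl (h i) | inr q => inr q end.
Lemma pullK : cancel pull push. Proof. by case=> j //=; rewrite h'K. Qed.
Lemma pushK : cancel push pull. Proof. by case=> j //=; rewrite hK. Qed.

(** Below a diagram, through strands along a bijection only rename its bottom vertices. *)
Lemma bcomp_bij (K : fieldType) (delta : K) (D : brauer l p) :
  bcomp delta (bvec K D) (bvec K bij_diag) = bvec K (relabel pullK pushK D).
Proof.
have bijE x : bij_diag x = bij_fun x by rewrite ffunE.
have relE x : relabel pullK pushK D x = pull (D (push x)) by rewrite ffunE.
pose phi (x : 'I_k + 'I_l + 'I_p) : 'I_k + 'I_p := match x with
  | inl (inl i) => inl i | inl (inr j) => inl (h' j) | inr q => inr q end.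
have phi_up a : phi (upper_vertex k a) = pull a by case: a.
have conn_up a : connect (stack_edge D bij_diag) (outer_vertex l (pull a)) (upper_vertex k a).
  case: a => [j|q] /=; last exact: connect0.
  apply: connect1; have := stack_edge_lower D bij_diag (inl (h' j)).
  by rewrite bijE /= h'K.
apply: (@bcomp_bvec _ _ _ _ _ _ phi).
- by case.
- by case=> [i|j]; rewrite bijE /= ?hK !inE eqxx.
- by move=> a; rewrite !phi_up relE pullK !inE eqxx orbT.
- move=> [[i|j]|q] /=; [exact: connect0 | exact: (conn_up (inl j)) | exact: connect0].
move=> a; rewrite relE.
have -> : outer_vertex l a = outer_vertex l (pull (push a)) by rewrite pushK.
apply: connect_trans (conn_up _) _; apply: connect_trans (connect1 (stack_edge_upper _ _ _)) _.
by rewrite stack_connect_sym.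
Qed.
End Bijections.

Section Juxtaposition.
Variables (k l k' l' : nat) (D : brauer k l) (E : brauer k' l').

Lemma juxt_diagE x : juxt_diag D E (juxt_emb x) = juxt_emb (juxt_fun D E x).
Proof. by rewrite !ffunE juxt_embK. Qed.

Lemma bjuxt_bvec (K : fieldType) : bjuxt (bvec K D) (bvec K E) = bvec K (juxt_diag D E).
Proof.
rewrite /bjuxt (bigD1 D) //= [X in _ + X]big1 ?addr0; last first.
  by move=> E1 /negPf E1D; apply: big1 => E2 _; rewrite ffunE E1D !mul0r scale0r.
rewrite (bigD1 E) //= [X in _ + X]big1 ?addr0; last first.
  by move=> E2 /negPf E2D; rewrite [bvec _ _ E2]ffunE E2D mulr0 scale0r.
by rewrite !ffunE !eqxx mulr1 scale1r.
Qed.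

Lemma eq_juxt (F : brauer (k + k') (l + l')) :
  (forall x, F (juxt_emb x) = juxt_emb (juxt_fun D E x)) -> F = juxt_diag D E.
Proof. by move=> FE; apply: eq_matching => x; rewrite -[x]juxt_projK FE juxt_diagE. Qed.

End Juxtaposition.

Section BlockPerm.
Variables (k l : nat) (s : {perm 'I_k}) (t : {perm 'I_l}).
Definition block_fun (i : 'I_(k + l)) : 'I_(k + l) :=
  match split i with inl a => lshift l (s a) | inr b => rshift k (t b) end.
Lemma block_funl a : block_fun (lshift l a) = lshift l (s a).
Proof. by rewrite /block_fun (unsplitK (inl _)). Qed.
Lemma block_funr b : block_fun (rshift k b) = rshift k (t b).
Proof. by rewrite /block_fun (unsplitK (inr _)). Qed.
Lemma block_fun_inj : injective block_fun.
Proof.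
move=> i j; rewrite -(splitK i) -(splitK j).
case: (split i) (split j) => [a|a] [b|b]; rewrite /= ?block_funl ?block_funr => /eqP.
- by rewrite eq_lshift => /eqP/perm_inj->.
- by rewrite eq_lrshift.
- by rewrite eq_rlshift.
by rewrite eq_rshift => /eqP/perm_inj->.
Qed.
Definition block_perm := perm block_fun_inj.
Lemma block_perml a : block_perm (lshift l a) = lshift l (s a).
Proof. by rewrite permE block_funl. Qed.
Lemma block_permr b : block_perm (rshift k b) = rshift k (t b).
Proof. by rewrite permE block_funr. Qed.

Lemma juxt_perm : perm_diag block_perm = juxt_diag (perm_diag s) (perm_diag t).
Proof.
apply: eq_juxt => -[[a|a]|[a|a]] /=; rewrite !ffunE /= ?block_perml ?block_permr //.
  by congr inl; apply: (canLR (permK _)); rewrite block_perml permKV.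
by congr inl; apply: (canLR (permK _)); rewrite block_permr permKV.
Qed.
End BlockPerm.

(** * Permutations and caps acting on tensors *)

Section Functor.
Variables (K : fieldType) (m n : nat) (V : osp_space K m n).
Variable (F : forall k l, 'Hom(bspace K k l, 'Hom(tpow V k, tpow V l))).
Hypotheses (FF : brauer_functor F) (V_neq0 : (0 < sdimn V)%N).

Definition diag_op k l (D : brauer k l) : 'Hom(tpow V k, tpow V l) := F k l (bvec K D).
Local Notation Fd := diag_op.
Definition perm_op k (s : {perm 'I_k}) : 'Hom(tpow V k, tpow V k) := Fd (perm_diag s).
Local Notation Fp := perm_op.

Lemma diag_op_juxt k l k' l' (D : brauer k l) (E : brauer k' l') :
  Fd (juxt_diag D E) = tens_hom (Fd D) (Fd E).
Proof. by rewrite /Fd -bjuxt_bvec (F_tens FF). Qed.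

Lemma diag_op_bij k l p (h : 'I_k -> 'I_l) (h' : 'I_l -> 'I_k) (hK : cancel h h') (h'K : cancel h' h)
  (D : brauer l p) :
  Fd (relabel (pullK h'K (p := p)) (pushK hK (p := p)) D) = (Fd D \o Fd (bij_diag hK h'K))%VF.
Proof. by rewrite /Fd -(bcomp_bij hK h'K (bdelta K m n)) (F_comp FF). Qed.

Lemma perm_diag_bij k (s : {perm 'I_k}) : perm_diag s = bij_diag (permK s) (permKV s).
Proof. by apply: eq_matching => x; rewrite !ffunE; case: x. Qed.

(** Left-to-right products of permutations become compositions in the reverse order. *)
Lemma perm_opM k (s t : {perm 'I_k}) : Fp (s * t)%g = (Fp t \o Fp s)%VF.
Proof.
rewrite {3}/Fp perm_diag_bij /Fp -diag_op_bij; congr Fd; apply: eq_matching => x.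
by rewrite !ffunE; case: x => i /=; rewrite ?permM ?invMg ?permM.
Qed.

Lemma block_perm1 k l : block_perm (1 : {perm 'I_k}) (1 : {perm 'I_l}) = 1%g.
Proof.
apply/permP=> i; rewrite -(splitK i) perm1.
by case: (split i) => j /=; rewrite ?block_perml ?block_permr perm1.
Qed.

Lemma I_diag_juxt k l : I_diag (k + l) = juxt_diag (I_diag k) (I_diag l).
Proof. by rewrite /I_diag -block_perm1 juxt_perm. Qed.

Lemma tens_hom_id k l : tens_hom (\1%VF : 'Hom(tpow V k, tpow V k))
  (\1%VF : 'Hom(tpow V l, tpow V l)) = \1%VF.
Proof.
apply: eq_hom_tbase => f.
by rewrite tbase_split tens_homE ?id_lfunE //; apply: even_hom_id.
Qed.

(** F is given to preserve only the identity of one strand; juxtaposition extends this to more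
strands. *)
Lemma perm_op1_S k : Fp (1 : {perm 'I_k.+1}) = \1%VF.
Proof.
elim: k => [|k IHk]; first exact: (F_I FF).
rewrite -[LHS]/(Fd (I_diag (1 + k.+1))) I_diag_juxt diag_op_juxt.
by rewrite [Fd (I_diag k.+1)]IHk [Fd (I_diag 1)](F_I FF) tens_hom_id.
Qed.

Lemma mindex0 (f g : mindex V 0) : f = g.
Proof. by apply/ffunP=> -[]. Qed.

Lemma even_hom00 (phi : 'Hom(tpow V 0, tpow V 0)) : even_hom phi.
Proof. by move=> f g _; rewrite (mindex0 f g). Qed.

(** F of the empty diagram is a scalar. Tensoring it with the identity of V gives the identity of
V, which is not zero; this is where V must be non-trivial. *)
Lemma perm_op1_0 : Fp (1 : {perm 'I_0}) = \1%VF.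
Proof.
set phi := Fp _; pose i0 := Ordinal V_neq0.
pose f1 : mindex V (1 + 0) := [ffun=> i0].
have id10 : Fd (juxt_diag (I_diag 1) (I_diag 0)) = \1%VF by rewrite -I_diag_juxt; apply: (F_I FF).
have := congr1 (fun T : 'Hom(tpow V (1 + 0), tpow V (1 + 0)) => T (tbase f1) f1) id10.
rewrite diag_op_juxt tbase_split tens_homE; last exact: even_hom00.
rewrite [Fd (I_diag 1)](F_I FF) !id_lfunE -tbase_split tbaseE eqxx [LHS]ffunE tbaseE eqxx.
rewrite mul1r => phi1; apply: eq_hom_tbase => f.
by rewrite id_lfunE; apply/ffunP=> g; rewrite (mindex0 f (mright f1)) (mindex0 g (mright f1)) tbaseE eqxx -phi1.
Qed.

Lemma perm_op1 k : Fp (1 : {perm 'I_k}) = \1%VF.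
Proof. by case: k => [|k]; [apply: perm_op1_0 | apply: perm_op1_S]. Qed.

(** The sign is kept abstract: it depends on the parities only, and most arguments need no more.
*)
Definition signed_perm k (s : {perm 'I_k}) := exists sg : ('I_k -> bool) -> bool,
  forall v p, homog (V := V) v p -> Fp s (ptens v) = (-1) ^+ sg p *: ptens (fun i => v ((s^-1)%g i)).

Lemma signed_perm1 k : signed_perm (1 : {perm 'I_k}).
Proof.
exists (fun => false) => v p _; rewrite perm_op1 id_lfunE expr0 scale1r.
by apply: eq_ptens => i; rewrite invg1 perm1.
Qed.

Lemma homog_perm k (s : {perm 'I_k}) (v : 'I_k -> V) p : homog v p -> homog (fun i => v (s i)) (fun i => p (s i)).
Proof. by move=> vp i; apply: vp. Qed.

Lemma signed_permM k (s t : {perm 'I_k}) : signed_perm s -> signed_perm t -> signed_perm (s * t)%g.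
Proof.
move=> [sg sP] [tg tP]; exists (fun p => sg p (+) tg (fun i => p ((s^-1)%g i))) => v p vp.
rewrite perm_opM comp_lfunE (sP _ _ vp) linearZ /= (tP _ _ (homog_perm (s^-1)%g vp)) scalerA -signr_addb.
by congr (_ *: _); apply: eq_ptens => i; rewrite invMg permM.
Qed.

Definition swap_sign k (a b : 'I_k) := forall v p, homog (V := V) v p ->
  Fp (tperm a b) (ptens v) = (-1) ^+ (p a && p b) *: ptens (fun i => v (tperm a b i)).

Lemma even_hom_perm_op1 k : even_hom (Fp (1 : {perm 'I_k})).
Proof. by rewrite perm_op1; apply: even_hom_id. Qed.

Lemma perm_op_swap2 v p : homog (V := V) v p ->
  Fp (tperm ord0 ord_max) (ptens v) =
    (-1) ^+ (p ord0 && p ord_max) *: ptens (fun i : 'I_2 => v (tperm ord0 ord_max i)).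
Proof.
move=> vp; have ptens2 (w : 'I_2 -> V) : ptens w = tens2 (w ord0) (w ord_max).
  apply: eq_ptens => i; rewrite (tnth_nth 0) /=.
  by case: i => -[|[|//]] lt_i /=; congr w; apply/val_inj.
by rewrite !ptens2 tpermL tpermR; apply: (F_X FF).
Qed.

Lemma mparity_split k l (f : mindex V (k + l)) : mparity f = mparity (mleft f) (+) mparity (mright f).
Proof.
rewrite /mparity big_split_ord oddD /=.
by congr (odd _ (+) odd _); apply: eq_bigr => i _; rewrite ffunE.
Qed.

Lemma even_hom_tens k l k' l' (phi : 'Hom(tpow V k, tpow V l)) (psi : 'Hom(tpow V k', tpow V l')) :
  even_hom phi -> even_hom psi -> even_hom (tens_hom phi psi).
Proof.
move=> phi_even psi_even f g; rewrite tbase_split tens_homE // ffunE mulf_eq0 negb_or.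
by case/andP=> /phi_even + /psi_even; rewrite !mparity_split => -> ->.
Qed.

Lemma even_hom_swap2 : even_hom (Fp (tperm ord0 ord_max : {perm 'I_2})).
Proof.
move=> f g; rewrite (perm_op_swap2 (homog_tbase f)) ffunE.
have -> : ptens (fun i => tnth (hbasis V) (f (tperm ord0 ord_max i))) =
    tbase [ffun i => f (tperm ord0 ord_max i)].
  by apply: eq_ptens => i; rewrite ffunE.
rewrite tbaseE; have [-> _|_ /eqP[]] := eqVneq g [ffun i => f (tperm ord0 ord_max i)]; last exact: mulr0.
rewrite /mparity [in RHS](reindex_inj (@perm_inj _ (tperm ord0 ord_max))) /=.
by congr odd; apply: eq_bigr => i _; rewrite ffunE tpermK.
Qed.

(** The transposition of two neighbours is a crossing between identity strands, so F is computed
by juxtaposition. *)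
Lemma swap_sign_block i j (a b : 'I_(i + (2 + j))) :
  a = rshift i (lshift j ord0) -> b = rshift i (lshift j ord_max) -> swap_sign a b.
Proof.
move=> -> ->; set a0 := rshift i _; set b0 := rshift i _ => v p vp.
pose X2 : {perm 'I_2} := tperm ord0 ord_max.
have tE : tperm a0 b0 = block_perm 1%g (block_perm X2 1%g).
  apply/permP=> x; rewrite -(splitK x); case: (split x) => y /=.
    by rewrite block_perml perm1 tpermD // /a0 /b0 eq_rlshift.
  rewrite block_permr -(splitK y); case: (split y) => z /=.
    rewrite block_perml /X2; case: (tpermP ord0 ord_max z) => [->|->|/eqP z0 /eqP z1]; rewrite ?tpermL ?tpermR //.
    by rewrite tpermD // /a0 /b0 eq_rshift eq_lshift eq_sym.
  by rewrite block_permr perm1 tpermD // /a0 /b0 eq_rshift eq_lrshift.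
rewrite /Fp tE juxt_perm diag_op_juxt juxt_perm diag_op_juxt (ptens_split v) (ptens_split (fun x => v (rshift i x))).
have X_even := even_hom_tens (@even_hom_swap2) (@even_hom_perm_op1 j).
rewrite (tens_homE _ _ _ X_even) (tens_homE _ _ _ (@even_hom_perm_op1 j)).
rewrite -/(Fp 1%g) -/(Fp 1%g) !perm_op1 !id_lfunE.
have vp2 : homog (V := V) (fun x : 'I_2 => v (rshift i (lshift j x))) (fun x => p (rshift i (lshift j x))).
  by move=> x; apply: vp.
rewrite -/(Fp _) (perm_op_swap2 vp2) tprodZl tprodZr; congr (_ *: _).
rewrite [RHS]ptens_split; congr tprod; first by apply: eq_ptens => x; rewrite block_perml perm1.
rewrite [RHS]ptens_split; congr tprod; apply: eq_ptens => x.
  by rewrite block_permr block_perml.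
by rewrite block_permr block_permr perm1.
Qed.

Lemma swap_sign_adjacent k (a b : 'I_k) : b = a.+1 :> nat -> swap_sign a b.
Proof.
move=> ab; have lt_b := ltn_ord b; rewrite ab in lt_b.
have [i [j [k_eq ai]]] : exists i j, k = (i + (2 + j))%N /\ a = i :> nat.
  by exists a, (k - a.+2)%N; split => //; rewrite addnA addn2 subnKC.
move: a b ab ai lt_b; rewrite {}k_eq => a b ab ai _.
by apply: (@swap_sign_block i j); apply/val_inj; rewrite /= ?ab ai ?addn0 // addn1.
Qed.

End Functor.

Section Functor.
Variables (K : fieldType) (m n : nat) (V : osp_space K m n).
Variable (F : forall k l, 'Hom(bspace K k l, 'Hom(tpow V k, tpow V l))).
Hypotheses (FF : brauer_functor F) (V_neq0 : (0 < sdimn V)%N).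

Local Notation Fd := (diag_op F).
Local Notation Fp := (perm_op F).

Lemma tperm_conj k (a b c : 'I_k) : a != b -> c != b -> 
  tperm a b = (tperm a c * (tperm c b * tperm a c))%g.
Proof.
move=> a_b c_b; have := tpermJ c b (tperm a c).
by rewrite tpermR (tpermD (z := b)) // conjgE tpermV => <-.
Qed.

(** Every transposition is obtained from one of neighbours by conjugation with transpositions of
neighbours. *)
Lemma tperm_ind k (P : 'I_k -> 'I_k -> Prop) :
  (forall a b, P a b -> P b a) ->
  (forall a b : 'I_k, b = a.+1 :> nat -> P a b) ->
  (forall a b c : 'I_k, c = a.+1 :> nat -> a != b -> c != b -> P c b -> P a b) ->
  forall a b, a != b -> P a b.
Proof.
move=> P_sym P_adj P_step.
have lt_case d (a b : 'I_k) : b = (a + d).+1 :> nat -> P a b.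
  elim: d a => [|d IHd] a b_eq; first by apply: P_adj; rewrite b_eq addn0.
  have lt_c : (a.+1 < k)%N by apply: leq_ltn_trans (ltn_ord b); rewrite b_eq ltnS leq_addr.
  apply: (P_step _ _ (Ordinal lt_c)) => //.
  - by apply/eqP=> /(congr1 val) /=; rewrite b_eq => /eqP; rewrite -addnS -[X in X == _]addn0 eqn_add2l.
  - apply/eqP=> /(congr1 val) /=; rewrite b_eq => /eqP.
    by rewrite eqSS -[X in X == _]addn0 eqn_add2l.
  by apply: IHd; rewrite b_eq /= addnS.
move=> a b; rewrite neq_ltn => /orP[] lt; last apply: P_sym.
  by apply: (lt_case (b - a.+1)%N); rewrite -addSn subnKC.
by apply: (lt_case (a - b.+1)%N); rewrite -addSn subnKC.
Qed.

Lemma signed_perm_adj k (a b : 'I_k) : b = a.+1 :> nat -> signed_perm F (tperm a b).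
Proof.
move=> ab; exists (fun p => p a && p b) => v p vp.
by rewrite (swap_sign_adjacent FF V_neq0 ab vp) tpermV.
Qed.

Lemma signed_perm_tperm k (a b : 'I_k) : a != b -> signed_perm F (tperm a b).
Proof.
move: a b; apply: tperm_ind => [a b|a b|a b c ac a_b c_b sg_cb].
- by rewrite tpermC.
- exact: signed_perm_adj.
rewrite (tperm_conj a_b c_b); have sg_ac := signed_perm_adj ac.
exact: (signed_permM FF sg_ac (signed_permM FF sg_cb sg_ac)).
Qed.

Lemma signed_perm_all k (s : {perm 'I_k}) : signed_perm F s.
Proof.
have [ts -> /allP ts_d] := prod_tpermP s; elim: ts ts_d => [|t ts IHts] ts_d.
  by rewrite big_nil; exact: (signed_perm1 FF V_neq0).
have sg_t : signed_perm F (tperm t.1 t.2).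
  by apply: signed_perm_tperm; apply: (ts_d t); rewrite mem_head.
rewrite big_cons; apply: (signed_permM FF sg_t).
by apply: IHts => u uts; apply: ts_d; rewrite inE uts orbT.
Qed.

(** When the two factors have the same parity, each factor between them is crossed by both and
contributes no sign. *)
Lemma swap_same k (a b : 'I_k) : a != b -> forall v p, homog (V := V) v p -> p a = p b ->
  Fp (tperm a b) (ptens v) = (-1) ^+ p a *: ptens (fun i => v (tperm a b i)).
Proof.
move: a b; apply: tperm_ind => [a b Pab v p vp eq_p|a b ab v p vp eq_p|a b c ac a_b c_b Pcb v p vp eq_p].
- rewrite tpermC (Pab v p vp (esym eq_p)) eq_p.
  by congr (_ *: _); apply: eq_ptens => i; rewrite tpermC.
- by rewrite (swap_sign_adjacent FF V_neq0 ab vp) -eq_p andbb.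
rewrite (tperm_conj a_b c_b) (perm_opM FF) comp_lfunE (swap_sign_adjacent FF V_neq0 ac vp) linearZ /=.
have vp1 := homog_perm (tperm a c) vp.
rewrite (perm_opM FF) comp_lfunE (Pcb _ _ vp1); last by rewrite tpermR tpermD.
rewrite tpermR linearZ /= (swap_sign_adjacent FF V_neq0 ac (homog_perm (tperm c b) vp1)).
rewrite tpermL (tpermD (x := c) (y := b) (z := a)) 1?eq_sym //; last first.
  by apply/eqP=> ca; move: ac; rewrite -ca => /eqP; rewrite eqn_leq ltnn andbF.
rewrite tpermL (tpermD (x := a) (y := c) (z := b)) // !scalerA eq_p.
rewrite -!signr_addb andbC.
congr ((-1) ^+ _ *: _); first by case: (p c) (p b) => -[].
by apply: eq_ptens => i; rewrite !permM.
Qed.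

(** As the two rows have the same number of vertices, the diagram is one of a permutation. *)
Lemma signed_bij k l (h : 'I_k -> 'I_l) (h' : 'I_l -> 'I_k) (hK : cancel h h') (h'K : cancel h' h) :
  exists sg : ('I_k -> bool) -> bool, forall v p, homog (V := V) v p ->
    Fd (bij_diag hK h'K) (ptens v) = (-1) ^+ sg p *: ptens (fun i => v (h' i)).
Proof.
have kl : k = l by have := bij_eq_card (Bijective hK h'K); rewrite !card_ord.
move: h h' hK h'K; rewrite -{l}kl => h h' hK h'K.
have -> : bij_diag hK h'K = perm_diag (perm (can_inj hK)).
  have hE x : perm (can_inj hK) x = h x by rewrite permE.
  apply: eq_matching => x; rewrite !ffunE; case: x => i /=; rewrite ?hE //.
  by congr inl; apply: esym; apply: (canLR (permK _)); rewrite hE h'K.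
have [sg sgP] := signed_perm_all (perm (can_inj hK)).
exists sg => v p vp; rewrite [LHS](sgP v p vp); congr (_ *: _); apply: eq_ptens => i; congr v.
by apply: (canLR (permK _)); rewrite permE h'K.
Qed.

Section CapEvaluation.
Definition evn r (i : 'I_r) : 'I_(r.*2) := label (inr i).
Definition odn r (i : 'I_r) : 'I_(r.*2) := label (inl i).

(** Peeling off the first cap is the induction step for evaluating F on [Ahat]. *)
Lemma Ahat_juxt r : Ahat r.+1 = juxt_diag A_diag (Ahat r).
Proof.
apply: (@eq_juxt 2 0 r.*2 0 A_diag (Ahat r) (Ahat r.+1)) => -[[i|[]]|[i|[]]] //=; rewrite !ffunE /pair_fun /=; congr inl; apply/val_inj => //=.
by rewrite negbK; case: ifP => // odd_i; case: (i : nat) odd_i.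
Qed.

Lemma even_hom_A : even_hom (Fd A_diag).
Proof.
move=> f g; have -> : tbase f = tens2 (tnth (hbasis V) (f ord0)) (tnth (hbasis V) (f ord_max)).
  apply: eq_ptens => i; rewrite (tnth_nth 0 [tuple _; _]) /=.
  by case: i => -[|[|//]] lt_i /=; congr (tnth _ (f _)); apply/val_inj.
rewrite [Fd _ _](F_A FF) ffunE; have [eq_p _|neq_p] := eqVneq (idx_parity (f ord0)) (idx_parity (f ord_max)).
  rewrite /mparity !big_ord_recl !big_ord0 /= addn0 (_ : lift ord0 ord0 = ord_max); last exact/val_inj.
  by rewrite -eq_p; case: idx_parity.
by rewrite (osp_form_even (hbasis_grade (f ord0)) (hbasis_grade (f ord_max)) neq_p) eqxx.
Qed.

Lemma diag_op_AhatS r : Fd (Ahat r.+1) = tens_hom (Fd A_diag) (Fd (Ahat r)).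
Proof. exact: etrans (congr1 (fun D => Fd D) (Ahat_juxt r)) (diag_op_juxt FF A_diag (Ahat r)). Qed.

Lemma even_hom_Ahat r : even_hom (Fd (Ahat r)).
Proof.
elim: r => [|r IHr]; first exact: even_hom00.
by rewrite diag_op_AhatS; apply: (even_hom_tens even_hom_A IHr).
Qed.

Lemma diag_op_AhatS_tprod r (x : tpow V 2) (y : tpow V r.*2) :
  Fd (Ahat r.+1) (tprod x y) = tprod (Fd A_diag x) (Fd (Ahat r) y).
Proof.
exact: etrans (congr1 (fun T : 'Hom(tpow V (2 + r.*2), tpow V (0 + 0)) => T (tprod x y))
  (diag_op_AhatS r)) (tens_homE (Fd A_diag) x y (@even_hom_Ahat r)).
Qed.

Lemma diag_op_Ahat r (v : 'I_(r.*2) -> V) :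
  Fd (Ahat r) (ptens v) = (\prod_(i < r) osp_form V (v (evn i)) (v (odn i))) *: tscal V 1.
Proof.
elim: r v => [|r IHr] v.
  rewrite big_ord0 scale1r; have -> : Ahat 0 = I_diag 0 by apply: eq_matching => -[[]|[]].
  rewrite [Fd _](perm_op1 FF V_neq0) id_lfunE; apply/ffunP=> f.
  by rewrite !ffunE big_ord0.
have vE : ptens v = tprod (ptens (fun i : 'I_2 => v (lshift r.*2 i)))
    (ptens (fun i => v (rshift 2 i))) by exact: (@ptens_split _ _ _ V 2 r.*2 v).
rewrite vE diag_op_AhatS_tprod IHr.
have -> : ptens (fun i : 'I_2 => v (lshift r.*2 i)) = tens2 (v (evn ord0)) (v (odn ord0)).
  apply: eq_ptens => i; rewrite (tnth_nth 0 [tuple _; _]) /=.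
  by case: i => -[|[|//]] lt_i /=; congr v; apply/val_inj.
rewrite [Fd _ _](F_A FF) big_ord_recl; apply/ffunP=> f.
rewrite !ffunE /= [_ *: _ in RHS]mulr1 [_ *: _ in LHS]mulr1; congr (_ * _).
by apply: eq_bigr => i _; congr (osp_form V (v _) (v _)); apply/val_inj; rewrite /= doubleS.
Qed.

End CapEvaluation.
End Functor.

(** * Bending *)

Section Gram.
Variables (K : fieldType) (m n : nat) (V : osp_space K m n).
Local Notation e := (tnth (hbasis V)).
Definition gram : 'M[K]_(sdimn V) := \matrix_(i, j) osp_form V (e i) (e j).

Lemma gram_unit : gram \in unitmx.
Proof.
rewrite -row_free_unit -kermx_eq0; apply/rowV0P => x /sub_kermxP xB0.
pose u := \sum_i x 0 i *: e i.
have u0 : u = 0.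
  apply: (@osp_form_nondeg _ _ _ V) => v; rewrite [v]hcoord_sum linear_sumr big1 // => j _.
  rewrite linearZr_LR /=.
  have : (x *m gram) 0 j = 0 by rewrite xB0 mxE.
  rewrite mxE /u linear_sumlz => E; rewrite -[RHS](mulr0 (hcoord j v)).
  congr (_ * _); apply: etrans E.
  by apply: eq_bigr => i _; rewrite mxE linearZl_LR.
apply/rowP=> i; rewrite mxE; have := congr1 (hcoord i) u0.
rewrite /u /hcoord linear_sum linear0 (bigD1 i) //= big1 ?addr0 => [|j j_i].
  by rewrite linearZ /= -/(hcoord _ _) hcoord_basis eqxx => <-; rewrite mulr1.
by rewrite linearZ /= -/(hcoord _ _) hcoord_basis eq_sym (negPf j_i); apply: mulr0.
Qed.

(** A tensor is recovered from its pairings with the basis tensors by applying the inverse Gram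
matrix to each factor. *)
Lemma tensor_gram_inj r (w : tpow V r) :
  (forall g : mindex V r, \sum_u w u * \prod_(i < r) gram (g i) (u i) = 0) -> w = 0.
Proof.
move=> w0; apply/ffunP=> h; rewrite ffunE.
have key (u : mindex V r) : \sum_(g : mindex V r) (\prod_(i < r) invmx gram (h i) (g i)) *
    (w u * \prod_(i < r) gram (g i) (u i)) = w u * (u == h)%:R.
  under eq_bigr => g _ do rewrite mulrCA -big_split.
  rewrite -mulr_sumr /= -(bigA_distr_bigA (fun i j => invmx gram (h i) j * gram j (u i))) /=.
  congr (_ * _); have entry i : \sum_j invmx gram (h i) j * gram j (u i) = (h i == u i)%:R.
    by have := congr1 (fun B : 'M_(sdimn V) => B (h i) (u i)) (mulVmx gram_unit); rewrite !mxE.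
  under eq_bigr do rewrite entry.
  have [->|u_h] := eqVneq u h; first by rewrite big1 // => i _; rewrite eqxx.
  have /existsP[i ui] : [exists i, u i != h i].
    by apply: contraNT u_h; rewrite negb_exists => /forallP H; apply/eqP/ffunP=> i; apply/eqP; have := H i; rewrite negbK.
  by rewrite (bigD1 i) //= eq_sym (negPf ui) mul0r.
have: \sum_(u : mindex V r) w u * (u == h)%:R = 0.
  under eq_bigr do rewrite -key.
  by rewrite exchange_big big1 // => g _; rewrite -mulr_sumr w0 mulr0.
rewrite (bigD1 h) //= eqxx mulr1 big1 ?addr0 // => u /negPf->; exact: mulr0.
Qed.
End Gram.

Section Bending.
Variable r : nat.
Local Notation N := (r.*2).

(** Identifies the two blocks of r positions of a product of two tensor powers (the bottom row,
then the top row) with the alternating labels of the vertices. *)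
Definition weave (x : 'I_(r + r)) : 'I_N := label (split x).
Definition unweave (y : 'I_N) : 'I_(r + r) := unsplit (unlabel y).
Lemma weaveK : cancel weave unweave.
Proof. by move=> x; rewrite /weave /unweave labelK splitK. Qed.
Lemma unweaveK : cancel unweave weave.
Proof. by move=> x; rewrite /weave /unweave unsplitK unlabelK. Qed.

Definition capped (M : matching 'I_N) : brauer N 0 := relabel (@inlK0 N) (@bottomK N) M.
Definition unfold_matching (M : matching 'I_N) : brauer r r := relabel (@unlabelK r) (@labelK r) M.
(** The matching M as caps on 2r points that are ordered bottom row first. *)
Definition capped_row (M : matching 'I_N) : brauer (r + r) 0 :=
  relabel (pullK unweaveK (p := 0)) (pushK weaveK (p := 0)) (capped M).

Lemma cappedE M x : capped M (inl x) = inl (M x).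
Proof. by rewrite ffunE. Qed.

Lemma unfold_matchingE M x : unfold_matching M x = unlabel (M (label x)).
Proof. by rewrite ffunE. Qed.

Lemma capped_rowE M y : capped_row M (inl (unsplit y)) = inl (unsplit (unfold_matching M y)).
Proof. by rewrite ffunE /push /weave unsplitK cappedE unfold_matchingE. Qed.

Lemma unfold_M0 y : unfold_matching (M0 r) y = swap_sum y.
Proof.
rewrite unfold_matchingE M0E; apply: (can_inj (@labelK r)); rewrite unlabelK; apply/val_inj.
by case: y => i /=; rewrite odd_double.
Qed.

Lemma juxt_through (D : brauer r r) x :
  juxt_diag D (I_diag r) (juxt_emb x) = juxt_emb (juxt_fun D (I_diag r) x).
Proof. exact: juxt_diagE. Qed.

(** Joining the top of the diagram of M to r further strands, by means of the caps of [M0], bends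
it into the capped matching M. *)
Lemma bend_diag (K : fieldType) (delta : K) (M : matching 'I_N) :
  bcomp delta (bvec K (capped_row (M0 r))) (bvec K (juxt_diag (unfold_matching M) (I_diag r)))
    = bvec K (capped_row M).
Proof.
set D := unfold_matching M.
pose tp (j : 'I_(r + r)) : 'I_r := match split j with inl i => i | inr i => i end.
pose phi (x : 'I_(r + r) + 'I_(r + r) + 'I_0) : 'I_(r + r) + 'I_0 := match x with
  | inl (inl i) => inl i | inl (inr j) => inl (rshift r (tp j)) | inr q => inr q end.
have tpl i : tp (lshift r i) = i by rewrite /tp (unsplitK (inl _)).
have tpr i : tp (rshift r i) = i by rewrite /tp (unsplitK (inr _)).
have I_E (y : 'I_r + 'I_r) : I_diag r y = swap_sum y.
  by rewrite ffunE; case: y => i /=; rewrite ?invg1 perm1.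
(* The two ends of the strand of D at the label y, seen in the stack. *)
pose low (y : 'I_r + 'I_r) : 'I_(r + r) + 'I_(r + r) :=
  match y with inl i => inl (lshift r i) | inr i => inr (lshift r i) end.
have lowE y : juxt_diag D (I_diag r) (low y) = low (D y).
  have embE z : low z = juxt_emb (inl z) by case: z.
  by rewrite !embE juxt_through.
have phi_low y : phi (inl (low y)) = inl (unsplit y) by case: y => i /=; rewrite ?tpl.
have strandE i : juxt_diag D (I_diag r) (inl (rshift r i)) = inr (rshift r i).
  by rewrite -[inl _]/(juxt_emb (inr (inl i))) juxt_through /= I_E.
have strandE' i : juxt_diag D (I_diag r) (inr (rshift r i)) = inl (rshift r i).
  by rewrite -[inr _]/(juxt_emb (inr (inr i))) juxt_through /= I_E.
have capE y : capped_row (M0 r) (inl (unsplit y)) = inl (unsplit (swap_sum y)).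
  by rewrite capped_rowE unfold_M0.
have capMl i : capped_row (M0 r) (inl (lshift r i)) = inl (rshift r i) by apply: (capE (inl i)).
have capMr i : capped_row (M0 r) (inl (rshift r i)) = inl (lshift r i) by apply: (capE (inr i)).
pose edge := stack_edge (capped_row (M0 r)) (juxt_diag D (I_diag r)).
have conn_strand i : connect edge (inl (inl (rshift r i))) (inl (inr (rshift r i))).
  by apply: connect1; have := stack_edge_lower (capped_row (M0 r)) (juxt_diag D (I_diag r)) (inl (rshift r i)); rewrite strandE.
have conn_mid i : connect edge (inl (inr (rshift r i))) (inl (inr (lshift r i))).
  by apply: connect1; have := stack_edge_upper (capped_row (M0 r)) (juxt_diag D (I_diag r)) (inl (rshift r i)); rewrite capMr.
have conn_low y : connect edge (inl (inl (unsplit y))) (inl (low y)).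
  by case: y => i /=; [apply: connect0 | apply: connect_trans (conn_strand i) (conn_mid i)].
apply: (@bcomp_bvec _ _ _ _ _ _ phi).
- by case.
- move=> x; have [[y ->]|[i [->|->]]] : (exists y, x = low y) \/ exists i, x = inl (rshift r i) \/ x = inr (rshift r i).
  + case: x => x; rewrite -(splitK x); case: (split x) => i /=.
    * by left; exists (inl i).
    * by right; exists i; left.
    * by left; exists (inr i).
    by right; exists i; right.
  + by rewrite lowE /lower_vertex !phi_low !inE capped_rowE eqxx orbT.
  + by rewrite strandE /= tpr !inE eqxx.
  by rewrite strandE' /= tpr !inE eqxx.
- case=> [x|[]] //; rewrite -(splitK x); case: (split x) => i.
    by rewrite capMl /= tpl tpr !inE eqxx.
  by rewrite capMr /= tpl tpr !inE eqxx.
- case=> [[x|x]|[]] //=.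
  rewrite -[in X in connect _ _ X](splitK x) /tp; case: (split x) => i /=.
    exact: connect_trans (conn_strand i) (conn_mid i).
  exact: conn_strand.
case=> [x|[]] //; rewrite -(splitK x) capped_rowE /=.
apply: connect_trans (conn_low _) _; rewrite stack_connect_sym.
apply: connect_trans (conn_low _) _; rewrite stack_connect_sym.
have := stack_edge_lower (capped_row (M0 r)) (juxt_diag D (I_diag r)) (low (split x)).
by rewrite lowE => /connect1.
Qed.

End Bending.

Section Functor.
Variables (K : numClosedFieldType) (m n : nat) (V : osp_space K m n).
Variable (F : forall k l, 'Hom(bspace K k l, 'Hom(tpow V k, tpow V l))).
Hypotheses (FF : brauer_functor F) (V_neq0 : (0 < sdimn V)%N).
Variable r : nat.
Local Notation N := r.*2.
Local Notation Fd := (diag_op F).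
Local Notation Fp := (perm_op F).
Local Notation M := {ffun matching 'I_N -> K^o}.
Local Notation to := (@mact_action 'I_N).

Definition unfold_vec (z : M) : bspace K r r := \sum_D z D *: bvec K (unfold_matching D).
Definition cap_form (z : M) : 'Hom(tpow V N, tpow V 0) := \sum_D z D *: Fd (capped D).

Fact unfold_vec_linear : linear unfold_vec.
Proof.
move=> a x y; rewrite /unfold_vec scaler_sumr -big_split; apply: eq_bigr => D _ /=.
by rewrite !ffunE scalerDl scalerA.
Qed.
HB.instance Definition _ := GRing.isLinear.Build K M (bspace K r r) *:%R unfold_vec unfold_vec_linear.

Fact cap_form_linear : linear cap_form.
Proof.
move=> a x y; rewrite /cap_form scaler_sumr -big_split; apply: eq_bigr => D _ /=.
by rewrite !ffunE scalerDl scalerA.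
Qed.

Lemma cap_formZ a x : cap_form (a *: x) = a *: cap_form x.
Proof.
rewrite /cap_form scaler_sumr; apply: eq_bigr => D _.
by rewrite ffunE scalerA.
Qed.

Lemma cap_form_sum I (s : seq I) (P : pred I) (E : I -> M) :
  cap_form (\sum_(i <- s | P i) E i) = \sum_(i <- s | P i) cap_form (E i).
Proof.
apply: (big_morph cap_form) => [x y|].
  by have := cap_form_linear 1 x y; rewrite !scale1r.
by rewrite /cap_form big1 // => D _; rewrite ffunE scale0r.
Qed.

Lemma diag_op_capped_mact (D : matching 'I_N) s : Fd (capped (mact D s)) = (Fd (capped D) \o Fp (s^-1)%g)%VF.
Proof.
rewrite /Fp perm_diag_bij -(diag_op_bij FF); congr diag_op; apply: eq_matching => -[x|[]] //.
by rewrite cappedE mactE [RHS]ffunE /push cappedE /= invgK.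
Qed.

Lemma cap_form_pact s z : cap_form (pact to s z) = (cap_form z \o Fp (s^-1)%g)%VF.
Proof.
rewrite {1}/cap_form (reindex_inj (act_inj to s)) /=; apply/lfunP=> x.
rewrite comp_lfunE /cap_form !sum_lfunE; apply: eq_bigr => D _.
by rewrite !ffunE /= -[mact (mact D s) _]/(to (to D s) (s^-1)%g) actK diag_op_capped_mact !scale_lfunE comp_lfunE.
Qed.

Lemma diag_op_bend (D : matching 'I_N) x y : Fd (capped_row (M0 r)) (tprod (Fd (unfold_matching D) x) y)
   = Fd (capped D) (Fd (bij_diag (@weaveK r) (@unweaveK r)) (tprod x y)).
Proof.
have := diag_op_bij FF (@weaveK r) (@unweaveK r) (capped D).
rewrite -/(capped_row D) => /(congr1 (fun T : 'Hom(_, _) => T (tprod x y))).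
rewrite comp_lfunE => <-.
transitivity (Fd (capped_row (M0 r)) (Fd (juxt_diag (unfold_matching D) (I_diag r)) (tprod x y))).
  rewrite (diag_op_juxt FF) tens_homE; last exact: (even_hom_perm_op1 FF V_neq0).
  by rewrite -/(Fp 1%g) (perm_op1 FF V_neq0) id_lfunE.
by rewrite -comp_lfunE /diag_op -(F_comp FF) bend_diag.
Qed.

Lemma F_unfold_bend z x y : Fd (capped_row (M0 r)) (tprod (F r r (unfold_vec z) x) y)
  = cap_form z (Fd (bij_diag (@weaveK r) (@unweaveK r)) (tprod x y)).
Proof.
rewrite /unfold_vec linear_sum sum_lfunE tprod_suml linear_sum /cap_form sum_lfunE.
apply: eq_bigr => D _; rewrite linearZ /= !scale_lfunE tprodZl linearZ /=.
by congr (_ *: _); apply: diag_op_bend.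
Qed.

(** The functional [cap_form] is the composite of F z with the pairing of the top row against r
further factors ([F_unfold_bend]). It determines F z because that pairing is non-degenerate
([tensor_gram_inj]), and conversely every word of 2r vectors splits into two words of length r. *)
Lemma bend_kernel z : (unfold_vec z \in lker (F r r)) = (cap_form z == 0).
Proof.
have [sg sgP] := signed_bij FF V_neq0 (@weaveK r) (@unweaveK r).
rewrite memv_ker; apply/eqP/eqP=> [Fz0|cz0].
  apply: eq_hom_tbase => f; rewrite zero_lfunE.
  pose v (i : 'I_(r + r)) := tnth (hbasis V) (f (weave i)).
  have vp : homog v (fun i => idx_parity (f (weave i))) by move=> i; apply: hbasis_grade.
  have := sgP v _ vp; rewrite ptens_split => E.
  have := F_unfold_bend z (ptens (fun i => v (lshift r i))) (ptens (fun i => v (rshift r i))).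
  rewrite Fz0 zero_lfunE E linearZ /=.
  have -> : tprod 0 (ptens (fun i => v (rshift r i))) = 0 :> tpow V (r + r).
    by apply/ffunP=> g; rewrite !ffunE mul0r.
  rewrite linear0 => /esym/eqP; rewrite scaler_eq0 signr_eq0 /= => /eqP <-.
  by congr (cap_form z _); apply: eq_ptens => i; rewrite /v unweaveK.
apply: eq_hom_tbase => f; rewrite zero_lfunE; set w := F r r _ _.
apply: tensor_gram_inj => g.
have := F_unfold_bend z (tbase f) (tbase g); rewrite cz0 zero_lfunE -/w.
pose p := split_fun (fun i => idx_parity (g i)) (fun i => idx_parity (g i)).
have -> : capped_row (M0 r) = relabel (pullK (@unweaveK r) (p := 0)) (pushK (@weaveK r) (p := 0)) (capped (M0 r)) by [].
rewrite (diag_op_bij FF) comp_lfunE {1}[w]tbase_sum tprod_suml !linear_sum.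
pose s0 : K := (-1) ^+ sg p.
have termE (u : mindex V r) : Fd (capped (M0 r)) (Fd (bij_diag (@weaveK r) (@unweaveK r))
     (tprod (w u *: tbase u) (tbase g))) =
   (s0 * (w u * \prod_(i < r) gram V (g i) (u i))) *: tscal V 1.
  pose v := split_fun (fun i => tnth (hbasis V) (u i)) (fun i => tnth (hbasis V) (g i)).
  have vE : tprod (tbase u) (tbase g) = ptens v.
    rewrite ptens_split; congr tprod; apply: eq_ptens => i; by rewrite /v ?split_funl ?split_funr.
  rewrite tprodZl !linearZ /= vE.
  have capM0 : capped (M0 r) = Ahat r.
    by apply: eq_matching => -[x|[]] //; rewrite cappedE M0E ffunE.
  have unweave_evn i : unweave (evn i) = rshift r i by rewrite /unweave /evn labelK.
  have unweave_odn i : unweave (odn i) = lshift r i by rewrite /unweave /odn labelK.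
  have formE q : homog v q -> Fd (capped (M0 r)) (Fd (bij_diag (@weaveK r) (@unweaveK r)) (ptens v))
      = ((-1) ^+ sg q * \prod_(i < r) gram V (g i) (u i)) *: tscal V 1.
    move=> vq; rewrite (sgP _ _ vq) linearZ /= capM0 (diag_op_Ahat FF V_neq0) scalerA; congr ((_ * _) *: _).
    apply: eq_bigr => i _; rewrite unweave_evn unweave_odn /v split_funl split_funr.
    by rewrite mxE.
  have [eq_par|] := boolP [forall i, idx_parity (g i) == idx_parity (u i)].
    have vp : homog v p.
      move=> i; rewrite /v /p -(splitK i); case: (split i) => j /=.
        by rewrite !split_funl (eqP (forallP eq_par j)); apply: hbasis_grade.
      by rewrite !split_funr; apply: hbasis_grade.
    by rewrite (formE _ vp) scalerA mulrCA mulrA.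
  case/forallPn=> i neq_par.
  have prod0 : \prod_(i < r) gram V (g i) (u i) = 0.
    by rewrite (bigD1 i) //= mxE (osp_form_even (hbasis_grade _) (hbasis_grade _) neq_par) mul0r.
  have vq : homog v (split_fun (fun i => idx_parity (u i)) (fun i => idx_parity (g i))).
    move=> j; rewrite /v -(splitK j); case: (split j) => j' /=.
      by rewrite !split_funl; apply: hbasis_grade.
    by rewrite !split_funr; apply: hbasis_grade.
  by rewrite (formE _ vq) prod0 !mulr0 !scale0r scaler0.
under eq_bigr => u _ do rewrite /= termE.
rewrite -scaler_suml -mulr_sumr => /ffunP/(_ [ffun i : 'I_0 => Ordinal V_neq0]).
rewrite !ffunE => /eqP; rewrite [_ *: _]mulr1 mulf_eq0 signr_eq0 /= => /eqP.
by [].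
Qed.

End Functor.

(** * Vanishing on a rectangle *)

(** Leibniz rule at the point 0. *)
Lemma deriv_prod_horner0 (K : fieldType) (I : finType) (Q : I -> {poly K}) :
  (\prod_i Q i)^`().[0] = \sum_i (Q i)^`().[0] * \prod_(j | j != i) (Q j).[0].
Proof.
suff H (s : seq I) : uniq s -> (\prod_(i <- s) Q i)^`().[0] =
    \sum_(i <- s) (Q i)^`().[0] * \prod_(j <- s | j != i) (Q j).[0].
  by rewrite /index_enum -H //; exact: index_enum_uniq.
elim: s => [|i s IHs] /=; first by rewrite !big_nil derivC hornerC.
case/andP=> i_s s_uniq; rewrite !big_cons derivM hornerD !hornerM IHs // eqxx /=.
congr (_ + _).
  congr (_ * _); rewrite horner_prod; rewrite big_seq [RHS]big_seq_cond; apply: eq_bigl => j.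
  by apply/idP/andP=> [js|[]//]; split=> //; apply: contraNneq i_s => <-.
rewrite mulr_sumr big_seq [RHS]big_seq; apply: eq_bigr => j js.
have i_j : i != j by apply: contraNneq i_s => ->.
by rewrite big_cons i_j mulrCA.
Qed.

Section Operators.
Variables (K : numClosedFieldType) (m n : nat) (V : osp_space K m n).
Variable (F : forall k l, 'Hom(bspace K k l, 'Hom(tpow V k, tpow V l))).
Hypotheses (FF : brauer_functor F) (V_neq0 : (0 < sdimn V)%N).
Variable N : nat.
Local Notation Fp := (perm_op F).
Local Notation G := {perm 'I_N}.
Local Notation W := (tpow V N).

Definition opsum (H : {set G}) (chi : G -> K) : 'End(W) := \sum_(s in H) chi s *: Fp s.

Lemma opsumE (H : {set G}) (chi : G -> K) x :
  opsum H chi x = \sum_(s in H) chi s *: Fp s x.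
Proof. by rewrite sum_lfunE; apply: eq_bigr => s _; rewrite scale_lfunE. Qed.

Lemma opsum_Fp (H : {group G}) (chi : involutive_char K N) s : s \in H ->
  (opsum H chi \o Fp s)%VF = chi s *: opsum H chi.
Proof.
move=> sH; apply/lfunP=> x; rewrite comp_lfunE scale_lfunE !sum_lfunE scaler_sumr.
rewrite [RHS](reindex_inj (mulgI s)) /=.
apply: eq_big => [t|t tH]; first by rewrite groupMl.
by rewrite !scale_lfunE scalerA icharM mulrA ichar_sq mul1r (perm_opM FF) comp_lfunE.
Qed.

Lemma perm_op_opsum (H : {group G}) (chi : involutive_char K N) s : s \in H ->
  (Fp s \o opsum H chi)%VF = chi s *: opsum H chi.
Proof.
move=> sH; apply/lfunP=> x; rewrite comp_lfunE scale_lfunE !sum_lfunE scaler_sumr linear_sum.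
rewrite [RHS](reindex_inj (mulIg s)) /=.
apply: eq_big => [t|t tH]; first by rewrite groupMr.
by rewrite !scale_lfunE linearZ scalerA icharM mulrCA ichar_sq mulr1 (perm_opM FF) comp_lfunE.
Qed.

Lemma opsum_sub_r (H1 H2 : {group G}) (chi : involutive_char K N) : H1 \subset H2 ->
  (opsum H2 chi \o opsum H1 chi)%VF = #|H1|%:R *: opsum H2 chi.
Proof.
move=> sH; apply/lfunP=> x; rewrite comp_lfunE (opsumE H1) linear_sum.
rewrite scale_lfunE -sumr_const scaler_suml.
apply: eq_bigr => s /(subsetP sH) sH2.
by rewrite linearZ /= -comp_lfunE opsum_Fp // scale_lfunE scalerA ichar_sq.
Qed.

Lemma opsum_sub_l (H1 H2 : {group G}) (chi : involutive_char K N) : H1 \subset H2 ->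
  (opsum H1 chi \o opsum H2 chi)%VF = #|H1|%:R *: opsum H2 chi.
Proof.
move=> sH; apply/lfunP=> x; rewrite comp_lfunE (opsumE H1).
rewrite scale_lfunE -sumr_const scaler_suml.
apply: eq_bigr => s /(subsetP sH) sH2.
by rewrite -comp_lfunE perm_op_opsum // scale_lfunE scalerA ichar_sq.
Qed.

Section Rectangle.
Variables (row col : 'I_N -> nat) (P : {set 'I_N}) (k : nat).
Hypotheses (P_row : {in P, forall a, row a < m.+1}%N)
  (P_col : forall j, (j <= k)%N -> #|[set a in P | col a == j]| = m.+1).

Definition rows_in : {group G} := (level_stab_gp row :&: [group of Sym P])%G.
Definition cols_in : {group G} := (level_stab_gp col :&: [group of Sym P])%G.
(** The row symmetriser times the column antisymmetriser of the set P of boxes. *)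
Definition rect_op : 'End(W) := (opsum rows_in (@ptriv K N) \o opsum cols_in (@psign K N))%VF.

Lemma mem_rows_in a b : a \in P -> b \in P -> row a = row b -> tperm a b \in rows_in.
Proof.
move=> aP bP rab; rewrite inE tperm_level //= inE.
by apply/subsetP=> x; rewrite inE; case: tpermP => [->|->|]; rewrite ?eqxx.
Qed.

Lemma mem_cols_in a b : a \in P -> b \in P -> col a = col b -> tperm a b \in cols_in.
Proof.
move=> aP bP rab; rewrite inE tperm_level //= inE.
by apply/subsetP=> x; rewrite inE; case: tpermP => [->|->|]; rewrite ?eqxx.
Qed.

Lemma rect_op_col s x : s \in cols_in -> rect_op (Fp s x) = psign K s *: rect_op x.
Proof.
move=> sC; rewrite /rect_op comp_lfunE -[opsum cols_in _ (Fp s x)]comp_lfunE.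
by rewrite (opsum_Fp (sign_char K N) sC) scale_lfunE linearZ comp_lfunE.
Qed.

Lemma neg_self_eq0 (U : lmodType K) (x : U) : x = - x -> x = 0.
Proof.
by move/eqP; rewrite -subr_eq0 opprK -mulr2n -scaler_nat scaler_eq0 pnatr_eq0 => /eqP.
Qed.

(** After any column permutation two entries of B share a row, by the pigeonhole principle; the
antisymmetriser of B and the row symmetriser disagree on their transposition. *)
Lemma rect_op_antisym0 (B : {set 'I_N}) x : B \subset P -> (m.+1 < #|B|)%N ->
  rect_op (opsum (Sym B) (@psign K N) x) = 0.
Proof.
move=> sBP ltB; rewrite /rect_op comp_lfunE (opsumE cols_in) linear_sum big1 // => c.
rewrite inE => /andP[_]; rewrite inE => cP; rewrite linearZ /=.
have cBP a : a \in B -> c a \in P by move=> aB; rewrite perm_closed // (subsetP sBP).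
have [a [b [aB bB a_b rab]]] : exists a b, [/\ a \in B, b \in B, a != b & row (c a) = row (c b)].
  pose f a : 'I_m.+1 := inord (row (c a)).
  have : ~~ [forall a in B, forall b in B, (f a == f b) ==> (a == b)].
    apply/negP=> /forall_inP inj; move: ltB; rewrite ltnNge -[X in (_ <= X)%N]card_ord => /negP; apply.
    rewrite -(@card_in_imset _ _ f) ?max_card // => a b aB bB fab.
    by have /forall_inP/(_ b bB) := inj a aB; rewrite fab eqxx => /eqP.
  case/forall_inPn=> a aB /forall_inPn[b bB]; rewrite negb_imply => /andP[/eqP fab a_b].
  exists a, b; split=> //; move/(congr1 val): fab; rewrite /f /= !inordK ?P_row ?cBP //.
have tB : tperm a b \in [group of Sym B].
  by rewrite inE; apply/subsetP=> z; rewrite inE; case: tpermP => [->|->|]; rewrite ?eqxx.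
pose y := opsum (Sym B) (@psign K N) x; rewrite -/y.
have ty : Fp (tperm a b) y = - y.
  rewrite /y -comp_lfunE (perm_op_opsum (sign_char K N) tB) scale_lfunE /= /psign odd_tperm a_b.
  by rewrite scaleN1r.
have : opsum rows_in (@ptriv K N) (Fp c y) = - opsum rows_in (@ptriv K N) (Fp c y).
  rewrite -linearN -linearN /= -ty -[Fp c (Fp _ _)]comp_lfunE -(perm_opM FF).
  have -> : (tperm a b * c = c * tperm (c a) (c b))%g by rewrite -tpermJ conjgE !mulgA mulgV mul1g.
  rewrite (perm_opM FF) comp_lfunE -[X in _ = X]comp_lfunE.
  by rewrite (opsum_Fp (triv_char K N) (mem_rows_in (cBP _ aB) (cBP _ bB) rab)) scale1r.
by move/neg_self_eq0->; rewrite scaler0.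
Qed.

Definition upd (q : 'I_N) (x : V) (v : 'I_N -> V) (a : 'I_N) : V :=
  if a == q then x else v a.

Lemma ptens_upd_sum I (s : seq I) (c : I -> K) (u : I -> V) (q : 'I_N) (v : 'I_N -> V) :
  v q = \sum_(i <- s) c i *: u i ->
  ptens v = \sum_(i <- s) c i *: ptens (upd q (u i) v).
Proof.
move=> vq; apply/ffunP=> f; rewrite sum_ffunE ptensE (bigD1 q) //= vq /hcoord linear_sum mulr_suml.
apply: eq_bigr => i _; rewrite linearZ ffunE ptensE [in RHS](bigD1 q) //= {1}/upd eqxx -mulrA; congr (_ * (_ * _)).
by apply: eq_bigr => a /negPf a_q; rewrite /upd a_q.
Qed.

Section Filling.
Variable e : 'I_m -> V.

(** A word whose even factors in P are taken from the given m vectors, and whose odd factors in P,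
except on D, are constant along the columns. Growing D from the empty set to the full set passes
from constant columns to arbitrary words. *)
Definition filling (D : {set 'I_N}) (u : nat -> V) (v : 'I_N -> V) (p : 'I_N -> bool) :=
  homog v p /\ {in P, forall a, if p a then a \notin D -> v a = u (col a)
                               else exists i, v a = e i}.

(** Induction on the number of odd factors in column j0. If there is none, the m + 1 boxes of the
column carry m even vectors, two factors coincide, and antisymmetrisation kills the word.
Otherwise replace the odd factor at some q0 by a combination of the vectors of the other columns.
In the term of column i, antisymmetrise over q0 and column i: these are m + 2 entries, so the
result is zero ([rect_op_antisym0]). In this sum, the permutations that put an odd factor at q0
all give the word itself, and the other ones give words with fewer odd factors in column j0. *)
Lemma rect_op_dependent (u : nat -> V) (c : nat -> K) j0 v p :
  (forall j, u j \in vgrade V true) -> (j0 <= k)%N ->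
  u j0 = \sum_(i < k.+1 | (i != j0 :> nat)) c i *: u i ->
  filling set0 u v p -> rect_op (ptens v) = 0.
Proof.
move=> u_odd le_j0 u_dep.
have [b] := ubnP #|[set a in P | (col a == j0) && p a]|.
elim: b v p => // b IHb v p lt_b [vp fill].
have [none|] := eqVneq [set a in P | (col a == j0) && p a] set0.
  (* The value [ord0] is never taken on column j0, so that g has only m values there. *)
  pose g a : 'I_m.+1 := if [pick i | v a == e i] is Some i then lift ord0 i else ord0.
  have colP a : a \in [set a in P | col a == j0] -> [/\ a \in P, col a = j0, p a = false & exists i, v a = e i].
    rewrite inE => /andP[aP /eqP ca]; have := fill a aP.
    have -> : p a = false by apply/negP=> pa; have := in_set0 a; rewrite -none inE aP ca eqxx pa.
    by [].
  have gE a : a \in [set a in P | col a == j0] -> exists2 i, g a = lift ord0 i & v a = e i.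
    case/colP=> _ _ _ [i vi]; rewrite /g; case: pickP => [i' /eqP vi'|/(_ i)]; first by exists i'.
    by rewrite vi eqxx.
  have : ~~ [forall a in [set a in P | col a == j0], forall b in [set a in P | col a == j0], (g a == g b) ==> (a == b)].
    apply/negP=> /forall_inP inj.
    have : (#|g @: [set a in P | col a == j0]| <= #|[set~ ord0 : 'I_m.+1]|)%N.
      by apply/subset_leq_card/subsetP=> _ /imsetP[a /gE[i -> _] ->]; rewrite !inE eq_sym neq_lift.
    rewrite card_in_imset ?P_col // ?cardsC1 ?card_ord ?ltnn // => a a' aB bB fab.
    by have /forall_inP/(_ a' bB) := inj a aB; rewrite fab eqxx => /eqP.
  case/forall_inPn=> a aC /forall_inPn[a' a'C]; rewrite negb_imply => /andP[/eqP gaa' a_a'].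
  have [i gi vi] := gE a aC; have [i' gi' vi'] := gE a' a'C.
  have [aP ca pa _] := colP a aC; have [a'P ca' pa' _] := colP a' a'C.
  have vaa' : v a = v a' by rewrite vi vi'; congr e; apply: (@lift_inj _ ord0); rewrite -gi -gi'.
  have tC : tperm a a' \in cols_in by apply: mem_cols_in; rewrite ?ca ?ca'.
  have swap := swap_same FF V_neq0 a_a' vp (etrans pa (esym pa')).
  have := rect_op_col (ptens v) tC; rewrite swap pa expr0 scale1r /psign odd_tperm a_a' scaleN1r.
  rewrite (_ : ptens _ = ptens v); first by move/neg_self_eq0.
  by apply: eq_ptens => x; case: tpermP => [->|->|].
case/set0Pn=> q0; rewrite inE => /and3P[q0P /eqP cq0 pq0].
have vq0 : v q0 = \sum_(i <- [seq i <- index_enum 'I_k.+1 | nat_of_ord i != j0])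
    c (nat_of_ord i) *: u (nat_of_ord i).
  by have := fill q0 q0P; rewrite pq0 inE cq0 u_dep big_filter; apply.
rewrite (ptens_upd_sum vq0) linear_sum big_filter big1 // => i i_j0.
rewrite linearZ /=; set w := upd _ _ _; apply/eqP; rewrite scaler_eq0; apply/orP; right; apply/eqP.
(* q0 lies in column j0, so that B has m + 2 elements. *)
pose B := q0 |: [set a in P | col a == i].
have sBP : B \subset P.
  by apply/subsetP=> a; rewrite !inE => /orP[/eqP->//|/andP[]].
have cardB : #|B| = m.+2.
  by rewrite cardsU1 P_col ?inE ?q0P /= ?cq0 1?eq_sym ?i_j0 // -ltnS.
have wp : homog w p.
  by move=> a; rewrite /w /upd; case: eqP => [->|_]; [rewrite pq0 | apply: vp].
have := rect_op_antisym0 (ptens w) sBP; rewrite cardB ltnSn => /(_ isT).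
rewrite opsumE linear_sum.
have termE s : s \in Sym B -> rect_op (psign K s *: Fp s (ptens w)) =
    if p ((s^-1)%g q0) then rect_op (ptens w) else 0.
  rewrite inE => sB; have sVB : perm_on B (s^-1)%g by rewrite perm_onV.
  rewrite linearZ /=; set q := (s^-1)%g q0.
  have q0B : q0 \in B by rewrite setU11.
  have qB : q \in B by rewrite perm_closed.
  have colC (t : G) : perm_on B t -> t q0 = q0 -> t \in cols_in.
    move=> tB tq0; rewrite inE; apply/andP; split; last by rewrite inE; apply: subset_trans tB sBP.
    apply/level_stabP=> a; have [->|a_q0] := eqVneq a q0; first by rewrite tq0.
    case: (boolP (a \in B)) => [aB|aB]; last by rewrite (out_perm tB).
    have taB : t a \in B by rewrite perm_closed.
    have ta_q0 : t a != q0 by rewrite -[X in _ != X]tq0 (inj_eq perm_inj).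
    by move: aB taB; rewrite !inE (negPf a_q0) (negPf ta_q0) /= => /andP[_ /eqP->] /andP[_ /eqP->].
  case: ifP => pq.
    have [q_q0|q_q0] := eqVneq q q0.
      have sq0 : s q0 = q0 by rewrite -{1}q_q0 permKV.
      by rewrite (rect_op_col _ (colC _ sB sq0)) scalerA psign_sq scale1r.
    have [qP cq] : q \in P /\ col q = i.
      by move: qB; rewrite !inE (negPf q_q0) /= => /andP[-> /eqP].
    have wq : w q = w q0.
      by rewrite /w /upd eqxx (negPf q_q0); have := fill q qP; rewrite pq inE cq; apply.
    pose s' := (tperm q0 q * s)%g.
    have sE : s = (tperm q0 q * s')%g by rewrite mulgA tperm2 mul1g.
    have tB : perm_on B (tperm q0 q).
      by apply/subsetP=> z; rewrite inE; case: tpermP => [->|->|]; rewrite ?eqxx.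
    have s'C : s' \in cols_in.
      by apply: colC; [apply: perm_onM | rewrite permM tpermL permKV].
    have q0_q : q0 != q by rewrite eq_sym.
    rewrite {2}sE (perm_opM FF) comp_lfunE (swap_same FF V_neq0 q0_q wp) ?pq0 ?pq //.
    rewrite (_ : ptens _ = ptens w); last first.
      by apply: eq_ptens => x; case: tpermP => [->|->|].
    rewrite !linearZ /= (rect_op_col _ s'C) sE psignM {1}/psign odd_tperm q0_q !scalerA expr1.
    by rewrite !mulN1r opprK psign_sq scale1r.
  have [sg sgP] := signed_perm_all FF V_neq0 s.
  rewrite (sgP _ _ wp) linearZ /= (_ : rect_op _ = 0) ?scaler0 //.
  have q_q0 : q != q0 by apply: contraFneq pq => ->.
  apply: (IHb _ (fun a => p ((s^-1)%g a))).
    rewrite ltnS in lt_b; apply: leq_trans lt_b.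
    have sub : [set a in P | (col a == j0) && p ((s^-1)%g a)] \proper [set a in P | (col a == j0) && p a].
      apply/properP; split; last first.
        by exists q0; rewrite inE q0P cq0 eqxx /= ?pq0 // -/q pq.
      apply/subsetP=> a; rewrite !inE => /and3P[aP /eqP ca pa]; rewrite aP ca eqxx /=.
      have [a_q0|a_q0] := eqVneq a q0; first by rewrite a_q0.
      by rewrite -(out_perm sVB (x := a)) // !inE (negPf a_q0) aP ca /= eq_sym.
    exact: proper_card.
  split; first exact: homog_perm.
  move=> a aP; have [->|a_q0] := eqVneq a q0.
    rewrite -/q pq /w /upd (negPf q_q0); have := qB; rewrite !inE (negPf q_q0) => /andP[qP _].
    by have := fill q qP; rewrite pq.
  case: (boolP (a \in B)) => [aB|aB]; last first.
    by rewrite (out_perm sVB aB) /w /upd (negPf a_q0); apply: fill.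
  have ca : col a = i by move: aB; rewrite !inE (negPf a_q0) => /andP[_ /eqP].
  rewrite ca /w /upd; set a' := (s^-1)%g a; have [->|a'_q0] := eqVneq a' q0; first by rewrite pq0.
  have : a' \in B by rewrite perm_closed.
  rewrite !inE (negPf a'_q0) /= => /andP[a'P /eqP ca'].
  by have := fill a' a'P; rewrite ca' -/a'; case: (p a') => // + _; apply; rewrite inE.
rewrite (eq_bigr _ termE) -big_mkcondr sumr_const => /eqP.
rewrite -scaler_nat scaler_eq0 pnatr_eq0 => /orP[|/eqP//].
rewrite -leqn0 leqNgt => /negP[]; apply/card_gt0P; exists 1%g.
by rewrite unfold_in /= invg1 perm1 pq0 andbT inE perm_on1.
Qed.

End Filling.
End Rectangle.
End Operators.

Section Rectangle.
Variables (K : numClosedFieldType) (m n : nat) (V : osp_space K m n).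
Variable (F : forall k l, 'Hom(bspace K k l, 'Hom(tpow V k, tpow V l))).
Hypotheses (FF : brauer_functor F) (V_neq0 : (0 < sdimn V)%N).
Variable N : nat.
Local Notation Fp := (perm_op F).
Local Notation G := {perm 'I_N}.
Variables (row col : 'I_N -> nat) (P : {set 'I_N}).
Local Notation k := (2 * n)%N.
Hypotheses (P_row : {in P, forall a, row a < m.+1}%N)
  (P_col : forall j, (j <= k)%N -> #|[set a in P | col a == j]| = m.+1).
Local Notation rect_op := (@rect_op K m n V F N row col P).

Variable e : 'I_m -> V.

(** The 2n + 1 odd vectors of the columns lie in a space of dimension 2n. *)
Lemma rect_op_filling0 (u : nat -> V) v p : (forall j, u j \in vgrade V true) ->
  filling col P e set0 u v p -> rect_op (ptens v) = 0.
Proof.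
move=> u_odd fill; apply/eqP; apply: contraT => rect_op_neq0.
pose X := [tuple u (nat_of_ord i) | i < k.+1].
have X_free : free X.
  apply/freeP => c; rewrite (eq_bigr (fun i : 'I_k.+1 => c i *: u i)); last first.
    by move=> i _; rewrite -tnth_nth tnth_mktuple.
  move=> sum0 j; apply/eqP; apply: contraT => cj.
  pose d i := - (c (inord i) / c j).
  have/negP[] := rect_op_neq0; apply/eqP; apply: (rect_op_dependent FF V_neq0 P_row P_col u_odd (c := d) (j0 := j)) fill.
    by rewrite -ltnS.
  rewrite -[LHS]scale1r -(mulVf cj) -scalerA; move/eqP: sum0; rewrite (bigD1 j) //= addr_eq0 => /eqP->.
  rewrite scalerN scaler_sumr -sumrN; apply: eq_bigr => i _.
  by rewrite /d inord_val scaleNr scalerA mulrC.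
have : (size X <= \dim (odd_part V))%N.
  rewrite -(eqP X_free); apply: dimvS; apply/span_subvP=> x /tnthP[i ->].
  by rewrite tnth_mktuple; apply: u_odd.
by rewrite size_tuple osp_dim_odd ltnn.
Qed.

(** Replace the common vector u of the odd factors of the column of p0 by u + t x, where x is the
factor at p0: by hypothesis the result vanishes for all t. Its derivative at t = 0 is the sum,
over the odd positions of the column that carry u or x, of the words with x there and u elsewhere;
these words differ by column permutations, so they all have the same image. *)
Lemma rect_op_polarize (D : {set 'I_N}) (p0 : 'I_N) :
  (forall u v p, (forall j, u j \in vgrade V true) -> filling col P e D u v p -> rect_op (ptens v) = 0) ->
  forall u v p, (forall j, u j \in vgrade V true) -> filling col P e (p0 |: D) u v p -> rect_op (ptens v) = 0.
Proof.
move=> vanishD u v p u_odd [vp fill].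
case: (boolP ((p0 \in P) && p p0)) => [/andP[p0P pp0]|triv]; last first.
  apply: (vanishD u v p) => //; split=> // a aP; have := fill a aP; case: ifP => // pa fa aD.
  by apply: fa; rewrite !inE negb_or aD andbT; apply: contra triv => /eqP<-; rewrite aP.
pose j := col p0; pose x := v p0.
pose O := [set a in P | [&& col a == j, p a & (a == p0) || (a \notin D)]].
have p0O : p0 \in O by rewrite inE p0P !eqxx pp0.
have OP a : a \in O -> [/\ a \in P, col a = j & p a].
  by rewrite inE => /and4P[-> /eqP-> ->].
have v_O a : a \in O -> a != p0 -> v a = u j.
  rewrite inE => /and4P[aP /eqP ca pa aD] a_p0; have := fill a aP; rewrite pa ca; apply.
  by rewrite !inE (negPf a_p0) /=; move: aD; rewrite (negPf a_p0).
pose vt t a : V := if a \in O then u j + t *: x else v a.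
have x_odd : x \in vgrade V true by have := vp p0; rewrite pp0.
have vanish_t t : rect_op (ptens (vt t)) = 0.
  pose ut i := if i == j then u j + t *: x else u i.
  have ut_odd i : ut i \in vgrade V true.
    by rewrite /ut; case: eqP => _ //; rewrite memvD ?memvZ.
  apply: (vanishD ut _ p ut_odd); split=> [a|a aP].
    rewrite /vt; case: (boolP (a \in O)) => [/OP[_ _ ->]|_]; last exact: vp.
    by rewrite memvD ?memvZ.
  have := fill a aP; case: ifP => pa fa; last first.
    by rewrite /vt; case: (boolP (a \in O)) => [/OP[_ _]|//]; rewrite pa.
  move=> aD; rewrite /vt /ut; case: (boolP (a \in O)) => [/OP[_ -> _]|aO]; first by rewrite eqxx.
  have a_p0 : a != p0 by apply: contraNneq aO => ->.
  have ca : col a != j by apply: contraNneq aO => ca; rewrite inE aP ca eqxx pa aD orbT.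
  by rewrite (negPf ca) fa // !inE negb_or a_p0.
(* The word that carries x at b and u at the other positions of O. *)
pose w (b a : 'I_N) : V := if a == b then x else if a \in O then u j else v a.
have wE b : b \in O -> rect_op (ptens (w b)) = rect_op (ptens v).
  have -> : ptens v = ptens (w p0).
    apply: eq_ptens => a; rewrite /w; case: eqP => [->//|/eqP a_p0].
    by case: (boolP (a \in O)) => // aO; apply: v_O.
  move=> bO; have [->//|b_p0] := eqVneq b p0; have [bP cb pb] := OP b bO.
  have wp : homog (w p0) p.
    move=> a; rewrite /w; case: eqP => [->|_]; first by rewrite pp0.
    by case: (boolP (a \in O)) => [/OP[_ _ ->]|_]; [apply: u_odd | apply: vp].
  have tC : tperm b p0 \in cols_in col P by apply: mem_cols_in; rewrite ?cb.
  have := rect_op_col FF row (ptens (w p0)) tC.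
  rewrite (swap_same FF V_neq0 b_p0 wp) ?pb ?pp0 // linearZ /= expr1 /psign odd_tperm b_p0 expr1.
  move/(scalerI (_ : -1 != 0))=> <-; last by rewrite oppr_eq0 oner_eq0.
  congr (rect_op _); apply: eq_ptens => a; rewrite /w; case: tpermP => [->|->|/eqP a_b /eqP a_p0].
  - by rewrite !eqxx.
  - by rewrite eq_sym (negPf b_p0) bO p0O.
  by rewrite (negPf a_b) (negPf a_p0).
suff sum0 : \sum_(b in O) rect_op (ptens (w b)) = 0.
  move: sum0; rewrite (eq_bigr (fun _ => rect_op (ptens v))) // sumr_const -scaler_nat.
  move/eqP; rewrite scaler_eq0 pnatr_eq0 -leqn0 leqNgt card_gt0 => /orP[/negP[]|/eqP//].
  by apply/set0Pn; exists p0.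
apply/ffunP=> g; rewrite ffunE.
pose Q (f : mindex V N) a : {poly K} :=
  if a \in O then (hcoord (f a) (u j))%:P + hcoord (f a) x *: 'X else (hcoord (f a) (v a))%:P.
have coordE y : rect_op y g = \sum_f y f * rect_op (tbase f) g.
  rewrite {1}[y]tbase_sum linear_sum sum_ffunE; apply: eq_bigr => f _.
  by rewrite linearZ ffunE.
(* The coordinate at g of the image of [vt t], as a polynomial in t. *)
pose R : {poly K} := \sum_f rect_op (tbase f) g *: \prod_a Q f a.
have R0 : R = 0.
  have Rt t : R.[t] = 0.
    transitivity (rect_op (ptens (vt t)) g); last by rewrite vanish_t ffunE.
    rewrite coordE /R horner_sum; apply: eq_bigr => f _; rewrite hornerZ mulrC; congr (_ * _).
    rewrite horner_prod ptensE; apply: eq_bigr => a _; rewrite /Q /vt; case: ifP => _.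
      by rewrite hornerD hornerC hornerZ hornerX /hcoord linearD linearZ /= mulrC.
    by rewrite hornerC.
  apply/eqP; apply: contraT => R_neq0.
  have := max_poly_roots R_neq0 (rs := [seq (i%:R : K) | i <- iota 0 (size R)]).
  rewrite size_map size_iota ltnn; apply.
    by apply/allP=> t _; rewrite /root Rt.
  by rewrite map_inj_uniq ?iota_uniq // => i i' /eqP; rewrite eqr_nat => /eqP.
have : R^`().[0] = 0 by rewrite R0 deriv0 horner0.
rewrite /R raddf_sum horner_sum => Rd; rewrite -[RHS]Rd sum_ffunE.
under eq_bigr => b bO do rewrite coordE.
rewrite exchange_big; apply: eq_bigr => f _ /=.
rewrite derivZ hornerZ deriv_prod_horner0 -mulr_suml mulrC; congr (_ * _).
rewrite [RHS](bigID (mem O)) /= [X in _ = _ + X]big1 ?addr0; last first.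
  by move=> a /negPf aO; rewrite /Q aO derivC hornerC mul0r.
apply: eq_bigr => b bO; rewrite ptensE (bigD1 b) //= {1}/w eqxx; congr (_ * _).
  by rewrite /Q bO derivD derivC add0r derivZ derivX hornerZ hornerC mulr1.
apply: eq_bigr => a /negPf a_b; rewrite /w a_b /Q; case: ifP => _; last by rewrite hornerC.
by rewrite hornerD hornerC hornerZ hornerX mulr0 addr0.
Qed.

(** Starting from [rect_op_filling0], each application of [rect_op_polarize] frees one more odd
factor. *)
Lemma rect_op_filling (D : {set 'I_N}) u v p : (forall j, u j \in vgrade V true) ->
  filling col P e D u v p -> rect_op (ptens v) = 0.
Proof.
have [b] := ubnP #|D|; elim: b D u v p => // b IHb D u v p lt_b u_odd.
have [->|/set0Pn[p0 p0D]] := eqVneq D set0; first exact: rect_op_filling0.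
rewrite -(setD1K p0D); apply: rect_op_polarize => // u' v' p' u'_odd.
apply: IHb => //; by move: lt_b; rewrite (cardsD1 p0) p0D add1n ltnS.
Qed.

End Rectangle.

(** * Vanishing for shapes outside the hook *)

Section HookVanishing.
Variables (K : numClosedFieldType) (m n : nat) (V : osp_space K m n).
Variable (F : forall k l, 'Hom(bspace K k l, 'Hom(tpow V k, tpow V l))).
Hypotheses (FF : brauer_functor F) (V_neq0 : (0 < sdimn V)%N).
Variable r : nat.
Local Notation N := r.*2.
Local Notation to := (@mact_action 'I_N).

Lemma cap_form_psum (H : {group {perm 'I_N}}) (chi : involutive_char K N) z :
  cap_form F (psum to H chi z) = (cap_form F z \o opsum F H chi)%VF.
Proof.
apply/lfunP=> x; rewrite comp_lfunE opsumE [RHS]linear_sum.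
rewrite /psum cap_form_sum sum_lfunE.
rewrite [RHS](reindex_inj invg_inj) /=; apply: eq_big => [s|s _]; first by rewrite groupV.
by rewrite cap_formZ scale_lfunE [RHS]linearZ /= icharV cap_form_pact // comp_lfunE.
Qed.

Section Shape.
Variable la : seq nat.
Hypotheses (la_part : is_partition N la) (la_hook : (2 * n < nth 0 la m)%N).

Definition hook_rect : {set 'I_N} := [set a | (trow la a < m.+1) && (tcol la a <= 2 * n)]%N.

Lemma hook_rect_row : {in hook_rect, forall a, trow la a < m.+1}%N.
Proof. by move=> a; rewrite inE => /andP[]. Qed.

Lemma hook_rect_col j : (j <= 2 * n)%N -> #|[set a in hook_rect | tcol la a == j]| = m.+1.
Proof.
move=> le_j; set A := [set _ | _]; rewrite cardE -(size_map (@trow N la)) -[RHS](size_iota 0).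
apply: perm_size; apply: uniq_perm; rewrite ?iota_uniq //.
  rewrite map_inj_in_uniq ?enum_uniq // => a b; rewrite !mem_enum !inE.
  move=> /andP[_ /eqP ca] /andP[_ /eqP cb] rab.
  by apply: (tcoords_inj la_part) => //; rewrite ca cb.
move=> i; rewrite mem_iota /= add0n; apply/mapP/idP => [[a]|lt_i].
  by rewrite mem_enum !inE => /andP[/andP[+ _] _] ->.
have lt_j : (j < nth 0 la i)%N.
  by apply: leq_ltn_trans le_j (leq_trans la_hook _); apply: (nth_part_anti la_part); rewrite -ltnS.
have [a [ra ca]] := tcoords_surj la_part lt_j.
by exists a => //; rewrite mem_enum !inE ra ca lt_i le_j eqxx.
Qed.

(** Every word in the homogeneous basis is a filling when D is the full set. *)
Lemma hook_rect_op0 : rect_op F (@trow N la) (@tcol N la) hook_rect = 0.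
Proof.
apply: eq_hom_tbase => f; rewrite zero_lfunE.
apply: (rect_op_filling FF V_neq0 hook_rect_row hook_rect_col (e := fun i => nth 0 (hbasis V) i)
   (D := setT) (u := fun _ => 0) (p := fun a => idx_parity (f a))) => [j|]; first exact: mem0v.
split; first exact: homog_tbase.
move=> a _; case: ifP => [_|]; first by rewrite inE.
move/negbT; rewrite /idx_parity -ltnNge osp_dim_even => lt_m.
by exists (Ordinal lt_m); rewrite (tnth_nth 0).
Qed.

(** The sums over the stabilisers of the rectangle can be inserted between the row sum and the
column sum of la at the cost of a non-zero integer factor; their product is zero by
[hook_rect_op0]. *)
Lemma cap_form_uvec0 : cap_form F (uvec K r la) = 0.
Proof.
rewrite /uvec /casym /rsym (cap_form_psum (level_stab_gp _) (sign_char K N)).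
rewrite (cap_form_psum (level_stab_gp _) (triv_char K N)) -comp_lfunA.
suff -> : (opsum F (level_stab (@trow N la)) (triv_char K N) \o
           opsum F (level_stab (@tcol N la)) (sign_char K N))%VF = 0 by rewrite comp_lfun0r.
pose A := rows_in (@trow N la) hook_rect; pose B := cols_in (@tcol N la) hook_rect.
have A_sub : A \subset level_stab_gp (@trow N la) by apply: subsetIl.
have B_sub : B \subset level_stab_gp (@tcol N la) by apply: subsetIl.
have A_neq0 : (#|A|%:R : K) != 0 by rewrite pnatr_eq0 -lt0n cardG_gt0.
have B_neq0 : (#|B|%:R : K) != 0 by rewrite pnatr_eq0 -lt0n cardG_gt0.
have factor : (opsum F (level_stab (@trow N la)) (triv_char K N) \o
    opsum F A (triv_char K N) \o (opsum F B (sign_char K N) \o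
           opsum F (level_stab (@tcol N la)) (sign_char K N)))%VF = 0.
  rewrite -comp_lfunA (comp_lfunA (opsum F A _)) [(opsum F A _ \o opsum F B _)%VF]hook_rect_op0.
  by rewrite comp_lfun0l comp_lfun0r.
move: factor; rewrite (opsum_sub_r FF _ A_sub) (opsum_sub_l FF _ B_sub).
rewrite -comp_lfunZl -comp_lfunZr => /eqP; rewrite !scaler_eq0 (negPf A_neq0) (negPf B_neq0) /=.
by move/eqP.
Qed.
End Shape.
End HookVanishing.

(** * Orthogonal and symplectic bases *)

Section AdaptedBases.
Variables (K : numFieldType) (m n : nat) (V : osp_space K m n).
Local Notation form := (osp_form V).

Definition nondeg_on (U : {vspace V}) :=
  forall u, u \in U -> (forall v, v \in U -> form u v = 0) -> u = 0.

Lemma nondeg_witness (U : {vspace V}) x : nondeg_on U -> x \in U -> x != 0 ->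
  exists2 y, y \in U & form x y != 0.
Proof.
move=> U_nd xU x0; have [/forallP all0|] := boolP [forall i, form x (tnth (vbasis U) i) == 0].
  have/eqP[] := x0; apply: U_nd => // v vU; rewrite (coord_vbasis vU) linear_sumr big1 // => i _.
  by rewrite linearZr_LR /= -tnth_nth (eqP (all0 i)) mulr0.
by case/forallPn=> i xi; exists (tnth (vbasis U) i); rewrite ?vbasis_mem ?mem_tnth.
Qed.

Definition perp (x : V) : {vspace V} := lker (linfun (form x : V -> K^o)).

Lemma mem_perp x v : (v \in perp x) = (form x v == 0).
Proof. by rewrite memv_ker linfunE // => a u w; rewrite linearPr. Qed.

Lemma dim_perp (U : {vspace V}) x z : z \in U -> form x z != 0 -> (\dim (U :&: perp x)).+1 = \dim U.
Proof.
move=> zU xz; rewrite -(limg_ker_dim (linfun (form x : V -> K^o)) U) -addn1; congr (_ + _)%N.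
apply/eqP; rewrite eq_sym eqn_leq; apply/andP; split.
  by apply: leq_trans (dimvS (subvf _)) _; rewrite dimvf.
rewrite lt0n dimv_eq0; apply: contra xz => /eqP img0.
have := memv_img (linfun (form x : V -> K^o)) zU; rewrite img0 memv0 linfunE // => a u w.
by rewrite linearPr.
Qed.

(** Polarisation gives a vector that is not isotropic; its orthogonal complement is again
non-degenerate. *)
Lemma orthogonal_basis d (U : {vspace V}) : \dim U = d -> nondeg_on U ->
  {in U &, forall u v, form u v = form v u} ->
  exists s : seq V, [/\ size s = d, {subset s <= U} &
    forall i j, (i < d)%N -> (j < d)%N -> (form (nth 0 s i) (nth 0 s j) != 0) = (i == j)].
Proof.
elim: d U => [|d IHd] U dimU U_nd U_sym; first by exists [::].
have [x xU xx] : exists2 x, x \in U & form x x != 0.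
  have y0 : vpick U != 0 by rewrite vpick0 -dimv_eq0 dimU.
  have yU := memv_pick U; have [z zU yz] := nondeg_witness U_nd yU y0.
  have [yy|yy] := eqVneq (form (vpick U) (vpick U)) 0; last by exists (vpick U).
  have [zz|zz] := eqVneq (form z z) 0; last by exists z.
  exists (vpick U + z); first exact: memvD.
  rewrite linearDl !linearDr /= yy zz add0r addr0 (U_sym z) // -mulr2n mulrn_eq0 negb_or.
  exact: yz.
pose U' := (U :&: perp x)%VS.
have dimU' : \dim U' = d by apply/eqP; rewrite -eqSS (dim_perp xU xx) dimU.
have U'P v : v \in U' -> v \in U /\ form x v = 0.
  by rewrite memv_cap mem_perp => /andP[-> /eqP].
have U'_nd : nondeg_on U'.
  move=> u /U'P[uU xu] u0; apply: U_nd => // v vU.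
  pose a := form x v / form x x.
  have v'U : v - a *: x \in U'.
    rewrite memv_cap mem_perp memvB ?memvZ //= linearBr linearZr_LR /= /a divfK ?subrr //.
  rewrite -(subrK (a *: x) v) linearDr (u0 _ v'U) add0r linearZr_LR /= (U_sym u) // xu mulr0 //.
have U'_sym : {in U' &, forall u v, form u v = form v u}.
  by move=> u v /U'P[uU _] /U'P[vU _]; apply: U_sym.
have [s [size_s sU s_orth]] := IHd U' dimU' U'_nd U'_sym.
have nthP i : (i < d)%N -> nth 0 s i \in U /\ form x (nth 0 s i) = 0.
  by move=> lt_i; apply/U'P/sU/mem_nth; rewrite size_s.
exists (x :: s); split; first by rewrite /= size_s.
  by move=> v; rewrite inE => /orP[/eqP->//|/sU/U'P[]].
move=> [|i] [|j] //= lt_i lt_j.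
- by rewrite (nthP j _).2 ?eqxx.
- by have [iU xi] := nthP i lt_i; rewrite (U_sym _ x) // xi eqxx.
by rewrite s_orth.
Qed.

(** The orthogonal complement of a hyperbolic pair is again non-degenerate. The pairs occupy the
positions 2j and 2j + 1, so partners are described by [pcol]. *)
Lemma symplectic_basis d (U : {vspace V}) : \dim U = d.*2 -> nondeg_on U ->
  {in U &, forall u v, form u v = - form v u} ->
  exists s : seq V, [/\ size s = d.*2, {subset s <= U} &
    forall i j, (i < d.*2)%N -> (j < d.*2)%N ->
      (form (nth 0 s i) (nth 0 s j) != 0) = (j == pcol i)].
Proof.
elim: d U => [|d IHd] U dimU U_nd U_alt; first by exists [::].
have xU := memv_pick U; set x := vpick U in xU.
have x0 : x != 0 by rewrite vpick0 -dimv_eq0 dimU.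
have [y yU xy] := nondeg_witness U_nd xU x0.
have self0 z : z \in U -> form z z = 0.
  move=> zU; have /eqP := U_alt z z zU zU.
  by rewrite -subr_eq0 opprK -mulr2n mulrn_eq0 => /eqP.
have yx : form y x != 0 by rewrite (U_alt y x) // oppr_eq0.
pose U1 := (U :&: perp x)%VS; pose U' := (U1 :&: perp y)%VS.
have xU1 : x \in U1 by rewrite memv_cap xU mem_perp self0 ?eqxx.
have dimU' : \dim U' = d.*2.
  by apply/eqP; rewrite -eqSS (dim_perp xU1 yx) -eqSS (dim_perp yU xy) dimU.
have U'P v : v \in U' -> [/\ v \in U, form x v = 0 & form y v = 0].
  by rewrite !memv_cap !mem_perp => /andP[/andP[-> /eqP-> /eqP->]].
have U'_nd : nondeg_on U'.
  move=> u /U'P[uU xu yu] u0; apply: U_nd => // v vU.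
  pose a := form y v / form y x; pose b := form x v / form x y.
  have v'U : v - (a *: x + b *: y) \in U'.
    rewrite !memv_cap !mem_perp memvB ?memvD ?memvZ //= !linearBr !linearDr !linearZr_LR /=.
    by rewrite !self0 // !mulr0 add0r addr0 /a /b !divfK ?subrr ?eqxx.
  rewrite -(subrK (a *: x + b *: y) v) linearDr (u0 _ v'U) add0r linearDr !linearZr_LR /=.
  by rewrite (U_alt u x) // (U_alt u y) // xu yu oppr0 !mulr0 addr0.
have U'_alt : {in U' &, forall u v, form u v = - form v u}.
  by move=> u v /U'P[uU _ _] /U'P[vU _ _]; apply: U_alt.
have [s [size_s sU s_pair]] := IHd U' dimU' U'_nd U'_alt.
have nthP i : (i < d.*2)%N -> [/\ nth 0 s i \in U, form x (nth 0 s i) = 0 & form y (nth 0 s i) = 0].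
  by move=> lt_i; apply/U'P/sU/mem_nth; rewrite size_s.
exists (x :: y :: s); split; first by rewrite /= size_s.
  by move=> v; rewrite !inE => /or3P[/eqP->//|/eqP->//|/sU/U'P[]].
have pcolSS i : pcol i.+2 = (pcol i).+2 by rewrite /pcol /= negbK; case: i => [|i] //=; case: ifP.
move=> [|[|i]] [|[|j]] //= lt_i lt_j; rewrite ?pcolSS.
- by rewrite self0 ?eqxx.
- by have [_ -> _] := nthP j lt_j; rewrite eqxx.
- by rewrite self0 ?eqxx.
- by have [_ _ ->] := nthP j lt_j; rewrite eqxx.
- by have [iU xi _] := nthP i lt_i; rewrite (U_alt _ x) // xi oppr0 eqxx.
- by have [iU _ yi] := nthP i lt_i; rewrite (U_alt _ y) // yi oppr0 eqxx.
by rewrite s_pair.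
Qed.

Lemma nondeg_grade a : nondeg_on (vgrade V a).
Proof.
move=> u ua u0; apply: (@osp_form_nondeg _ _ _ V) => v.
have : v \in (vgrade V a + vgrade V (~~ a))%VS.
  by case: a {ua u0}; rewrite /vgrade /= ?[(odd_part V + _)%VS]addvC osp_total memvf.
case/memv_addP=> v1 v1a [v2 v2a ->]; rewrite linearDr (u0 _ v1a) add0r /=.
by apply: (osp_form_even ua v2a); case: (a).
Qed.

Lemma even_orthogonal_basis : exists s : seq V, [/\ size s = m, {subset s <= vgrade V false} &
  forall i j, (i < m)%N -> (j < m)%N -> (form (nth 0 s i) (nth 0 s j) != 0) = (i == j)].
Proof.
apply: (@orthogonal_basis m (vgrade V false)); first exact: osp_dim_even.
  exact: nondeg_grade.
by move=> u v uE vE; rewrite (osp_form_sym uE vE) mul1r.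
Qed.

Lemma odd_symplectic_basis : exists s : seq V, [/\ size s = n.*2, {subset s <= vgrade V true} &
  forall i j, (i < n.*2)%N -> (j < n.*2)%N -> (form (nth 0 s i) (nth 0 s j) != 0) = (j == pcol i)].
Proof.
apply: (@symplectic_basis n (vgrade V true)); first by rewrite -mul2n; apply: osp_dim_odd.
  exact: nondeg_grade.
by move=> u v uE vE; rewrite (osp_form_sym uE vE) mulN1r.
Qed.

End AdaptedBases.

(** * Non-vanishing for shapes inside the hook *)

Section StabilisedWord.
Variables (K : numClosedFieldType) (m n : nat) (V : osp_space K m n).
Variable (F : forall k l, 'Hom(bspace K k l, 'Hom(tpow V k, tpow V l))).
Hypotheses (FF : brauer_functor F) (V_neq0 : (0 < sdimn V)%N).
Local Notation Fp := (perm_op F).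

(** The permutation is a product of transpositions of equal factors of parity b, each contributing
the sign (-1)^b by [swap_same]. *)
Lemma perm_op_stab N (v : 'I_N -> V) p (b : bool) (s : {perm 'I_N}) : homog v p ->
  (forall a, s a != a -> p a = b) -> (forall a, v (s a) = v a) ->
  Fp s (ptens v) = (if b then psign K s else 1) *: ptens v.
Proof.
move=> vp; have [d] := ubnP #|[set a | s a != a]|; elim: d s => // d IHd s lt_d s_b s_v.
have [none|/set0Pn[a]] := eqVneq [set a | s a != a] set0.
  have -> : s = 1%g.
    apply/permP=> a; rewrite perm1; apply/eqP; apply: contraT => sa.
    by have := in_set0 a; rewrite -none inE sa.
  by rewrite (perm_op1 FF V_neq0) id_lfunE /psign odd_perm1 if_same scale1r.
rewrite inE => sa; pose s' := (s * tperm a (s a))%g.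
have ssa : s (s a) != s a by rewrite (inj_eq perm_inj).
have v_t x : v (tperm a (s a) x) = v x by case: tpermP => [->|->|//]; rewrite s_v.
have moved x : s' x != x -> s x != x /\ x != a.
  rewrite permM; have [->|x_a] := eqVneq x a; first by rewrite tpermR eqxx.
  move=> s'x; split=> //; apply: contra s'x => /eqP sx.
  have sa_x : s a != x by apply: contraNneq ssa => e; rewrite e sx.
  by rewrite sx tpermD // eq_sym.
have s'_v x : v (s' x) = v x by rewrite permM v_t s_v.
have sE : s = (s' * tperm a (s a))%g by rewrite -mulgA tperm2 mulg1.
have lt' : (#|[set x | s' x != x]| < d)%N.
  rewrite ltnS in lt_d; apply: leq_trans lt_d; apply/proper_card/properP; split.
    by apply/subsetP=> x; rewrite !inE => /moved[].
  by exists a; rewrite inE // permM tpermR eqxx.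
have IH := IHd s' lt' (fun x s'x => s_b x (moved x s'x).1) s'_v.
have a_sa : a != s a by rewrite eq_sym.
rewrite {1}sE (perm_opM FF) comp_lfunE IH linearZ /= (swap_same FF V_neq0 a_sa vp); last by rewrite !s_b.
have -> : ptens (fun i => v (tperm a (s a) i)) = ptens v by apply: eq_ptens.
rewrite scalerA s_b //; congr (_ *: _); rewrite [in RHS]sE psignM /psign odd_tperm a_sa.
by case: b {IH s_b IHd}; rewrite ?mulr1.
Qed.

Section HookShape.
Variable r : nat.
Local Notation N := r.*2.
Local Notation to := (@mact_action 'I_N).
Local Notation d0 := (unit_vec K (M0 r)).
Variable la : seq nat.
Hypotheses (la_part : is_partition N la) (la_even : all (fun i => ~~ odd i) la).
Hypothesis la_hook : (nth 0 la m <= n.*2)%N.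
Variables (ev od : seq V).
Hypotheses (ev_in : forall i, (i < m)%N -> nth 0 ev i \in vgrade V false)
  (od_in : forall i, (i < n.*2)%N -> nth 0 od i \in vgrade V true)
  (ev_form : forall i j, (i < m)%N -> (j < m)%N ->
     (osp_form V (nth 0 ev i) (nth 0 ev j) != 0) = (i == j))
  (od_form : forall i j, (i < n.*2)%N -> (j < n.*2)%N ->
     (osp_form V (nth 0 od i) (nth 0 od j) != 0) = (j == pcol i)).

Local Notation rw := (@trow N la).
Local Notation cl := (@tcol N la).
Local Notation R := (level_stab_gp rw).
Local Notation C := (level_stab_gp cl).

(** In the first m rows the factors are even and constant along the rows; below, they are odd and
constant along the columns, of which there are at most 2n. *)
Definition test_word (a : 'I_N) : V := if (rw a < m)%N then nth 0 ev (rw a) else nth 0 od (cl a).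
Definition test_par (a : 'I_N) : bool := (m <= rw a)%N.
Local Notation v := test_word.

Lemma low_col a : (m <= rw a)%N -> (cl a < n.*2)%N.
Proof.
move=> le_m; apply: leq_trans (tcol_lt la_part a) (leq_trans _ la_hook).
exact: nth_part_anti la_part _ _ le_m.
Qed.

Lemma test_homog : homog v test_par.
Proof.
move=> a; rewrite /test_word /test_par; case: (ltnP (rw a) m) => [lt_m|le_m]; first exact: ev_in.
exact/od_in/low_col.
Qed.

(** Factors that pair non-trivially lie in the same row if it is one of the first m rows, and
otherwise in partner columns below; so for a matching reached from [M0] by column permutations a
non-zero value forces the first m rows to be matched as in [M0]. *)
Lemma test_form a b : osp_form V (v a) (v b) != 0 ->
  if (rw a < m)%N then rw b = rw a else (m <= rw b)%N /\ cl b = pcol (cl a).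
Proof.
move=> nz; have eq_par : test_par a = test_par b.
  have [//|neq] := eqVneq (test_par a) (test_par b).
  by rewrite (osp_form_even (test_homog a) (test_homog b) neq) eqxx in nz.
move: eq_par nz; rewrite /test_par /test_word; case: (ltnP (rw a) m) => lt_a; case: (ltnP (rw b) m) => lt_b //= _.
  by rewrite ev_form // => /eqP.
by rewrite od_form ?low_col // => /eqP.
Qed.

Lemma test_form_M0 a : osp_form V (v a) (v (M0 r a)) != 0.
Proof.
have [rM cM] := M0_coords la_part la_even a; rewrite /test_word rM cM.
case: (ltnP (rw a) m) => lt_a; first by rewrite ev_form ?eqxx.
rewrite od_form ?eqxx ?low_col // -cM low_col // rM //.
Qed.

(** The zeroth tensor power is a line; its unique coordinate is read at the unique index. *)
Definition eval (D : matching 'I_N) : K := diag_op F (capped D) (ptens v) [ffun=> Ordinal V_neq0].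

Lemma eval_cap_form z : cap_form F z (ptens v) [ffun=> Ordinal V_neq0] = \sum_D z D * eval D.
Proof.
by rewrite /cap_form sum_lfunE sum_ffunE; apply: eq_bigr => D _; rewrite scale_lfunE ffunE.
Qed.

Lemma capped_M0 : capped (M0 r) = Ahat r.
Proof. by apply: eq_matching => -[x|[]] //; rewrite cappedE M0E ffunE. Qed.

Lemma odn_M0 (i : 'I_r) : odn i = M0 r (evn i).
Proof. by rewrite M0E; apply/val_inj; rewrite /= odd_double. Qed.

Lemma evalM s D : eval (mact D s) = diag_op F (capped D) (Fp s^-1%g (ptens v)) [ffun=> Ordinal V_neq0].
Proof. by rewrite /eval (diag_op_capped_mact FF) comp_lfunE. Qed.

Lemma eval_M0 : eval (M0 r) != 0.
Proof.
rewrite /eval capped_M0 (diag_op_Ahat FF V_neq0) !ffunE mulf_neq0 ?oner_eq0 //.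
by apply/prodf_neq0 => i _; rewrite odn_M0 test_form_M0.
Qed.

(** Up to sign the value is the product of the forms along the edges of the matching. *)
Lemma eval_neq0 s a :
  eval (mact (M0 r) s) != 0 -> osp_form V (v a) (v (mact (M0 r) s a)) != 0.
Proof.
rewrite mactE evalM; have [sg sgP] := signed_perm_all FF V_neq0 (s^-1)%g.
rewrite (sgP _ _ test_homog) linearZ /= capped_M0 (diag_op_Ahat FF V_neq0) ffunE [(_ *: tscal _ _) _]ffunE.
rewrite mulf_eq0 negb_or => /andP[_]; rewrite mulf_eq0 negb_or => /andP[+ _].
set b := (s^-1)%g a; move/prodf_neq0=> nz.
have nz_i i : osp_form V (v (s (evn i))) (v (s (M0 r (evn i)))) != 0.
  by have := nz i isT; rewrite invgK odn_M0.
have aE : a = s b by rewrite permKV.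
have [i [bE|bE]] : exists i, b = evn i \/ b = odn i.
  rewrite -(unlabelK b); case: (unlabel b) => i; exists i; [by right | by left].
  by rewrite {1}aE bE nz_i.
rewrite {1}aE bE odn_M0 (partnerK (M0 r)); have := nz_i i.
by rewrite (osp_form_sym (test_homog _) (test_homog _)) mulf_eq0 negb_or => /andP[].
Qed.

(** Permuting equal odd factors produces the sign of the permutation. *)
Lemma eval_odd (c : {perm 'I_N}) D : (forall a, c a != a -> (m <= rw a)%N) -> (forall a, cl (c a) = cl a) ->
  (forall a, (m <= rw (c a))%N = (m <= rw a)%N) ->
  eval (mact D c) = psign K c * eval D.
Proof.
move=> c_low c_col c_row; pose c' := (c^-1)%g.
have cc' a : c (c' a) = a by rewrite permKV.
have low' a : c' a != a -> test_par a = true.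
  move=> moved; have := c_low (c' a); rewrite cc' eq_sym => /(_ moved).
  by rewrite -c_row cc'.
have v' a : v (c' a) = v a.
  have [->//|moved] := eqVneq (c' a) a; have := low' _ moved; rewrite /test_par => low_a.
  have low_ca : (m <= rw (c' a))%N by rewrite -c_row cc'.
  by rewrite /test_word !ltnNge low_a low_ca /= -(c_col (c' a)) cc'.
by rewrite evalM -/c' (perm_op_stab test_homog low' v') linearZ ffunE /= /psign odd_permV.
Qed.

(** Permuting equal even factors changes nothing. *)
Lemma eval_even (s : {perm 'I_N}) D : (forall a, s a != a -> (rw a < m)%N) -> (forall a, rw (s a) = rw a) ->
  eval (mact D s) = eval D.
Proof.
move=> s_up s_row; pose s' := (s^-1)%g.
have ss' a : s (s' a) = a by rewrite permKV.
have row' a : rw (s' a) = rw a by rewrite -{2}(ss' a) s_row.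
have up' a : s' a != a -> test_par a = false.
  move=> moved; have := s_up (s' a); rewrite ss' eq_sym => /(_ moved).
  by rewrite row' /test_par => lt; rewrite leqNgt lt.
have v' a : v (s' a) = v a.
  have [->//|moved] := eqVneq (s' a) a; have := up' _ moved; rewrite /test_par leqNgt => /negbFE lt.
  by rewrite /test_word row' lt.
by rewrite evalM -/s' (perm_op_stab test_homog up' v') scale1r.
Qed.

(** On matchings reached from [M0] by column permutations followed by permutations of the lower
rows, these are the ones on which [eval] is not zero ([eval_low_neq0]). *)
Definition good (D : matching 'I_N) : bool :=
  [forall a, if (rw a < m)%N then D a == M0 r a else cl (D a) == pcol (cl a)].

Lemma good_up D a : good D -> (rw a < m)%N -> D a = M0 r a.
Proof. by move/forallP/(_ a)=> + lt_a; rewrite lt_a => /eqP. Qed.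

Lemma good_col D : good D -> col_paired la D.
Proof.
move=> Dg a; case: (ltnP (rw a) m) => lt_a.
  by rewrite (good_up Dg lt_a) (M0_coords la_part la_even a).2.
by move/forallP/(_ a): Dg; rewrite ltnNge lt_a => /eqP.
Qed.

Lemma good_low D a : good D -> (m <= rw (D a))%N = (m <= rw a)%N.
Proof.
have M0_row b := (M0_coords la_part la_even b).1.
move=> Dg; have lt_eq : (rw (D a) < m)%N = (rw a < m)%N.
  apply/idP/idP => lt; last by rewrite good_up ?M0_row.
  by have := good_up Dg lt; rewrite partnerK => ->; rewrite M0_row.
by rewrite leqNgt lt_eq -leqNgt.
Qed.

Lemma pcolK c : pcol (pcol c) = c.
Proof. by rewrite {1}/pcol odd_pcol /pcol; case E: (odd c); case: c E. Qed.

(** It is enough to permute, below the first m rows, the entries of the odd columns: send each of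
them to the new partner of its former neighbour. *)
Lemma good_perm D : good D -> exists c, [/\ c \in C, forall a, c a != a -> (m <= rw a)%N,
  forall a, (m <= rw (c a))%N = (m <= rw a)%N & mact (M0 r) c = D].
Proof.
move=> Dg; have D_col := good_col Dg; have M0c a := (M0_coords la_part la_even a).
(* Only odd columns move, so that each edge of [M0] has one moving end. *)
pose f a := if (m <= rw a)%N && odd (cl a) then D (M0 r a) else a.
have f_col a : cl (f a) = cl a.
  by rewrite /f; case: ifP => // _; rewrite D_col (M0c a).2 pcolK.
have f_low a : (m <= rw (f a))%N = (m <= rw a)%N.
  by rewrite /f; case: ifP => // _; rewrite good_low // (M0c a).1.
have f_inj : injective f.
  move=> a b eq_f; have eq_c : cl a = cl b by rewrite -f_col eq_f f_col.
  have eq_l : (m <= rw a)%N = (m <= rw b)%N by rewrite -f_low eq_f f_low.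
  move: eq_f; rewrite /f eq_l eq_c; case: ifP => // _.
  by move/(can_inj (partnerK D))/(can_inj (partnerK (M0 r))).
pose c := perm f_inj; have cE a : c a = f a by rewrite permE.
exists c; split.
- by apply/level_stabP=> a; rewrite cE f_col.
- by move=> a; rewrite cE /f; case: ifP => [/andP[]|]; rewrite ?eqxx.
- by move=> a; rewrite cE.
have comm a : c (M0 r a) = D (c a).
  rewrite !cE /f (M0c a).1 (M0c a).2 odd_pcol.
  case: (leqP m (rw a)) => lt_a /=; last by rewrite good_up.
  by case: (odd (cl a)); rewrite /= ?(partnerK D) ?(partnerK (M0 r)).
by apply: eq_matching => a; rewrite mactE comm permKV.
Qed.

Lemma col_sign_eq c1 c2 : c1 \in C -> c2 \in C -> mact (M0 r) c1 = mact (M0 r) c2 ->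
  psign K c1 = psign K c2.
Proof.
move=> c1C c2C eq_act.
have cC : (c1 * c2^-1)%g \in C by rewrite groupM ?groupV.
have fixed : mact (M0 r) (c1 * c2^-1)%g = M0 r.
  by rewrite -[LHS]/(to (M0 r) _) actM /= eq_act -[LHS]/(to (to (M0 r) c2) _) -actM mulgV act1.
have := col_stab_even la_part la_even cC fixed; rewrite odd_permM odd_permV /psign.
by case: (odd_perm c1) (odd_perm c2) => -[].
Qed.

(** Equals [eval] divided by its value at [M0] on good matchings ([eval_good]); it is well defined
because column permutations fixing [M0] are even. *)
Definition hsign (D : matching 'I_N) : K :=
  if good D then (if [pick c in C | mact (M0 r) c == D] is Some c then psign K c else 0) else 0.

Lemma hsign_good c : c \in C -> good (mact (M0 r) c) -> hsign (mact (M0 r) c) = psign K c.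
Proof.
move=> cC gc; rewrite /hsign gc; case: pickP => [c' /andP[c'C /eqP]|/(_ c)]; first exact: col_sign_eq.
by rewrite cC eqxx.
Qed.

Lemma eval_good D : good D -> eval D = hsign D * eval (M0 r).
Proof.
move=> gD; have [c [cC c_low c_row cD]] := good_perm gD; move: (gD); rewrite -cD => gc.
rewrite hsign_good // eval_odd //; exact/level_stabP.
Qed.

Lemma hsign_real D : (hsign D)^* = hsign D.
Proof. by rewrite /hsign; case: ifP => _; [case: pickP => *; rewrite ?psign_real ?rmorph0 | rewrite rmorph0]. Qed.

Definition Lo : {set 'I_N} := [set a | m <= rw a]%N.
(** The part of s below the first m rows. By [lowP] the remaining part of a row permutation does
not affect [eval]. *)
Definition low (s : {perm 'I_N}) : {perm 'I_N} := restr_perm Lo s.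

Lemma lowP s : s \in R -> [/\ {in Lo, low s =1 s}, forall a, a \notin Lo -> low s a = a,
  low s \in R & forall D, eval (mact D s) = eval (mact D (low s))].
Proof.
move=> sR; have row_s : forall a, rw (s a) = rw a by apply/level_stabP.
have sLo a : (s a \in Lo) = (a \in Lo) by rewrite !inE row_s.
have sUp a : (s a \in ~: Lo) = (a \in ~: Lo) by rewrite !inE row_s.
have [in_s out_s sE] := restr_split sLo; have [in_u out_u _] := restr_split sUp.
have lowR : low s \in R.
  apply/level_stabP=> a; case: (boolP (a \in Lo)) => aL; last by rewrite /low out_s.
  by rewrite /low in_s // row_s.
split=> // D; rewrite {1}sE -[mact D _]/(to D _) actM /=; apply: eval_even => a.
  by rewrite ltnNge; apply: contra => aL; apply/eqP/out_u; rewrite !inE negbK.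
case: (boolP (a \in ~: Lo)) => aL; last by rewrite out_u.
by rewrite in_u // row_s.
Qed.

Lemma lowM s t : s \in R -> t \in R -> low (s * t)%g = (low s * low t)%g.
Proof.
move=> sR tR; have [in_s out_s _ _] := lowP sR; have [in_t out_t _ _] := lowP tR.
have [in_st out_st _ _] := lowP (groupM sR tR); apply/permP=> a; rewrite permM.
case: (boolP (a \in Lo)) => aL; last by rewrite out_st // out_s // out_t.
have row_s : forall a, rw (s a) = rw a by apply/level_stabP.
have saL : s a \in Lo by move: aL; rewrite !inE row_s.
by rewrite in_st // in_s // in_t // permM.
Qed.

Lemma low1 : low 1%g = 1%g.
Proof.
have [in_1 out_1 _ _] := lowP (group1 R); apply/permP=> a.
by case: (boolP (a \in Lo)) => aL; [rewrite in_1 | rewrite out_1 // perm1].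
Qed.

Lemma lowV s : s \in R -> low (s^-1)%g = ((low s)^-1)%g.
Proof.
move=> sR; apply: (mulgI (low s)); rewrite -lowM ?groupV //.
by rewrite !mulgV low1.
Qed.

(** In the first m rows a non-zero value forces the edges to stay in their rows, where the column
pairing inherited from [M0] leaves no other possibility than [M0]; and these rows are not touched
by the lower part of s. *)
Lemma eval_low_neq0 s c : s \in R -> c \in C -> eval (mact (mact (M0 r) c) (low s)) != 0 ->
  good (mact (M0 r) c) /\ good (mact (mact (M0 r) c) (low s)).
Proof.
move=> sR cC; have [in_s out_s _ _] := lowP sR.
set D1 := mact (M0 r) c; set D := mact D1 (low s).
have DE : D = mact (M0 r) (c * low s)%g.
  by rewrite /D /D1 -[mact (mact _ _) _]/(to (to (M0 r) c) (low s)) -actM.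
rewrite DE => nz; have form_D a := test_form (eval_neq0 a nz); rewrite -DE in form_D *.
have D1_col : col_paired la D1 by apply: col_paired_M0.
have up_notin a : (rw a < m)%N -> a \notin Lo by rewrite inE -ltnNge.
have D1_up a : (rw a < m)%N -> D1 a = M0 r a /\ D a = M0 r a.
  move=> lt_a; have rowD : rw (D a) = rw a by have := form_D a; rewrite lt_a.
  have D1E : D1 a = D a.
    apply: (@perm_inj _ (low s)); rewrite (out_s (D a)); last by apply: up_notin; rewrite rowD.
    rewrite /D mactE; congr (low s (D1 _)); apply: esym; apply: (canLR (permK _)).
    by rewrite out_s // up_notin.
  suff D1M : D1 a = M0 r a by rewrite -D1E.
  by apply: (tcoords_inj la_part); rewrite ?D1_col ?D1E ?rowD ?(M0_coords la_part la_even a).1 ?(M0_coords la_part la_even a).2.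
split; apply/forallP=> a; case: ifP => lt_a.
- by rewrite (D1_up a lt_a).1.
- by rewrite D1_col.
- by rewrite (D1_up a lt_a).2.
by have := form_D a; rewrite lt_a => -[_ ->].
Qed.

Definition low_sum (f : {ffun matching 'I_N -> K^o}) : {ffun matching 'I_N -> K^o} :=
  \sum_(s in R) pact to (low s) f.
Definition hvec : {ffun matching 'I_N -> K^o} := [ffun D => hsign D].

(** [low] is a morphism on the row stabiliser, so the sum is self-adjoint and its square is a
multiple of it. *)
Lemma herm_low_sum f : herm (low_sum f) (low_sum f) = #|R|%:R * herm f (low_sum f).
Proof.
rewrite {1}/low_sum herm_suml -sumr_const mulr_suml; apply: eq_bigr => s sR.
rewrite mul1r herm_pact; congr herm; rewrite /low_sum linear_sum /=.
rewrite [RHS](reindex_inj (mulIg (s^-1)%g)) /=; apply: eq_big => [t|t tR].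
  by rewrite groupMr ?groupV.
by rewrite -pactM lowM ?groupV // lowV.
Qed.

(** At [M0] the good matchings that contribute are obtained from [M0] by row permutations and
respect the column pairing, so they are all equal to [M0] and contribute 1. *)
Lemma low_sum_hvec_neq0 : low_sum hvec != 0.
Proof.
suff [k [k_gt0 kE]] : exists k : nat, (0 < k)%N /\ low_sum hvec (M0 r) = k%:R.
  by apply/eqP=> E; move/eqP: kE; rewrite E ffunE eq_sym pnatr_eq0 -leqn0 leqNgt k_gt0.
exists (\sum_(s in R) (mact (M0 r) (low s)^-1%g == M0 r))%N; split.
  rewrite (bigD1 1%g (group1 (level_stab_gp _))) /= low1 invg1.
  by rewrite -[mact (M0 r) 1%g]/(to (M0 r) 1%g) act1 eqxx.
rewrite /low_sum sum_ffunE natr_sum; apply: eq_bigr => s sR; rewrite !ffunE /=.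
have goodM0 : good (M0 r).
  by apply/forallP=> a; rewrite eqxx; case: ifP => // _; rewrite (M0_coords la_part la_even a).2.
have h1 : hsign (M0 r) = 1.
  have M01 : mact (M0 r) 1%g = M0 r by rewrite -[LHS]/(to (M0 r) 1%g) act1.
  by rewrite -M01 hsign_good ?group1 ?M01 // /psign odd_perm1.
case: eqP => [->|neq]; first by rewrite h1.
rewrite /hsign; case: ifP => // gD; case: neq.
have [_ _ lowR _] := lowP sR.
apply: (paired_eq_M0 la_part la_even _ (good_col gD)).
by apply: row_paired_act; [apply: groupVr | apply: row_paired_M0].
Qed.

(** The column permutations leading to one matching form a coset of those fixing [M0]. *)
Lemma casym_good D : good D -> casym to la d0 D =
  (\sum_(c in C) (mact (M0 r) c == M0 r))%N%:R * hsign D.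
Proof.
move=> gD; have [k [kC _ _ kD]] := good_perm gD.
have -> : casym to la d0 D = \sum_(c in C) (mact (M0 r) c == D)%:R * hsign D.
  rewrite /casym /psum sum_ffunE; apply: eq_bigr => c cC.
  rewrite pact_unit_vec !ffunE /= eq_sym; case: eqP => [cD|_]; last by rewrite mul0r; apply: mulr0.
  by rewrite mul1r -cD hsign_good ?cD //; apply: mulr1.
rewrite -mulr_suml natr_sum; congr (_ * _); rewrite [LHS](reindex_inj (mulIg k)) /=.
apply: eq_big => [c|c cC]; first by rewrite groupMr.
congr (_%:R); congr (nat_of_bool _); rewrite -kD -[mact _ (c * k)%g]/(to (M0 r) (c * k)%g) actM /=.
by apply/eqP/eqP => [|->//]; apply: (act_inj to k).
Qed.

(** The value at [test_word] is the sum over row permutations s and matchings D of the coefficient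
of D in c_la d0 times the value of s D. Both factors are multiples of [hsign] whenever they do not
vanish, and only the lower part of s matters, so that the sum is a positive multiple of [eval] at
[M0] times the product of [hvec] with [low_sum], that is, of the square norm of [low_sum]. *)
Theorem cap_form_rsym_casym_neq0 : cap_form F (rsym to la (casym to la d0)) != 0.
Proof.
pose stab := (\sum_(c in C) (mact (M0 r) c == M0 r))%N.
have stab_gt0 : (0 < stab)%N.
  rewrite /stab (bigD1 1%g (group1 (level_stab_gp _))) /=.
  by rewrite -[mact (M0 r) 1%g]/(to (M0 r) 1%g) act1 eqxx.
have casym_supp D : casym to la d0 D != 0 -> exists2 c, c \in C & mact (M0 r) c = D.
  rewrite /casym /psum sum_ffunE => nz.
  have [c cC] : exists2 c, c \in C & (psign K c *: pact to c d0) D != 0.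
    apply/exists_inP; apply: contraNT nz => /exists_inPn none; apply/eqP.
    by apply: big1 => c /none; rewrite negbK => /eqP.
  rewrite pact_unit_vec !ffunE; have [cD _|ne] := eqVneq (mact (M0 r) c) D; first by exists c.
  by rewrite [_ *: _]mulr0 eqxx.
pose S := \sum_D rsym to la (casym to la d0) D * eval D.
suff S_neq0 : S != 0.
  by apply: contra S_neq0 => /eqP cf0; rewrite /S -eval_cap_form cf0 zero_lfunE ffunE.
have SE : S = (stab%:R * eval (M0 r)) * herm hvec (low_sum hvec).
  transitivity (\sum_(s in R) \sum_D casym to la d0 D * eval (mact D s)).
    rewrite /S exchange_big /=; rewrite /rsym /psum.
    transitivity (\sum_D \sum_(s in R) casym to la d0 (to D s^-1%g) * eval D).
      apply: eq_bigr => D _; rewrite sum_ffunE mulr_suml; apply: eq_bigr => s _.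
      by rewrite /ptriv scale1r ffunE.
    rewrite exchange_big [RHS]exchange_big /=; apply: eq_bigr => s sR.
    by rewrite (reindex_inj (act_inj to s)) /=; apply: eq_bigr => D _; rewrite -[mact D s]/(to D s) actK.
  rewrite /low_sum herm_sumr mulr_sumr [RHS](reindex_inj invg_inj) /=.
  apply: eq_big => [s|s sR]; first by rewrite groupV.
  rewrite /herm mulr_sumr; apply: eq_bigr => D _; have [_ _ _ ->] := lowP sR.
  rewrite lowV // !ffunE invgK hsign_real /=.
  have [c0|/casym_supp[c cC cD]] := eqVneq (casym to la d0 D) 0.
    rewrite c0 mul0r; case: (boolP (good D)) => [gD|/negPf gD]; last by rewrite {1}/hsign gD mul0r mulr0.
    move: c0; rewrite casym_good // -/stab => /eqP; rewrite mulf_eq0 pnatr_eq0 -leqn0 leqNgt stab_gt0 /=.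
    by move/eqP->; rewrite mul0r mulr0.
  have [e0|nz] := eqVneq (eval (mact D (low s))) 0.
    rewrite e0 mulr0; case: (boolP (good (mact D (low s)))) => [gD|/negPf gD].
      move/eqP: e0; rewrite eval_good // mulf_eq0 (negPf eval_M0) orbF => /eqP->.
      by rewrite !mulr0.
    by rewrite [hsign (mact _ _)]/hsign gD !mulr0.
  rewrite -cD in nz *; have [g1 g2] := eval_low_neq0 sR cC nz.
  rewrite casym_good // -/stab (eval_good g2).
  by rewrite [hsign (mact (mact _ _) _) * _]mulrC mulrACA.
rewrite SE !mulf_neq0 ?eval_M0 ?pnatr_eq0 -?lt0n //.
apply: contra low_sum_hvec_neq0 => /eqP E; apply/eqP/herm_eq0.
by rewrite herm_low_sum E mulr0.
Qed.

End HookShape.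
End StabilisedWord.

(** * The basis of the kernel *)

Section Bilinearity.
Variables (K : fieldType) (delta : K) (k l p : nat).

Lemma bcomp_linearl (y : bspace K k l) : linear (fun x : bspace K l p => bcomp delta x y).
Proof.
move=> a x x'; rewrite /bcomp scaler_sumr -big_split; apply: eq_bigr => D1 _ /=.
rewrite scaler_sumr -big_split; apply: eq_bigr => D2 _ /=.
by rewrite !ffunE !mulrDl scalerDl scalerA !mulrA.
Qed.

Lemma bcomp_linearr (x : bspace K l p) : linear (fun y : bspace K k l => bcomp delta x y).
Proof.
move=> a y y'; rewrite /bcomp scaler_sumr -big_split; apply: eq_bigr => D1 _ /=.
rewrite scaler_sumr -big_split; apply: eq_bigr => D2 _ /=.
rewrite !ffunE mulrDr mulrDl scalerDl scalerA; congr (_ *: _ + _).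
by rewrite [_ *: _ in LHS]/GRing.scale /= mulrCA !mulrA.
Qed.

Lemma lin_ext_linear k' l' (h : brauer k l -> brauer k' l') : linear (@lin_ext K k l k' l' h).
Proof.
move=> a x y; rewrite /lin_ext scaler_sumr -big_split; apply: eq_bigr => D _ /=.
by rewrite !ffunE scalerDl scalerA.
Qed.

Lemma lin_ext_bvec k' l' (h : brauer k l -> brauer k' l') D : lin_ext h (bvec K D) = bvec K (h D).
Proof.
rewrite /lin_ext (bigD1 D) //= big1 ?addr0 => [|E /negPf E_D]; rewrite ffunE.
  by rewrite eqxx scale1r.
by rewrite E_D scale0r.
Qed.

(** For maps that are linear as functions of one argument only, without a canonical structure. *)
Lemma linear_sumE (U W : lmodType K) (f : U -> W) (I : finType) (P : pred I) (c : I -> K) (E : I -> U) :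
  linear f -> f (\sum_(i | P i) c i *: E i) = \sum_(i | P i) c i *: f (E i).
Proof.
move=> f_lin; have f0 : f 0 = 0 by have := f_lin (-1) 0 0; rewrite scaler0 addr0 scaleN1r addNr.
elim/big_rec2: _ => // i w u _ <-; exact: f_lin.
Qed.

End Bilinearity.

Section PhiVector.
Variables (K : numClosedFieldType) (delta : K) (r : nat).
Local Notation N := r.*2.
Local Notation to := (@mact_action 'I_N).

Lemma bcomp_perm (s t : {perm 'I_N}) :
  bcomp delta (bvec K (perm_diag s)) (bvec K (perm_diag t)) = bvec K (perm_diag (t * s)%g).
Proof.
rewrite (perm_diag_bij t) bcomp_bij; congr bvec; apply: eq_matching => -[x|x].
  by rewrite !ffunE /= permM.
by rewrite !ffunE /= invMg permM.
Qed.

Lemma bcomp_capped_perm (D : matching 'I_N) (s : {perm 'I_N}) :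
  bcomp delta (bvec K (capped D)) (bvec K (perm_diag s)) = bvec K (capped (mact D (s^-1)%g)).
Proof.
rewrite perm_diag_bij bcomp_bij; congr bvec; apply: eq_matching => -[x|[]] //.
by rewrite cappedE mactE [LHS]ffunE /push cappedE /= invgK.
Qed.

Lemma unbend_capped (D : matching 'I_N) : unbend (capped D) = unfold_matching D.
Proof. by apply: eq_matching => x; rewrite unfold_matchingE ffunE /= cappedE. Qed.

Lemma sym_diag_unfold (s : {perm 'I_N}) (D : matching 'I_N) :
  sym_diag s (unfold_matching D) = unfold_matching (mact D s).
Proof.
by apply: eq_matching => x; rewrite unfold_matchingE mactE [LHS]ffunE unfold_matchingE !unlabelK.
Qed.

Lemma sym_act_unfold (s : {perm 'I_N}) (z : {ffun matching 'I_N -> K^o}) :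
  sym_act s (unfold_vec z) = unfold_vec (pact to s z).
Proof.
rewrite /sym_act /unfold_vec (linear_sumE _ _ _ (@lin_ext_linear _ _ _ _ _ _)).
rewrite [RHS](reindex_inj (act_inj to s)); apply: eq_bigr => D _ /=.
rewrite lin_ext_bvec sym_diag_unfold ffunE /=.
by rewrite -[mact (mact D s) _]/(to (to D s) (s^-1)%g) actK.
Qed.

Lemma unfold_unit_vec (D : matching 'I_N) : unfold_vec (unit_vec K D) = bvec K (unfold_matching D).
Proof.
rewrite /unfold_vec (bigD1 D) //= big1 ?addr0 => [|E /negPf E_D]; rewrite ffunE.
  by rewrite eqxx scale1r.
by rewrite E_D scale0r.
Qed.

(** Composing the caps with a permutation s permutes their feet by the inverse of s, so the
product of the sums over rows and columns is expanded and both summation indices are inverted. *)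
Lemma Phi_unfold la : Phi delta r la = unfold_vec (uvec K r la).
Proof.
pose R := level_stab_gp (@trow N la); pose C := level_stab_gp (@tcol N la).
have x_E : x_elt N K la = \sum_(s in R) 1 *: bvec K (perm_diag s).
  by apply: eq_bigr => s _; rewrite scale1r.
have y_E : y_elt N K la = \sum_(t in C) psign K t *: bvec K (perm_diag t) by [].
have c_E : c_elt delta N la = \sum_(s in R) 1 *: \sum_(t in C) psign K t *: bvec K (perm_diag (t * s)%g).
  rewrite /c_elt x_E (linear_sumE _ _ _ (bcomp_linearl delta _)); apply: eq_bigr => s _.
  rewrite y_E (linear_sumE _ _ _ (bcomp_linearr delta _)); congr (_ *: _).
  by apply: eq_bigr => t _; rewrite bcomp_perm.
have Phi_E : Phi delta r la = \sum_(s in R) \sum_(t in C)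
    psign K t *: bvec K (unfold_matching (mact (mact (M0 r) (s^-1)%g) (t^-1)%g)).
  rewrite /Phi c_E (linear_sumE _ _ _ (bcomp_linearr delta _)).
  rewrite /U_map (linear_sumE _ _ _ (@lin_ext_linear _ _ _ _ _ _)).
  apply: eq_bigr => s _; rewrite scale1r (linear_sumE _ _ _ (bcomp_linearr delta _)).
  rewrite (linear_sumE _ _ _ (@lin_ext_linear _ _ _ _ _ _)); apply: eq_bigr => t _.
  rewrite -capped_M0 bcomp_capped_perm lin_ext_bvec unbend_capped invMg.
  by rewrite -[mact _ (_ * _)%g]/(to (M0 r) _) actM.
rewrite Phi_E exchange_big (reindex_inj invg_inj) /uvec /casym /psum [RHS]linear_sum.
apply: eq_big => [t|t tC]; first by rewrite groupV.
rewrite (reindex_inj invg_inj) /= /rsym /psum linear_sum scaler_sumr [RHS]linear_sum.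
apply: eq_big => [s|s sR]; first by rewrite groupV.
rewrite /ptriv scale1r [RHS]linearZ /= !pact_unit_vec unfold_unit_vec !invgK.
by rewrite /psign odd_permV.
Qed.

Definition fold_matching (E : brauer r r) : matching 'I_N := relabel (@labelK r) (@unlabelK r) E.

Lemma fold_matchingK : cancel fold_matching (@unfold_matching r).
Proof. by move=> E; apply: eq_matching => x; rewrite unfold_matchingE ffunE !labelK. Qed.

Lemma unfold_matchingK : cancel (@unfold_matching r) fold_matching.
Proof. by move=> D; apply: eq_matching => x; rewrite ffunE unfold_matchingE !unlabelK. Qed.

Lemma unfold_vecE (z : {ffun matching 'I_N -> K^o}) (E : brauer r r) :
  unfold_vec z E = z (fold_matching E).
Proof.
rewrite /unfold_vec sum_ffunE (bigD1 (fold_matching E)) //= big1 ?addr0 => [|D D_E].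
  by rewrite !ffunE fold_matchingK eqxx; apply: mulr1.
rewrite !ffunE (_ : (_ == _) = false); first exact: mulr0.
by apply: contraNF D_E => /eqP->; rewrite unfold_matchingK.
Qed.

Lemma unfold_vec_inj : injective (@unfold_vec K r).
Proof.
move=> z z' eq_zz'; apply/ffunP=> D.
by rewrite -[D]unfold_matchingK -!unfold_vecE eq_zz'.
Qed.

Lemma unfold_vec_surj (x : bspace K r r) : exists z, x = unfold_vec z.
Proof.
exists [ffun D => x (unfold_matching D)]; apply/ffunP=> E.
by rewrite unfold_vecE ffunE fold_matchingK.
Qed.

(** [unfold_vec] is a linear bijection. *)
Lemma unfold_basis (Ker : {vspace {ffun matching 'I_N -> K^o}}) (U : {vspace bspace K r r})
    (X : seq {ffun matching 'I_N -> K^o}) :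
  (forall z, (unfold_vec z \in U) = (z \in Ker)) -> basis_of Ker X ->
  basis_of U (map (@unfold_vec K r) X).
Proof.
move=> UE X_basis; pose f := linfun (@unfold_vec K r).
have fE : f =1 @unfold_vec K r by move=> z; rewrite lfunE.
have f_inj : lker f = 0%VS by apply/eqP/lker0P => z z'; rewrite !fE; apply: unfold_vec_inj.
have -> : U = (f @: Ker)%VS.
  apply/vspaceP=> x; apply/idP/memv_imgP => [xU|[z zK ->]]; last by rewrite fE UE.
  by have [z xE] := unfold_vec_surj x; exists z; rewrite ?fE // -UE -xE.
rewrite -(eq_map fE); apply: limg_basis_of X_basis.
by rewrite f_inj capv0.
Qed.

End PhiVector.

Section Containment.
Variables (m n r : nat).

(** The parts decrease, so only the last row of the rectangle matters. *)
Lemma containsP N la : is_partition N la ->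
  contains la (lambda_c m n) = (2 * n + 2 <= nth 0 la m)%N.
Proof.
move=> la_part; apply/forallP/idP => [/(_ (cast_ord (esym (size_nseq _ _)) ord_max))|le_m i] /=.
  by rewrite nth_nseq ltnSn.
have lt_i : (i < m.+1)%N by rewrite -[m.+1](size_nseq _ (2 * n + 2)%N).
rewrite nth_nseq lt_i; apply: leq_trans le_m _.
exact: (nth_part_anti la_part).
Qed.

(** A part smaller than 2n + 2 and even is at most 2n. *)
Lemma not_contains_hook la : la \in even_partitions r ->
  ~~ contains la (lambda_c m n) -> (nth 0 la m <= n.*2)%N.
Proof.
case/even_partP=> la_part /allP la_even; rewrite (containsP la_part) -ltnNge mul2n addn2 ltnS.
rewrite leq_eqVlt => /orP[/eqP E|//].
have [lt_m|/(nth_default 0) E0] := ltnP m (size la); last by rewrite E0 in E.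
by have := la_even _ (mem_nth 0 lt_m); rewrite E /= odd_double.
Qed.
End Containment.

Lemma Theta_unfold (K : numClosedFieldType) m n r :
  Theta K m n r = map (@unfold_vec K r) [seq theta_vec K p.1 p.2
    | p <- tab_pairs r [seq la <- even_partitions r | contains la (lambda_c m n)]].
Proof.
rewrite /Theta /tab_pairs -map_comp map_allpairs; congr flatten.
apply: eq_map => la; apply: eq_map => t /=.
by rewrite Phi_unfold sym_act_unfold.
Qed.

Section Kernel.
Variables (K : numClosedFieldType) (m n : nat) (V : osp_space K m n).
Variable (F : forall k l, 'Hom(bspace K k l, 'Hom(tpow V k, tpow V l))).
Hypotheses (FF : brauer_functor F).
Variable r : nat.

(** In this case m = n = 0 and all the positive tensor powers vanish, so the kernel is everything;
every even partition contains the rectangle (2). *)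
Lemma basis_trivial : sdimn V = 0%N -> (0 < r)%N -> basis_of (lker (F r r)) (Theta K m n r).
Proof.
move=> V0 r_gt0; have : (m + n == 0)%N.
  by rewrite -leqn0 -V0 /sdimn osp_dim_even osp_dim_odd leq_add2l leq_pmull.
rewrite addn_eq0 => /andP[/eqP m0 /eqP n0].
have tpow0 (x y : tpow V r) : x = y.
  by apply/ffunP=> f; have : (f (Ordinal r_gt0) < 0)%N by rewrite -[in X in (_ < X)%N]V0.
rewrite Theta_unfold; apply: (@unfold_basis _ _ fullv) => [z|].
  by rewrite memvf memv_ker; apply/eqP/lfunP=> x; apply: tpow0.
have := theta_basis K r; rewrite (_ : [seq la <- _ | _] = even_partitions r) //.
apply/all_filterP/allP=> la laL; have [la_part la_even] := even_partP laL.
rewrite (containsP _ _ la_part) m0 n0 /=.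
case: la {laL} la_part la_even => [|a la] /and3P[_ pos /eqP sum_la] /=.
  by move: r_gt0 sum_la; case: (r).
by case: a pos {sum_la} => [|[|a]].
Qed.

Lemma basis_nontrivial : (0 < sdimn V)%N -> basis_of (lker (F r r)) (Theta K m n r).
Proof.
move=> V_neq0; pose cap := linfun (@cap_form K m n V F r).
have capE z : (z \in lker cap) = (cap_form F z == 0).
  by rewrite memv_ker linfunE //; apply: cap_form_linear.
rewrite Theta_unfold; apply: (@unfold_basis _ _ (lker cap)) => [z|].
  by rewrite capE (bend_kernel FF V_neq0).
apply: theta_kernel_basis => [s z|la laL|la laL no_c].
- by rewrite !capE (cap_form_pact FF) => /eqP->; rewrite comp_lfun0l.
- have [la_part _] := even_partP laL; rewrite (containsP _ _ la_part) => le_m.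
  rewrite capE; apply/eqP/(cap_form_uvec0 FF V_neq0 la_part).
  by apply: leq_trans le_m; rewrite addn2 ltnS leqnSn.
have [la_part la_even] := even_partP laL.
have hook := not_contains_hook laL no_c.
have [ev [ev_size ev_in ev_form]] := even_orthogonal_basis V.
have [od [od_size od_in od_form]] := odd_symplectic_basis V.
rewrite capE; apply: (cap_form_rsym_casym_neq0 FF V_neq0 la_part la_even hook _ _ ev_form od_form) => i lt_i.
  by apply/ev_in/mem_nth; rewrite ev_size.
by apply/od_in/mem_nth; rewrite od_size.
Qed.

End Kernel.

Unset Implicit Arguments.
Theorem theorem3p25 (R : realType) (m n : nat) (V : osp_space R[i] m n)
    (F : forall k l,
       'Hom(bspace R[i] k l, 'Hom(tpow V k, tpow V l)))
    (F_functor : brauer_functor F)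
    (r : nat) (r_ge : (m.+1 * n.+1 <= r)%N) :
  basis_of (lker (F r r)) (Theta R[i] m n r).
Proof.
have [V0|V_neq0] := posnP (sdimn V); last exact: basis_nontrivial.
by apply: basis_trivial => //; apply: leq_trans r_ge.
Qed.
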